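(* Let $X, X_1, X_2, \ldots$ be i.i.d. real random variables, $S_n=\sum_{k=1}^n X_k$ and $M_n=\max_{1\le k\le n}|S_k|$. For $b>-1$ and $0<\sigma<\infty$ consider the statement $$( * )\qquad \lim_{\epsilon\nearrow\infty}\epsilon^{-2(b+1)}\sum_{n=1}^{\infty}\frac{(\log\log n)^b}{n\log n}\,P\Big\{M_n\le\sigma\phi(n)\epsilon\Big\}=\frac{4}{\pi}\Gamma(b+1)\sum_{k=0}^{\infty}\frac{(-1)^k}{(2k+1)^{2b+3}}.$$ (Direct part) Suppose that $E X=0$ and $E X^2=\sigma^2$ with $0<\sigma<\infty$. Then $( * )$ holds for every $b>-1$. (Converse part) If $( * )$ holds for some $b>-1$ and $0<\sigma<\infty$, then $E X=0$ and $E X^2=\sigma^2$.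
   Context: Conventions: $\log x=\ln(x\vee e)$ (so $\log x\ge 1$), $\log\log x=\log(\log x)$, and $\phi(x)=\sqrt{\pi^2 x/(8\log\log x)}$. $\Gamma$ is the gamma function. *)

(* Defs.v *)
From mathcomp Require Import all_boot all_order all_algebra finmap.
From mathcomp Require Import all_classical all_reals all_analysis.

Set Implicit Arguments.
Unset Strict Implicit.
Unset Printing Implicit Defensive.

Import Order.TTheory GRing.Theory Num.Theory.
Import numFieldNormedType.Exports.

Local Open Scope classical_set_scope.
Local Open Scope ring_scope.

Section RealFunctions.
Context {R : realType}.
Implicit Types x b : R.

(* Truncated logarithm ln (x \/ e); it is at least 1, hence so is its iterate
   [loglog], and [phi] involves no division by zero. *)
Definition logt x : R := ln (Num.max x (expR 1)).

Definition loglog x : R := logt (logt x).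

Definition phi x : R := Num.sqrt (pi ^+ 2 * x / (8 * loglog x)).

(* Euler's integral, convergent for 0 < x. *)
Definition Gamma x : R :=
  \int[lebesgue_measure]_(t in `]0, +oo[) (t `^ (x - 1) * expR (- t)).

(* Real-valued series: the limit of the partial sums, absolutely convergent for
   -1 < b. *)
Definition chung_constant b : R :=
  4 / pi * Gamma (b + 1)
  * \big[+%R/0]_(0 <= k <oo) ((-1) ^+ k / ((2 * k + 1)%:R `^ (2 * b + 3))).

End RealFunctions.

Section Probability.
Context {d : measure_display} {T : measurableType d} {R : realType}.
Variable P : probability T R.

Definition mutually_independent {I : choiceType} (X : I -> {RV P >-> R}) : Prop :=
  forall (J : {fset I}) (B : I -> set R), (forall i, measurable (B i)) ->
    P (\bigcap_(i in [set` J]) (X i @^-1` B i))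
    = (\prod_(i <- J) P (X i @^-1` B i))%E.

(* Equality of laws is required on measurable sets only: the values of a measure
   outside the sigma-algebra carry no meaning. *)
Definition identically_distributed {I : Type} (X : I -> {RV P >-> R}) : Prop :=
  forall (i j : I) (B : set R), measurable B ->
    distribution P (X i) B = distribution P (X j) B.

Definition iid {I : choiceType} (X : I -> {RV P >-> R}) : Prop :=
  mutually_independent X /\ identically_distributed X.

(* The sequence X, X_1, X_2, ... is indexed by nat with X in position 0; the
   partial sums start at index 1. *)
Definition partial_sum (X : nat -> {RV P >-> R}) (n : nat) (w : T) : R :=
  \sum_(1 <= k < n.+1) X k w.

Definition max_partial_sum (X : nat -> {RV P >-> R}) (n : nat) (w : T) : R :=
  \big[Num.max/0]_(1 <= k < n.+1) `|partial_sum X k w|.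

(* The series is taken in the extended reals, where a series of nonnegative terms
   always has a sum; convergence to the finite right-hand side forces that sum
   to be finite for all large eps. *)
Definition precise_chung_asymptotics
    (X : nat -> {RV P >-> R}) (b sigma : R) : Prop :=
  ((eps `^ (- 2 * (b + 1)))%:E *
     \sum_(1 <= n <oo)
       ((loglog n%:R `^ b / (n%:R * logt n%:R))%:E *
        P [set w | (max_partial_sum X n w <= sigma * phi n%:R * eps)%R]))%E
    @[eps --> +oo] --> (chung_constant b)%:E.

End Probability.

(* Main.v *)
(** Let [t h] be an odd multiple of [pi / 2], so that [cos (t s)] vanishes at [s = h] and [s = - h].
One step of the walk multiplies [E [cos (t S_n); M_n <= h]] by the real part of the characteristic
function at [t], up to the overshoot at the exit from [[-h, h]], so this expectation is close to
[exp (- t^2 sigma^2 n / 2)]. The Abel means of the expansion of [1] on [[-h, h]] in these cosines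
have the closed form [2/pi atan (2 r cos y / (1 - r^2))]; they yield the Erdos-Kac limit
[4/pi sum_k (-1)^k / (2k+1) exp (- (2k+1)^2 u)] of [P (M_n <= h)], where [u = pi^2 sigma^2 n / (8 h^2)],
which is [loglog n / eps^2] for [h = sigma phi(n) eps].

The weights [(loglog n)^b / (n log n)] discretize [y^b dy] at [y = loglog n], so that the normalized
sum of [exp (- lambda u)] tends to [Gamma (b+1) lambda^-(b+1)]; together with the limit above this
gives the constant. Large [u] are controlled by [P (M_n <= h) <= 2 exp (- c kappa n / h^2)] as soon as
[1 - |E e^(itX)|^2 >= kappa t^2] near [0], obtained by splitting the walk into blocks.

Conversely, if the variance is infinite then [kappa] can be taken arbitrarily large, and the limit
would be [0]; it would also be [0], by Chebyshev's inequality, for a nonzero mean. A zero variance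
makes the series diverge, and any other variance rescales [eps], which changes the limit. *)

(* No invariance principle is used: everything rests on one-step estimates for the characteristic
   function. With only a second moment, one step at frequency [t] costs a multiple of
   [t^2 * tail2 t], and [n] steps with [n t^2] bounded still cost [o(1)]. The overshoot would cost a
   fixed [eta] at each step, but it is charged to the probability of exiting at that step, and these
   probabilities add up to at most one.

   Partial Fourier sums of the square wave oscillate near its jumps. The Abel means stay between [0]
   and [1] on the interval and are close to [1] away from its ends, which gives a lower bound at
   level [h] and an upper bound after a slight increase of the level.

   The limit for [P (M_n <= h)] is uniform only for [u] in a compact part of the open half-line.
   Elsewhere the difference is dominated by exponentials in [u] with small explicit normalized sums,
   so the series is never split. The block bound sees only the modulus of the characteristic
   function near [0], which makes it available in the converse before any moment is known. *)
From HB Require Import structures.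
Require Import Defs.
From mathcomp Require Import all_boot all_order all_algebra finmap.
From mathcomp Require Import all_classical all_reals all_analysis.
From mathcomp Require Import measurable_realfun ring lra.

Set Implicit Arguments.
Unset Strict Implicit.
Unset Printing Implicit Defensive.

Import Order.TTheory GRing.Theory Num.Theory.
Import numFieldNormedType.Exports.

Local Open Scope classical_set_scope.
Local Open Scope ring_scope.

(** * Independence of the next step from the past *)

Section Independence.
Context {d : measure_display} {T : measurableType d} {R : realType}.
Variable P : probability T R.

(** Independence on rectangles identifies the law of the pair with the product law, by uniqueness of
    the product measure. The nonnegative form comes first in use: it yields the integrability that
    the signed form asks for. *)
Lemma independent_joint_integral d1 d2 (T1 : measurableType d1) (T2 : measurableType d2)
    (U : {mfun T >-> T1}) (V : {mfun T >-> T2}) :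
  (forall A B, measurable A -> measurable B ->
     P (U @^-1` A `&` V @^-1` B) = P (U @^-1` A) * P (V @^-1` B))%E ->
  (forall f : T1 * T2 -> \bar R, measurable_fun setT f -> (forall z, (0 <= f z)%E) ->
    (\int[distribution P U \x distribution P V]_z f z = \int[P]_w f (U w, V w))%E) /\
  (forall f : T1 * T2 -> \bar R, measurable_fun setT f ->
    P.-integrable setT (fun w => f (U w, V w)) ->
    (\int[distribution P U \x distribution P V]_z f z = \int[P]_w f (U w, V w))%E).
Proof.
move=> UV.
pose W w := (U w, V w).
have mW : measurable_fun setT W by exact: measurable_fun_pair.
pose W' : {mfun T >-> (T1 * T2)%type} := HB.pack W (isMeasurableFun.Build _ _ _ _ _ mW).
have law X : measurable X -> (distribution P U \x distribution P V)%E X = distribution P W' X.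
  apply: product_measure_unique => A B mA mB.
  by rewrite /distribution /pushforward/= -UV.
split => f mf hf.
  rewrite (eq_measure_integral (distribution P W')); last by move=> A mA _; exact: law.
  by rewrite (@ge0_integral_distribution _ _ _ _ _ _ W').
rewrite (eq_measure_integral (distribution P W')); last by move=> A mA _; exact: law.
by rewrite (@integral_distribution _ _ _ _ _ _ W').
Qed.

(** Tonelli for [|U V|] makes the product integrable; Fubini then factors the signed integral. *)
Lemma independent_RintegralM (U V : {RV P >-> R}) :
  (forall A B, measurable A -> measurable B ->
     P (U @^-1` A `&` V @^-1` B) = P (U @^-1` A) * P (V @^-1` B))%E ->
  P.-integrable setT (EFin \o U) -> P.-integrable setT (EFin \o V) ->
  P.-integrable setT (EFin \o (U \* V)) /\
  \int[P]_w (U w * V w) = \int[P]_w U w * \int[P]_w V w.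
Proof.
move=> UV iU iV.
pose m1 : probability _ R := distribution P U.
pose m2 : probability _ R := distribution P V.
have [law0 law1] := independent_joint_integral UV.
pose f (z : R * R) : R := z.1 * z.2.
have mf : measurable_fun setT f.
  by apply: measurable_funM; [exact: measurable_fst|exact: measurable_snd].
have mEf : measurable_fun setT (EFin \o f) by exact: measurableT_comp.
have absE : (\int[m1 \x m2]_z `|(EFin \o f) z| =
   (\int[P]_w `|(U w)%:E|) * (\int[P]_w `|(V w)%:E|))%E.
  have mabs : measurable_fun setT (fun z => `|(EFin \o f) z|%E).
    by do 2 apply: measurableT_comp => //.
  rewrite fubini_tonelli1//=.
  pose c := (\int[P]_w `|(V w)%:E|)%E.
  have c0 : (0 <= c)%E by apply: integral_ge0.
  transitivity (\int[m1]_x (`|x%:E| * c))%E.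
    apply: eq_integral => x _; rewrite /fubini_F/=.
    transitivity (\int[m2]_y (`|x%:E| * `|y%:E|))%E.
      by apply: eq_integral => y _; rewrite /f/= normrM EFinM.
    rewrite ge0_integralZl//; last by do 2 apply: measurableT_comp => //.
    congr (_ * _)%E.
    by rewrite ge0_integral_distribution//; do 2 apply: measurableT_comp => //.
  rewrite ge0_integralZr//; last by do 2 apply: measurableT_comp => //.
  congr (_ * _)%E.
  by rewrite ge0_integral_distribution//; do 2 apply: measurableT_comp => //.
have fin : ((\int[P]_w `|(U w)%:E|) * (\int[P]_w `|(V w)%:E|) < +oo)%E.
  move/integrableP : iU => [_]; move/integrableP : iV => [_] /= h1 h2.
  by rewrite lte_mul_pinfty// ?integral_ge0// ge0_fin_numE// integral_ge0.
have if_ : (m1 \x m2)%E.-integrable setT (EFin \o f).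
  by apply/integrableP; split => //; rewrite absE.
have iUV : P.-integrable setT (EFin \o (U \* V)).
  apply/integrableP; split.
    by apply/measurable_EFinP; exact: measurable_funM.
  by move: fin; rewrite -absE law0//; exact: measurableT_comp.
split => //.
rewrite /Rintegral.
have -> : (\int[P]_w (U w * V w)%:E = \int[m1 \x m2]_z (f z)%:E)%E.
  by rewrite law1.
rewrite -integral12_prod_meas1//= /fubini_F/=.
have abs_id (W : {RV P >-> R}) : P.-integrable setT (EFin \o W) ->
    (distribution P W).-integrable setT (EFin : R -> \bar R).
  move=> iW; apply/integrableP; split; first exact: measurableT_comp.
  rewrite ge0_integral_distribution//; last by do 2 apply: measurableT_comp => //.
  by move/integrableP : iW => [].
pose c := (\int[P]_w (V w)%:E)%E.
have finV : c \is a fin_num by exact: integrable_fin_num.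
have finU : (\int[P]_w (U w)%:E)%E \is a fin_num by exact: integrable_fin_num.
transitivity (fine (\int[m1]_x (x%:E * c))%E).
  congr fine; apply: eq_integral => x _.
  transitivity (\int[m2]_y (x%:E * y%:E))%E.
    by apply: eq_integral => y _; rewrite /f/= EFinM.
  rewrite integralZl//; last exact: abs_id.
  by congr (_ * _)%E; rewrite integral_distribution.
rewrite -fineM//; congr fine.
rewrite -(fineK finV) integralZr//; last exact: abs_id.
by congr (_ * _)%E; [rewrite integral_distribution|rewrite fineK].
Qed.

Variable X : nat -> {RV P >-> R}.

(** The rectangles in [X 0], ..., [X j]: a family stable under intersection, so that finite measures
    agreeing on it agree on the sigma-algebra it generates. *)
Definition past (j : nat) : set (set T) :=
  [set A | exists2 B : nat -> set R, (forall i, measurable (B i)) &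
    A = \bigcap_(i in [set k | (k <= j)%N]) (X i @^-1` B i)].

Lemma past_measurable j A : <<s past j >> A -> measurable A.
Proof.
apply: smallest_sub; first exact: sigma_algebra_measurable.
move=> _ [B mB ->]; apply: bigcap_measurable; first by exists 0%N.
by move=> k _; rewrite -[_ @^-1` _]setTI; exact: measurable_funP.
Qed.

Hypothesis indX : mutually_independent X.

(** For fixed [B], both sides are finite measures in [A]: the restriction of [P] to the event and a
    multiple of [P]. They agree on rectangles by mutual independence, hence on all of the past. *)
Lemma past_independent j A B : <<s past j >> A -> measurable B ->
  (P (A `&` X j.+1 @^-1` B) = P A * P (X j.+1 @^-1` B))%E.
Proof.
move=> sA mB.
have mV : measurable (X j.+1 @^-1` B).
  by rewrite -[_ @^-1` _]setTI; exact: measurable_funP.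
have finV := fin_num_measure P _ mV.
pose c : {nonneg R} := NngNum (fine_ge0 (measure_ge0 P (X j.+1 @^-1` B))).
suff : mrestr P mV A = mscale c P A.
  by rewrite /mrestr /mscale/= fineK// muleC.
apply: (g_sigma_algebra_measure_unique (past j) _ (fun=> setT)) => //.
- by move=> E /= pE; apply: (@past_measurable j); exact: sub_sigma_algebra.
- move=> _; exists (fun=> setT) => //.
  by apply/esym; rewrite -subTset => w _ k _.
- by rewrite bigcup_const.
- move=> _ _ [B1 mB1 ->] [B2 mB2 ->].
  exists (fun i => B1 i `&` B2 i); first by move=> i; exact: measurableI.
  rewrite predeqE => w; split=> [[h1 h2] i ij|h]; first by split; [exact: h1|exact: h2].
  by split=> i ij; have [] := h i ij.
- move=> _ [C mC ->].
  transitivity (P (\bigcap_(i in [set k | (k <= j)%N]) (X i @^-1` C i)) *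
                P (X j.+1 @^-1` B))%E; last first.
    by rewrite -(fineK finV) muleC.
  rewrite [LHS]/(P _).
  pose J := [fset x in iota 0 j.+1]%fset.
  have JE i : (i \in J) = (i <= j)%N by rewrite in_fset mem_iota ltnS.
  have jJ : j.+1 \notin J by rewrite JE ltnn.
  (* A rectangle over the indices up to [j] together with the event for [j.+1] is a single
     rectangle, to which mutual independence applies. *)
  pose D i := if i == j.+1 then B else C i.
  have mD i : measurable (D i) by rewrite /D; case: ifP.
  have h1 := indX (j.+1 |` J)%fset mD; have h2 := indX J mC.
  have e : \bigcap_(i in [set` J]) (X i @^-1` C i) =
           \bigcap_(i in [set k | (k <= j)%N]) (X i @^-1` C i).
    by congr bigcap; rewrite predeqE => i /=; rewrite JE.
  rewrite -e h2.
  have -> : \bigcap_(i in [set` J]) (X i @^-1` C i) `&` X j.+1 @^-1` B =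
     \bigcap_(i in [set` (j.+1 |` J)%fset]) (X i @^-1` D i).
    rewrite predeqE => w; split.
      move=> [h hB] i /=; rewrite in_fset1U => /orP[/eqP ->|iJ]; rewrite /D ?eqxx//.
      by case: eqP => [->//|_]; exact: h.
    move=> h; split.
      move=> i iJ; have := h i; rewrite /= in_fset1U/D => /=.
      have : i != j.+1 by apply: contraNneq jJ => <-.
      by move=> /negbTE ->; apply.
    by have := h j.+1; rewrite /= /D eqxx; apply; rewrite in_fset1U eqxx.
  transitivity (\prod_(i <- (j.+1 |` J)%fset) P (X i @^-1` D i))%E; first exact: h1.
  rewrite big_fsetU1//= {1}/D eqxx muleC; congr (_ * _)%E.
  rewrite big_seq [RHS]big_seq; apply: eq_bigr => i iJ.
  by rewrite /D; case: eqP => // ij; move: jJ; rewrite -ij iJ.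
- move=> _; rewrite [X in (X < _)%E](_ : _ = P (X j.+1 @^-1` B)); last first.
    by rewrite -[in RHS](setTI (_ @^-1` _)).
  by apply: (le_lt_trans (probability_le1 _ mV)); rewrite ltry.
Qed.

Definition adapted (j : nat) (Y : T -> R) :=
  measurable_fun setT (Y : g_sigma_algebraType (past j) -> R).

Lemma adapted_measurable j Y : adapted j Y -> measurable_fun setT Y.
Proof.
by move=> aY _ B mB; rewrite setTI; apply: (@past_measurable j);
   have := aY measurableT B mB; rewrite setTI.
Qed.

Lemma adapted_X j i : (i <= j)%N -> adapted j (X i).
Proof.
move=> ij _ B mB; rewrite setTI; apply: sub_sigma_algebra.
exists (fun k => if k == i then B else setT).
  by move=> k; case: ifP.
rewrite predeqE => w; split=> [wB k _|]; first by case: eqP => //= ->.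
by move/(_ i ij); rewrite eqxx.
Qed.

(** Stated for integrable rather than bounded factors because the variance of the walk needs it for
    the unbounded centered sums. *)
Lemma adapted_Rintegral j (Y : T -> R) (g : R -> R) :
  adapted j Y -> measurable_fun setT g ->
  P.-integrable setT (EFin \o Y) -> P.-integrable setT (EFin \o (g \o X j.+1)) ->
  P.-integrable setT (EFin \o (fun w => Y w * g (X j.+1 w))) /\
  \int[P]_w (Y w * g (X j.+1 w)) = \int[P]_w Y w * \int[P]_w g (X j.+1 w).
Proof.
move=> aY mg iY iX.
have mgX : measurable_fun setT (g \o X j.+1) by exact: measurableT_comp.
pose U : {RV P >-> R} := HB.pack Y (isMeasurableFun.Build _ _ _ _ _ (adapted_measurable aY)).
pose V : {RV P >-> R} := HB.pack (g \o X j.+1) (isMeasurableFun.Build _ _ _ _ _ mgX).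
apply: (@independent_RintegralM U V) => // A B mA mB.
rewrite (_ : V @^-1` B = X j.+1 @^-1` (g @^-1` B))//.
apply: past_independent; first by have := aY measurableT A mA; rewrite setTI.
by rewrite -[_ @^-1` _]setTI; exact: mg.
Qed.

End Independence.

(** * Expectations of bounded measurable functions *)

Section BoundedExpectation.
Context {d : measure_display} {T : measurableType d} {R : realType}.
Variable P : probability T R.
Implicit Types (f g : T -> R) (A : set T).

(** A class closed under the algebra used below and contained in the integrable functions, so that
    integrability side conditions are settled by structure. *)
Definition bddmeas f := measurable_fun setT f /\ exists C, forall w, `|f w| <= C.

Lemma bddmeas_integrable f : bddmeas f -> P.-integrable setT (EFin \o f).
Proof.
move=> [mf [C fC]]; apply: measurable_bounded_integrable => //.
- by apply: (le_lt_trans (probability_le1 P measurableT)); rewrite ltry.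
- by exists C; split; rewrite ?num_real// => x Cx w _; exact: le_trans (fC w) (ltW Cx).
Qed.

Lemma bddmeas_cst (a : R) : bddmeas (fun=> a).
Proof. by split; [exact: measurable_cst | exists `|a|]. Qed.

Lemma bddmeasD f g : bddmeas f -> bddmeas g -> bddmeas (fun w => f w + g w).
Proof.
move=> [mf [C fC]] [mg [D gD]]; split; first exact: measurable_funD.
by exists (C + D) => w; rewrite (le_trans (ler_normD _ _))// lerD.
Qed.

Lemma bddmeasM f g : bddmeas f -> bddmeas g -> bddmeas (fun w => f w * g w).
Proof.
move=> [mf [C fC]] [mg [D gD]]; split; first exact: measurable_funM.
by exists (C * D) => w; rewrite normrM ler_pM.
Qed.

Lemma bddmeasZ (a : R) f : bddmeas f -> bddmeas (fun w => a * f w).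
Proof. by apply: bddmeasM; exact: bddmeas_cst. Qed.

Lemma bddmeasN f : bddmeas f -> bddmeas (fun w => - f w).
Proof.
by move=> /(bddmeasZ (-1)) h; rewrite (_ : (fun w => _) = (fun w => -1 * f w))//;
  apply/funext => w; rewrite mulN1r.
Qed.

Lemma bddmeasB f g : bddmeas f -> bddmeas g -> bddmeas (fun w => f w - g w).
Proof. by move=> bf bg; apply: bddmeasD => //; exact: bddmeasN. Qed.

Lemma bddmeas_cos f : measurable_fun setT f -> bddmeas (fun w => cos (f w)).
Proof.
move=> mf; split; last by exists 1 => w; rewrite ler_norml cos_geN1 cos_le1.
by apply: measurableT_comp => //; apply: continuous_measurable_fun; exact: continuous_cos.
Qed.

Lemma bddmeas_sin f : measurable_fun setT f -> bddmeas (fun w => sin (f w)).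
Proof.
move=> mf; split; last by exists 1 => w; rewrite ler_norml sin_geN1 sin_le1.
by apply: measurableT_comp => //; apply: continuous_measurable_fun; exact: continuous_sin.
Qed.

Lemma bddmeas_indic A : measurable A -> bddmeas (\1_A : T -> R).
Proof.
move=> mA; split; first exact: measurable_indic.
by exists 1 => w; rewrite indicE; case: (w \in A); rewrite ?normr1 ?normr0.
Qed.

Definition Ex f : R := \int[P]_w f w.

Lemma eq_Ex f g : f =1 g -> Ex f = Ex g.
Proof. by move=> fg; apply: eq_Rintegral => w _. Qed.

Lemma ExD f g : bddmeas f -> bddmeas g -> Ex (fun w => f w + g w) = Ex f + Ex g.
Proof. by move=> bf bg; rewrite /Ex RintegralD//; exact: bddmeas_integrable. Qed.

Lemma ExB f g : bddmeas f -> bddmeas g -> Ex (fun w => f w - g w) = Ex f - Ex g.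
Proof. by move=> bf bg; rewrite /Ex RintegralB//; exact: bddmeas_integrable. Qed.

Lemma ExZ (a : R) f : bddmeas f -> Ex (fun w => a * f w) = a * Ex f.
Proof. by move=> bf; rewrite /Ex RintegralZl//; exact: bddmeas_integrable. Qed.

Lemma Ex_cst (a : R) : Ex (fun=> a) = a.
Proof.
rewrite /Ex Rintegral_cst// -[RHS]mulr1.
by congr (_ * _); rewrite -[RHS]/(fine 1%:E); congr fine; exact: probability_setT.
Qed.

Lemma le_Ex f g : bddmeas f -> bddmeas g -> (forall w, f w <= g w) -> Ex f <= Ex g.
Proof. by move=> bf bg fg; apply: le_Rintegral => //; exact: bddmeas_integrable. Qed.

Lemma Ex_ge0 f : (forall w, 0 <= f w) -> 0 <= Ex f.
Proof. by move=> f0; exact: Rintegral_ge0. Qed.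

Lemma Ex_indic A : measurable A -> Ex \1_A = fine (P A).
Proof. by move=> mA; rewrite /Ex /Rintegral integral_indic// setIT. Qed.

Lemma normr_Ex f g : bddmeas f -> bddmeas g -> (forall w, `|f w| <= g w) ->
  `|Ex f| <= Ex g.
Proof.
move=> bf bg fg; rewrite ler_norml; apply/andP; split.
  rewrite -[leLHS]mulN1r -ExZ//; apply: le_Ex => //; first exact: bddmeasZ.
  by move=> w; have := fg w; rewrite ler_norml mulN1r => /andP[].
by apply: le_Ex => // w; have := fg w; rewrite ler_norml => /andP[].
Qed.

Lemma bddmeas_sum (I : Type) (r : seq I) (F : I -> T -> R) :
  (forall i, bddmeas (F i)) -> bddmeas (fun w => \sum_(i <- r) F i w).
Proof.
move=> bF; elim: r => [|i r IH].
  by under eq_fun do rewrite big_nil; exact: bddmeas_cst.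
by under eq_fun do rewrite big_cons; exact: bddmeasD.
Qed.

Lemma Ex_sum (I : Type) (r : seq I) (F : I -> T -> R) :
  (forall i, bddmeas (F i)) -> Ex (fun w => \sum_(i <- r) F i w) = \sum_(i <- r) Ex (F i).
Proof.
move=> bF; elim: r => [|i r IH].
  by rewrite big_nil -[RHS](Ex_cst 0); apply: eq_Ex => w; rewrite big_nil.
rewrite big_cons -IH -ExD//; last exact: bddmeas_sum.
by apply: eq_Ex => w; rewrite big_cons.
Qed.

End BoundedExpectation.

(** * The walk, its running maximum and its filtration *)

Section Walk.
Context {d : measure_display} {T : measurableType d} {R : realType}.
Variables (P : probability T R) (X : nat -> {RV P >-> R}).
Hypothesis iidX : iid X.

Local Notation S := (partial_sum X).
Local Notation M := (max_partial_sum X).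
Local Notation E := (Ex P).
Local Notation past := (past X).
Local Notation adapted := (adapted X).

Lemma partial_sum0 w : S 0 w = 0.
Proof. by rewrite /partial_sum big_nil. Qed.

Lemma partial_sumS n w : S n.+1 w = S n w + X n.+1 w.
Proof. by rewrite /partial_sum big_nat_recr. Qed.

Lemma max_partial_sum0 w : M 0 w = 0.
Proof. by rewrite /max_partial_sum big_nil. Qed.

Lemma max_partial_sumS n w : M n.+1 w = Num.max (M n w) `|S n.+1 w|.
Proof.
(* The default [0] is not neutral for [Num.max] on the reals, so the last term is moved by
   commutativity and associativity instead. *)
have rcons_max (F : nat -> R) x s : (forall i, 0 <= F i) ->
    \big[Num.max/0]_(i <- rcons s x) F i = Num.max (\big[Num.max/0]_(i <- s) F i) (F x).
  move=> F0; elim: s => [|y s IH]; first by rewrite /= !big_cons !big_nil maxC.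
  by rewrite rcons_cons !big_cons IH maxA.
rewrite /max_partial_sum (_ : index_iota 1 n.+2 = rcons (index_iota 1 n.+1) n.+1).
  by rewrite rcons_max.
have h : iota 1 (n + 1) = rcons (iota 1 n) n.+1 by rewrite iotaD cats1 add1n.
by rewrite /index_iota !subSS !subn0 -h addn1.
Qed.

Lemma le_max_partial_sum n w : `|S n w| <= M n w.
Proof.
case: n => [|n]; first by rewrite partial_sum0 max_partial_sum0 normr0.
by rewrite max_partial_sumS le_max lexx orbT.
Qed.

Lemma max_partial_sum_homo m n w : (m <= n)%N -> M m w <= M n w.
Proof.
elim: n => [|n IH]; first by rewrite leqn0 => /eqP ->.
rewrite leq_eqVlt => /predU1P[->//|]; rewrite ltnS => /IH h.
by rewrite max_partial_sumS le_max h.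
Qed.

Lemma adapted_partial_sum i j : (i <= j)%N -> adapted j (S i).
Proof.
elim: i => [|i IH] ij; first (rewrite /adapted (_ : S 0 = fun=> 0); last by
  apply/funext => w; rewrite partial_sum0); first exact: measurable_cst.
rewrite /adapted (_ : S i.+1 = fun w => S i w + X i.+1 w); last first.
  by apply/funext => w; rewrite partial_sumS.
by apply: measurable_funD; [exact: (IH (ltnW ij)) | exact: adapted_X].
Qed.

Lemma adapted_max_partial_sum i j : (i <= j)%N -> adapted j (M i).
Proof.
elim: i => [|i IH] ij; first (rewrite /adapted (_ : M 0 = fun=> 0); last by
  apply/funext => w; rewrite max_partial_sum0); first exact: measurable_cst.
rewrite /adapted (_ : M i.+1 = fun w => Num.max (M i w) `|S i.+1 w|); last first.
  by apply/funext => w; rewrite max_partial_sumS.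
apply: measurable_maxr; first exact: (IH (ltnW ij)).
by apply: measurableT_comp => //; exact: adapted_partial_sum.
Qed.

Definition survive n (h : R) : set T := [set w | M n w <= h].

Lemma adapted_survive i j h : (i <= j)%N -> adapted j (\1_(survive i h) : T -> R).
Proof.
move=> ij; apply: (@measurable_indic _ (g_sigma_algebraType (past j))).
have := adapted_max_partial_sum ij measurableT (measurable_itv `]-oo, h]).
by rewrite setTI; congr (measurable _); rewrite predeqE => w /=; rewrite in_itv.
Qed.

Lemma measurable_partial_sum n : measurable_fun setT (S n).
Proof. by apply: adapted_measurable; exact: (@adapted_partial_sum n n). Qed.

Lemma measurable_survive n h : measurable (survive n h).
Proof.
have := adapted_measurable (adapted_max_partial_sum (leqnn n)) measurableT
  (measurable_itv `]-oo, h]).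
by rewrite setTI; congr (measurable _); rewrite predeqE => w /=; rewrite in_itv.
Qed.

Definition psurv n h : R := fine (P (survive n h)).

Lemma psurvE n h : psurv n h = E \1_(survive n h).
Proof. by rewrite Ex_indic//; exact: measurable_survive. Qed.

Lemma psurv_ge0 n h : 0 <= psurv n h.
Proof. exact: fine_ge0. Qed.

Lemma EFin_psurv n h : (psurv n h)%:E = P (survive n h).
Proof. by rewrite fineK// fin_num_measure//; exact: measurable_survive. Qed.

Lemma psurv_le1 n h : psurv n h <= 1.
Proof. by rewrite -lee_fin EFin_psurv probability_le1//; exact: measurable_survive. Qed.

Lemma psurv_anti m n h : (m <= n)%N -> psurv n h <= psurv m h.
Proof.
move=> mn; rewrite -lee_fin !EFin_psurv le_measure ?inE//; try exact: measurable_survive.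
by move=> w /=; rewrite /survive/=; apply: le_trans; exact: max_partial_sum_homo.
Qed.

Lemma distribution_X n B : measurable B -> distribution P (X n) B = distribution P (X 0%N) B.
Proof. by move=> mB; have [_ idX] := iidX; exact: idX. Qed.

Lemma ge0_integral_X n (g : R -> \bar R) : measurable_fun setT g -> (forall x, 0 <= g x)%E ->
  (\int[P]_w g (X n w) = \int[P]_w g (X 0%N w))%E.
Proof.
move=> mg g0; have h k : (\int[P]_w g (X k w) = \int[distribution P (X k)]_x g x)%E.
  by rewrite ge0_integral_distribution.
rewrite !h; apply: eq_measure_integral => B mB _; exact: distribution_X.
Qed.

Lemma integrable_X n (g : R -> R) : measurable_fun setT g ->
  P.-integrable setT (EFin \o (g \o X 0%N)) -> P.-integrable setT (EFin \o (g \o X n)).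
Proof.
move=> mg /integrableP[_ i0]; apply/integrableP; split.
  by apply: measurableT_comp => //; exact: measurableT_comp.
rewrite (_ : (\int[P]_x _ = \int[P]_x `|(g (X 0%N x))%:E|)%E)//.
rewrite -(@ge0_integral_X n (fun x => `|(g x)%:E|%E))//.
by do 2 apply: measurableT_comp => //.
Qed.

Lemma Ex_X n (g : R -> R) : measurable_fun setT g ->
  P.-integrable setT (EFin \o (g \o X 0%N)) -> E (g \o X n) = E (g \o X 0%N).
Proof.
move=> mg i0; congr fine.
have h k : (\int[P]_w (g (X k w))%:E = \int[distribution P (X k)]_x (g x)%:E)%E.
  by rewrite integral_distribution//; [exact: measurableT_comp|exact: integrable_X].
rewrite !h; apply: eq_measure_integral => B mB _; exact: distribution_X.
Qed.

Lemma adapted_Ex j Y (g : R -> R) : adapted j Y -> bddmeas Y ->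
  measurable_fun setT g -> (exists C, forall x, `|g x| <= C) ->
  E (fun w => Y w * g (X j.+1 w)) = E Y * E (g \o X 0%N).
Proof.
move=> aY bY mg [C gC].
have bg n : bddmeas (g \o X n).
  by split; [exact: measurableT_comp | exists C => w; exact: gC].
rewrite -(@Ex_X j.+1)//; last exact: bddmeas_integrable.
have [ind _] := iidX.
by have [_ h] := adapted_Rintegral ind aY mg (bddmeas_integrable _ bY) (bddmeas_integrable _ (bg _)); exact: h.
Qed.

(** Real and imaginary parts of the characteristic function of the common law. *)
Definition chr_cos (t : R) : R := E (fun w => cos (t * X 0%N w)).
Definition chr_sin (t : R) : R := E (fun w => sin (t * X 0%N w)).

Lemma measurable_Zl (t : R) (f : T -> R) :
  measurable_fun setT f -> measurable_fun setT (fun w => t * f w).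
Proof. by move=> mf; exact: measurable_funM. Qed.

Lemma bddmeas_cosS (t : R) n : bddmeas (fun w => cos (t * S n w)).
Proof. by apply/bddmeas_cos/measurable_Zl; exact: measurable_partial_sum. Qed.

Lemma bddmeas_sinS (t : R) n : bddmeas (fun w => sin (t * S n w)).
Proof. by apply/bddmeas_sin/measurable_Zl; exact: measurable_partial_sum. Qed.

(** The two real components of [E [Y e^(i t S_(j+1))] = E [Y e^(i t S_j)] E [e^(i t X)]], from the
    addition formulas and the independence of [X j.+1] from the past. *)
Lemma chr_step j (Y : T -> R) (t : R) : adapted j Y -> bddmeas Y ->
  E (fun w => Y w * cos (t * S j.+1 w)) =
    E (fun w => Y w * cos (t * S j w)) * chr_cos t
    - E (fun w => Y w * sin (t * S j w)) * chr_sin t /\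
  E (fun w => Y w * sin (t * S j.+1 w)) =
    E (fun w => Y w * sin (t * S j w)) * chr_cos t
    + E (fun w => Y w * cos (t * S j w)) * chr_sin t.
Proof.
move=> aY bY.
have mcos : measurable_fun setT (fun x : R => cos (t * x)).
  by apply: measurableT_comp; [apply: continuous_measurable_fun; exact: continuous_cos|exact: measurable_funM].
have msin : measurable_fun setT (fun x : R => sin (t * x)).
  by apply: measurableT_comp; [apply: continuous_measurable_fun; exact: continuous_sin|exact: measurable_funM].
have bcos : exists C, forall x : R, `|cos (t * x)| <= C.
  by exists 1 => x; rewrite ler_norml cos_geN1 cos_le1.
have bsin : exists C, forall x : R, `|sin (t * x)| <= C.
  by exists 1 => x; rewrite ler_norml sin_geN1 sin_le1.
have aS := adapted_partial_sum (leqnn j).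
have ac : adapted j (fun w => Y w * cos (t * S j w)).
  apply: measurable_funM => //.
  by apply: measurableT_comp; [apply: continuous_measurable_fun; exact: continuous_cos|exact: measurable_funM].
have as_ : adapted j (fun w => Y w * sin (t * S j w)).
  apply: measurable_funM => //.
  by apply: measurableT_comp; [apply: continuous_measurable_fun; exact: continuous_sin|exact: measurable_funM].
have bc := bddmeasM bY (bddmeas_cosS t j).
have bs := bddmeasM bY (bddmeas_sinS t j).
have bX (g : R -> R) : measurable_fun setT g -> (exists C, forall x, `|g x| <= C) ->
    bddmeas (fun w => g (X j.+1 w)).
  by move=> mg [C gC]; split; [exact: measurableT_comp | exists C => w; exact: gC].
split.
- transitivity (E (fun w => Y w * cos (t * S j w) * cos (t * X j.+1 w)
                       - Y w * sin (t * S j w) * sin (t * X j.+1 w))).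
    by apply: eq_Ex => w; rewrite partial_sumS mulrDr cosD mulrBr !mulrA.
  rewrite ExB.
  - by rewrite (adapted_Ex ac bc mcos bcos) (adapted_Ex as_ bs msin bsin).
  - by apply: bddmeasM => //; apply: (bX (fun x => cos (t * x))).
  - by apply: bddmeasM => //; apply: (bX (fun x => sin (t * x))).
- transitivity (E (fun w => Y w * sin (t * S j w) * cos (t * X j.+1 w)
                       + Y w * cos (t * S j w) * sin (t * X j.+1 w))).
    by apply: eq_Ex => w; rewrite partial_sumS mulrDr sinD mulrDr !mulrA.
  rewrite ExD.
  - by rewrite (adapted_Ex ac bc msin bsin) (adapted_Ex as_ bs mcos bcos).
  - by apply: bddmeasM => //; apply: (bX (fun x => cos (t * x))).
  - by apply: bddmeasM => //; apply: (bX (fun x => sin (t * x))).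
Qed.

End Walk.

(** * Taylor bounds for sine and cosine *)

Section TrigonometricBounds.
Context {R : realType}.
Implicit Types x y t : R.

Lemma le_norm_MVT (f df : R -> R) (a b K : R) : a <= b ->
  (forall x, a <= x <= b -> is_derive x 1 f (df x)) ->
  (forall x, a <= x <= b -> `|df x| <= K) -> `|f b - f a| <= K * (b - a).
Proof.
move=> ab dfx dfK.
have [||c] := @MVT_segment _ f df a b ab.
- by move=> x; rewrite in_itv/= => /andP[ax xb]; apply: dfx; rewrite !ltW.
- apply: derivable_within_continuous => x; rewrite in_itv/= => xab.
  by have := dfx x xab => h; exact: ex_derive.
rewrite in_itv/= => cab ->.
by rewrite normrM (@ger0_norm _ (b - a)) ?subr_ge0// ler_wpM2r ?subr_ge0// dfK.
Qed.

Lemma norm_sin_le x : `|sin x| <= `|x|.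
Proof.
wlog x0 : x / 0 <= x.
  move=> H; have [/H//|/ltW xn] := leP 0 x.
  by rewrite -normrN -sinN -[leRHS]normrN; apply: H; rewrite oppr_ge0.
have := @le_norm_MVT sin cos 0 x 1 x0.
rewrite sin0 !subr0 mul1r (ger0_norm x0); apply => y _.

by rewrite cos_max.
Qed.

Lemma one_sub_cosE x : 1 - cos x = 2 * sin (x / 2) ^+ 2.
Proof.
rewrite {1}(_ : x = (x / 2) *+ 2); last by rewrite mulr2n -splitr.
by rewrite cos_mulr2n cos2sin2; ring.
Qed.

Lemma one_sub_cos_bounds x : 0 <= 1 - cos x <= x ^+ 2 / 2.
Proof.
rewrite subr_ge0 cos_le1/= one_sub_cosE.
have : sin (x / 2) ^+ 2 <= (x / 2) ^+ 2.
  by rewrite -[leLHS]real_normK ?num_real// -[leRHS]real_normK ?num_real// lerXn2r ?nnegrE// norm_sin_le.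
by rewrite exprMn; set s := sin _ ^+ 2; lra.
Qed.

Lemma cos_ge_half x : `|x| <= 1 -> 1 / 2 <= cos x.
Proof.
move=> x1; have /andP[_] := one_sub_cos_bounds x.
have : x ^+ 2 <= 1 by rewrite -[leLHS]real_normK ?num_real// expr_le1.
by lra.
Qed.

Lemma norm_sin_sub_cube x : `|sin x - x| <= `|x| ^+ 3 / 2.
Proof.
wlog x0 : x / 0 <= x.
  move=> H; have [/H//|/ltW xn] := leP 0 x.
  have := H (- x); rewrite sinN oppr_ge0 normrN opprK => /(_ xn).
  by rewrite -[X in `|X| <= _]opprK normrN opprD opprK.
have := @le_norm_MVT (fun y => sin y - y) (fun y => cos y - 1) 0 x (x ^+ 2 / 2) x0.
rewrite sin0 !subr0 (ger0_norm x0) (_ : x ^+ 2 / 2 * x = x ^+ 3 / 2); last by ring.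
apply => y /andP[y0 yx].
have /andP[h1 h2] := one_sub_cos_bounds y.
rewrite distrC ger0_norm// (le_trans h2)// ler_wpM2r// ?invr_ge0//.
by rewrite lerXn2r// nnegrE (le_trans y0).
Qed.

(** Quadratic for large [x], cubic for small [x]. At [t * X] the right-hand side has mean
    [2 t^2 tail2 t], which is [o(t^2)] under a second moment alone. *)
Lemma norm_sin_sub x : `|sin x - x| <= 2 * (x ^+ 2 * Num.min 1 `|x|).
Proof.
have hx := normr_ge0 x.
have e : x ^+ 2 = `|x| ^+ 2 by rewrite real_normK ?num_real.
rewrite e; have [x1|x1] := leP 1 `|x|.
- rewrite mulr1 (le_trans (ler_normB _ _))//.
  apply: (@le_trans _ _ (2 * `|x|)).
    by have := norm_sin_le x; lra.
  by rewrite ler_pM2l// expr2 ler_peMl.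
- apply: le_trans (norm_sin_sub_cube x) _.
  rewrite -exprSr; have : 0 <= `|x| ^+ 3 by rewrite exprn_ge0.
  by set z := `|x| ^+ 3; lra.
Qed.

Lemma norm_cos_sub x : `|cos x - 1 + x ^+ 2 / 2| <= x ^+ 2 * Num.min 1 `|x|.
Proof.
have hx := normr_ge0 x.
have e : x ^+ 2 = `|x| ^+ 2 by rewrite real_normK ?num_real.
have /andP[h1 h2] := one_sub_cos_bounds x.
have [x1|x1] := leP 1 `|x|.
- rewrite mulr1 ger0_norm; last by lra.
  by have : 0 <= x ^+ 2 by [rewrite sqr_ge0]; lra.
- rewrite (_ : cos x - 1 = - (1 - cos x)); last by ring.
  rewrite one_sub_cosE; set s := sin (x / 2).
  have -> : - (2 * s ^+ 2) + x ^+ 2 / 2 = - 2 * ((s - x / 2) * (s + x / 2)) by field.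
  have a1 := norm_sin_sub_cube (x / 2).
  have a2 : `|s + x / 2| <= `|x|.
    apply: le_trans (ler_normD _ _) _.
    by have := norm_sin_le (x / 2); rewrite -/s normrM (@ger0_norm _ (2^-1))//; lra.
  rewrite !normrM e -exprSr.
  have -> : `| - 2 | = 2 :> R by rewrite normrN ger0_norm.
  have a3 : `|s - x / 2| * `|s + x / 2| <= (`|x / 2| ^+ 3 / 2) * `|x|.
    by apply: ler_pM.
  rewrite normrM (@ger0_norm _ (2^-1))// in a3.
  have : (`|x| / 2) ^+ 3 / 2 * `|x| = (`|x| ^+ 3 * `|x|) / 16 by field.
  have x30 : 0 <= `|x| ^+ 3 by rewrite exprn_ge0.
  have : `|x| ^+ 3 * `|x| <= `|x| ^+ 3 * 1 by rewrite ler_wpM2l// ltW.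
  by move: x30 a3; set z := `|x| ^+ 3; lra.
Qed.

Lemma cos_lipschitz x y : `|cos x - cos y| <= `|x - y|.
Proof.
wlog xy : x y / y <= x.
  by move=> H; have [/H//|/ltW yx] := leP y x; rewrite distrC [leRHS]distrC; exact: H.
rewrite [leRHS]ger0_norm ?subr_ge0// -[leRHS]mul1r.
apply: (@le_norm_MVT cos (fun z => - sin z)) => // z _.
by rewrite normrN sin_max.
Qed.

End TrigonometricBounds.

Lemma integrable_Zl d (T : measurableType d) (R : realType) (mu : {measure set T -> \bar R})
    (k : R) (f : T -> R) : mu.-integrable setT (EFin \o f) ->
  mu.-integrable setT (EFin \o (fun w => k * f w)).
Proof. by move=> fi; exact: (integrableZl measurableT k fi). Qed.

Lemma integrable_add d (T : measurableType d) (R : realType) (mu : {measure set T -> \bar R})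
    (f g : T -> R) : mu.-integrable setT (EFin \o f) -> mu.-integrable setT (EFin \o g) ->
  mu.-integrable setT (EFin \o (fun w => f w + g w)).
Proof. by move=> fi gi; exact: (integrableD measurableT fi gi). Qed.

Lemma integrable_sub d (T : measurableType d) (R : realType) (mu : {measure set T -> \bar R})
    (f g : T -> R) : mu.-integrable setT (EFin \o f) -> mu.-integrable setT (EFin \o g) ->
  mu.-integrable setT (EFin \o (fun w => f w - g w)).
Proof. by move=> fi gi; exact: (integrableB measurableT fi gi). Qed.

(** * Characteristic function near the origin *)

Section CharacteristicFunction.
Context {d : measure_display} {T : measurableType d} {R : realType}.
Variables (P : probability T R) (X : nat -> {RV P >-> R}).
Hypothesis iidX : iid X.
Hypothesis X2int : P.-integrable setT (EFin \o (fun w => X 0%N w ^+ 2)).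

Local Notation E := (Ex P).
Local Notation X0 := (X 0%N).

(** The uncentered second moment, equal to the variance once the mean is known to vanish. *)
Definition var0 : R := E (fun w => X0 w ^+ 2).

(* Tends to [0] with [t] by dominated convergence and controls every error term below. *)
Definition tail2 (t : R) : R := E (fun w => X0 w ^+ 2 * Num.min 1 `|t * X0 w|).

Lemma measurable_sqr_min (t : R) : measurable_fun setT (fun x : R => x ^+ 2 * Num.min 1 `|t * x|).
Proof.
apply: measurable_funM; first exact: measurable_funX.
apply: measurable_minr => //.
by apply: measurableT_comp => //; exact: measurable_funM.
Qed.

Lemma tail2_integrable (t : R) :
  P.-integrable setT (EFin \o (fun w => X0 w ^+ 2 * Num.min 1 `|t * X0 w|)).
Proof.
apply: (le_integrable _ _ _ X2int) => //.
  apply: measurableT_comp => //.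
  exact: (measurableT_comp (measurable_sqr_min t)).
move=> w _ /=; rewrite lee_fin normrM ler_piMr//.
by rewrite ger0_norm ?le_min ?ler01 ?normr_ge0// ge_min lexx.
Qed.

Lemma tail2_ge0 t : 0 <= tail2 t.
Proof.
by apply: Rintegral_ge0 => w _; rewrite mulr_ge0 ?sqr_ge0// le_min ler01 normr_ge0.
Qed.

Lemma tail2_homo s t : 0 <= s -> s <= t -> tail2 s <= tail2 t.
Proof.
move=> s0 st; apply: le_Rintegral => //; try exact: tail2_integrable.
move=> w _; rewrite ler_wpM2l ?sqr_ge0// le_min !ge_min lexx/=.
by rewrite !normrM ler_wpM2r ?orbT// !ger0_norm// (le_trans s0).
Qed.

(** Dominated convergence is applied along [t = 1 / (n + 1)]; monotonicity in [t] extends the bound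
    to an interval. *)
Lemma tail2_cvg0 (eta : R) : 0 < eta -> exists2 t0, 0 < t0 & forall t, 0 <= t <= t0 -> tail2 t <= eta.
Proof.
move=> eta0.
pose f_ (n : nat) (w : T) := (X0 w ^+ 2 * Num.min 1 `|n.+1%:R^-1 * X0 w|)%:E.
have [] := @dominated_convergence _ _ _ P setT measurableT f_ (cst 0%E)
  (fun w => (X0 w ^+ 2)%:E).
- move=> n; apply: measurableT_comp => //.
  exact: (measurableT_comp (measurable_sqr_min _)).
- exact: measurable_cst.
- apply: aeW => w _ /=; apply: cvg_EFin; first by near=> n.
  rewrite /f_/= [X in _ --> X](_ : _ = X0 w ^+ 2 * 0); last by rewrite mulr0.
  apply: cvgMr.
  have h : (n.+1%:R^-1 * X0 w) @[n --> \oo] --> (0 : R).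
    by rewrite -[X in _ --> X](mul0r (X0 w)); apply: cvgMl; exact: cvg_harmonic.
  apply: (@squeeze_cvgr _ _ _ _ (fun=> 0) (fun n => `|n.+1%:R^-1 * X0 w|)).
  + by near=> n; rewrite le_min ler01 normr_ge0/= ge_min lexx orbT.
  + exact: cvg_cst.
  + by rewrite -[X in _ --> X](normr0 R); apply: cvg_norm.
- exact: X2int.
- apply: aeW => w n _ /=; rewrite /f_/= lee_fin normrM ger0_norm ?sqr_ge0// ler_piMr ?sqr_ge0//.
  by rewrite ger0_norm ?le_min ?ler01 ?normr_ge0// ge_min lexx.
move=> _ _; rewrite integral0 => h.
have {}h : tail2 n.+1%:R^-1 @[n --> \oo] --> (0 : R).
  exact: (fine_cvg (h : _ --> (0 : R)%:E)%E).
move/cvgrPdist_le : h => /(_ _ eta0) [N _ /(_ N (leqnn N))].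
rewrite /= sub0r normrN ger0_norm ?tail2_ge0// => hN.
exists N.+1%:R^-1 => // t /andP[t0 tN].
exact: le_trans (tail2_homo t0 tN) hN.
Unshelve. all: by end_near. Qed.

Lemma measurable_X0Z (t : R) : measurable_fun setT (fun w => t * X0 w).
Proof. exact: measurable_funM. Qed.

Lemma X0_integrable : P.-integrable setT (EFin \o X0).
Proof.
have i1 : P.-integrable setT (EFin \o (fun w => 1 + X0 w ^+ 2)).
  by apply: integrable_add => //; exact: (bddmeas_integrable P (bddmeas_cst 1)).
apply: (le_integrable _ _ _ i1) => //; first exact: measurableT_comp.
move=> w _; rewrite /= lee_fin [leRHS]ger0_norm; last by rewrite addr_ge0 ?sqr_ge0.
have : 0 <= (`|X0 w| - 1 / 2) ^+ 2 by exact: sqr_ge0.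
rewrite -[X in 1 + X](real_normK (num_real _)).
by set a := `|X0 w|; nra.
Qed.

Lemma norm_chr_cos t : `|chr_cos X t| <= 1.
Proof.
rewrite -[leRHS](Ex_cst P 1); apply: normr_Ex.
- exact/bddmeas_cos/measurable_X0Z.
- exact: bddmeas_cst.
- by move=> w; exact: cos_max.
Qed.

Lemma tail2Z t : 0 <= t ->
  t ^+ 2 * tail2 t = E (fun w => (t * X0 w) ^+ 2 * Num.min 1 `|t * X0 w|).
Proof.
move=> t0; rewrite /tail2 /Ex -RintegralZl//; last exact: tail2_integrable.
by apply: eq_Rintegral => w _; rewrite exprMn mulrA.
Qed.

Lemma tail2Z_integrable t :
  P.-integrable setT (EFin \o (fun w => (t * X0 w) ^+ 2 * Num.min 1 `|t * X0 w|)).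
Proof.
have := @integrable_Zl _ _ _ P (t ^+ 2) _ (tail2_integrable t).
by congr (_.-integrable _ (EFin \o _)); apply/funext => w; rewrite exprMn mulrA.
Qed.

Lemma chr_cos_approx t : 0 <= t ->
  `|chr_cos X t - 1 + t ^+ 2 * var0 / 2| <= t ^+ 2 * tail2 t.
Proof.
move=> t0; rewrite tail2Z//.
have b1 : bddmeas (fun w => cos (t * X0 w) - 1).
  by apply: bddmeasB; [exact/bddmeas_cos/measurable_X0Z|exact: bddmeas_cst].
have i2 : P.-integrable setT (EFin \o (fun w => t ^+ 2 / 2 * X0 w ^+ 2)).
  exact: integrable_Zl.
have -> : chr_cos X t - 1 + t ^+ 2 * var0 / 2 =
    E (fun w => (cos (t * X0 w) - 1) + (t ^+ 2 / 2 * X0 w ^+ 2)).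
  rewrite /Ex RintegralD//; last exact: bddmeas_integrable.
  congr (_ + _).
    rewrite -[LHS]/(_ - _) -[X in _ - X](Ex_cst P 1) -ExB//.
      exact/bddmeas_cos/measurable_X0Z.
    exact: bddmeas_cst.
  by rewrite RintegralZl// mulrAC.
have iD : P.-integrable setT (EFin \o (fun w => (cos (t * X0 w) - 1) + (t ^+ 2 / 2 * X0 w ^+ 2))).
  by apply: integrable_add => //; exact: bddmeas_integrable.
apply: le_trans (le_normr_Rintegral _ _) _ => //.
apply: le_Rintegral => //.
- exact: (integrable_norm iD).
- exact: tail2Z_integrable.
- move=> w _; apply: le_trans (norm_cos_sub _).
  by rewrite exprMn mulrAC.
Qed.

(** Centering cancels the first-order term of the sine. A remainder of order [t] would not survive
    the sum over [n] steps with [n t^2] of order one. *)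
Lemma chr_sin_approx t : 0 <= t -> E X0 = 0 -> `|chr_sin X t| <= 2 * (t ^+ 2 * tail2 t).
Proof.
move=> t0 EX0; rewrite tail2Z//.
have i1 : P.-integrable setT (EFin \o (fun w => sin (t * X0 w))).
  by apply/bddmeas_integrable/bddmeas_sin/measurable_X0Z.
have i2 : P.-integrable setT (EFin \o (fun w => t * X0 w)).
  by apply: integrable_Zl => //; exact: X0_integrable.
have -> : chr_sin X t = E (fun w => sin (t * X0 w) - t * X0 w).
  rewrite /Ex RintegralB// RintegralZl//; last exact: X0_integrable.
  by rewrite -/(Ex P X0) EX0 mulr0 subr0.
have iD : P.-integrable setT (EFin \o (fun w => sin (t * X0 w) - t * X0 w)).
  exact: integrable_sub.
apply: le_trans (le_normr_Rintegral _ _) _ => //.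
rewrite -RintegralZl//; last exact: tail2Z_integrable.
apply: le_Rintegral => //.
- exact: (integrable_norm iD).
- by apply: integrable_Zl; exact: tail2Z_integrable.
- by move=> w _; exact: norm_sin_sub.
Qed.

(** Splits an overshoot [a] at [eta]: a small one costs [eta]; for a larger one
    [eta^3 <= eta^2 <= a^2], and the resulting term has mean [t^2 tail2 t / eta^3] at
    [a = |t X|]. *)
Lemma min1_le (eta a : R) : 0 < eta <= 1 -> 0 <= a ->
  Num.min 1 a <= eta + a ^+ 2 * Num.min 1 a / eta ^+ 3.
Proof.
move=> /andP[e0 e1] a0.
have m0 : 0 <= Num.min 1 a by rewrite le_min ler01 a0.
have h : 0 <= a ^+ 2 * Num.min 1 a / eta ^+ 3.
  by rewrite divr_ge0 ?mulr_ge0 ?sqr_ge0 ?exprn_ge0// ltW.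
have [ae|ea] := leP a eta.
  by apply: (@le_trans _ _ eta); rewrite ?lerDl// ge_min ae orbT.
apply: (@le_trans _ _ (a ^+ 2 * Num.min 1 a / eta ^+ 3)); last by rewrite lerDr ltW.
rewrite ler_pdivlMr ?exprn_gt0// mulrC ler_wpM2r//.
apply: (@le_trans _ _ (eta ^+ 2)); last by rewrite lerXn2r ?nnegrE// ltW.
by rewrite exprS ler_piMl// sqr_ge0.
Qed.

End CharacteristicFunction.

Lemma norm_subXX_le (R : realType) (x y : R) n : `|x| <= 1 -> `|y| <= 1 ->
  `|x ^+ n - y ^+ n| <= n%:R * `|x - y|.
Proof.
move=> x1 y1; elim: n => [|n IH]; first by rewrite !expr0 subrr normr0 mul0r.
have -> : x ^+ n.+1 - y ^+ n.+1 = x * (x ^+ n - y ^+ n) + (x - y) * y ^+ n.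
  by rewrite !exprS; ring.
apply: le_trans (ler_normD _ _) _; rewrite !normrM -natr1 mulrDl mul1r lerD//.
  by apply: le_trans IH; rewrite ler_piMl.
by rewrite ler_piMr// normrX exprn_ile1.
Qed.

Lemma expRN_approx (R : realType) (x : R) : 0 <= x -> `|expR (- x) - 1 + x| <= x ^+ 2.
Proof.
move=> x0; rewrite ger0_norm; last by have := expR_ge1Dx (- x); lra.
have h1 := expR_ge1Dx x.
have : expR (- x) <= (1 + x)^-1.
  by rewrite expRN lef_pV2// posrE ?expR_gt0// ltr_wpDr.
have h2 : (1 + x)^-1 <= 1 - x + x ^+ 2.
  rewrite -[leLHS]mul1r ler_pdivrMr ?ltr_wpDr//.
  have : 0 <= x ^+ 3 by rewrite exprn_ge0.
  by rewrite (_ : (1 - x + x ^+ 2) * (1 + x) = 1 + x ^+ 3); [lra | ring].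
by lra.
Qed.

(** * The walk killed on leaving an interval *)

Section KilledWalk.
Context {d : measure_display} {T : measurableType d} {R : realType}.
Variables (P : probability T R) (X : nat -> {RV P >-> R}).
Hypothesis iidX : iid X.

Local Notation S := (partial_sum X).
Local Notation M := (max_partial_sum X).
Local Notation E := (Ex P).
Local Notation X0 := (X 0%N).
Local Notation surv := (survive X).
Local Notation psurv := (psurv X).
Local Notation chr2 t := (chr_cos X t ^+ 2 + chr_sin X t ^+ 2).

(* [(E[Y cos t S_j], E[Y sin t S_j])] is rotated and scaled by the characteristic function
   at each step. *)
Lemma chr_iter j m (Y : T -> R) t : adapted X j Y -> bddmeas Y ->
  E (fun w => Y w * cos (t * S (j + m) w)) ^+ 2 + E (fun w => Y w * sin (t * S (j + m) w)) ^+ 2 =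
  chr2 t ^+ m * (E (fun w => Y w * cos (t * S j w)) ^+ 2 + E (fun w => Y w * sin (t * S j w)) ^+ 2).
Proof.
move=> aY bY; elim: m => [|m IH]; first by rewrite addn0 expr0 mul1r.
have aY' : adapted X (j + m) Y.
  move=> _ B mB; have := aY measurableT B mB; rewrite !setTI.
  apply: smallest_sub; first exact: smallest_sigma_algebra.
  move=> _ [C mC ->]; apply: sub_sigma_algebra.
  exists (fun i => if (i <= j)%N then C i else setT); first by move=> i; case: ifP.
  rewrite predeqE => w; split=> [h i _ /=|h i /= ij].
    by case: ifP => // ij; exact: h.
  by have := h i (leq_trans ij (leq_addr _ _)); rewrite ij.
have [hc hs] := chr_step iidX t aY' bY.
by rewrite addnS hc hs (exprS _ m) -(mulrA (chr2 t)) -IH; ring.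
Qed.

Lemma bddmeas_survive n h : bddmeas (\1_(surv n h) : T -> R).
Proof. by apply: bddmeas_indic; exact: measurable_survive. Qed.

(* On [{M_(j+m) <= h}] one has [cos (S_(j+m) / h) >= 1/2], hence [1 <= 2/3 (1 + cos)] there,
   while the expectation of the cosine has become negligible after [m] steps. *)
Lemma psurv_block j m h : 0 < h -> chr2 h^-1 ^+ m <= 32^-1 ->
  psurv (j + m) h <= 5 / 6 * psurv j h.
Proof.
move=> h0 hm; set t := h^-1.
have t0 : 0 < t by rewrite invr_gt0.
pose Y : T -> R := \1_(surv j h).
have aY : adapted X j Y by exact: adapted_survive.
have bY : bddmeas Y := bddmeas_survive j h.
have Y01 w : 0 <= Y w <= 1.
  by rewrite /Y indicE; case: (w \in _) => /=; rewrite ?lexx ?ler01.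
have pE : psurv j h = E Y by rewrite psurvE.
have bc n : bddmeas (fun w => Y w * cos (t * S n w)) by apply: bddmeasM => //; exact: bddmeas_cosS.
have bs n : bddmeas (fun w => Y w * sin (t * S n w)) by apply: bddmeasM => //; exact: bddmeas_sinS.
have := chr_iter m t aY bY.
set C := E _; set D := E _; set C0 := E _; set D0 := E _ => CD.
have p0 := psurv_ge0 X j h.
have C0p : `|C0| <= psurv j h.
  rewrite pE; apply: normr_Ex => // w; have /andP[y0 _] := Y01 w.
  by rewrite normrM (ger0_norm y0) ler_piMr// cos_max.
have D0p : `|D0| <= psurv j h.
  rewrite pE; apply: normr_Ex => // w; have /andP[y0 _] := Y01 w.
  by rewrite normrM (ger0_norm y0) ler_piMr// sin_max.
have sq (x : R) : `|x| <= psurv j h -> x ^+ 2 <= psurv j h ^+ 2.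
  by move=> xp; rewrite -[leLHS]real_normK ?num_real// lerXn2r.
(* Both initial components are at most [p = psurv j h], so [C^2 <= 2 p^2 / 32 = (p / 4)^2], and the
   final factor is [2 / 3 * (1 + 1 / 4) = 5 / 6]. This is the origin of [32]. *)
have C2 : C ^+ 2 <= (psurv j h / 4) ^+ 2.
  have : C ^+ 2 <= 32^-1 * (psurv j h ^+ 2 + psurv j h ^+ 2).
    apply: (@le_trans _ _ (C ^+ 2 + D ^+ 2)); first by rewrite lerDl sqr_ge0.
    rewrite CD ler_pM//.
    - by rewrite exprn_ge0// addr_ge0 ?sqr_ge0.
    - by rewrite addr_ge0 ?sqr_ge0.
    - by rewrite lerD// sq.
  move/le_trans; apply; rewrite exprMn.
  by set p2 := psurv j h ^+ 2; rewrite (_ : 32^-1 * (p2 + p2) = p2 * 4^-1 ^+ 2)//; field.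
have Cp : C <= psurv j h / 4.
  apply: le_trans (ler_norm C) _.
  by rewrite -(@ler_pXn2r _ 2) ?nnegrE ?divr_ge0// real_normK ?num_real.
have key : psurv (j + m) h <= E (fun w => 2 / 3 * (Y w + Y w * cos (t * S (j + m) w))).
  rewrite psurvE; apply: le_Ex.
  - exact: bddmeas_survive.
  - by apply/bddmeasZ/bddmeasD.
  - move=> w; rewrite indicE.
    have yc : 0 <= Y w + Y w * cos (t * S (j + m) w).
      have /andP[y0 _] := Y01 w.
      by rewrite -[X in X + _]mulr1 -mulrDr mulr_ge0//; have := cos_geN1 (t * S (j + m) w); lra.
    case: (boolP (w \in _)) => /= [|_]; last by rewrite mulr_ge0// divr_ge0.
    rewrite inE /survive/= => Mh.
    have -> : Y w = 1.
      rewrite /Y indicE mem_set// /survive/=.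
      by apply: le_trans Mh; apply: max_partial_sum_homo; exact: leq_addr.
    rewrite mul1r.
    suff : 1 / 2 <= cos (t * S (j + m) w) by lra.
    apply: cos_ge_half; rewrite normrM (gtr0_norm t0) ler_pdivrMl// mulr1.
    exact: le_trans (le_max_partial_sum X _ w) Mh.
apply: le_trans key _; rewrite ExZ ?ExD//; last exact: bddmeasD.
by rewrite -pE -/C; lra.
Qed.

(** Blocks have length [m], about [5 h^2 / kappa]: then [chr2^m <= e^(-5) <= 1 / 32], and each block
    costs a factor [5 / 6 <= e^(-1/6)]. Since [kappa <= h^2], rounding keeps [m <= 6 h^2 / kappa],
    whence [36 = 6 * 6]; the factor [2 >= e^(1/6)] pays for the incomplete block. *)
Lemma psurv_tail (kappa t0 : R) : 0 < kappa -> 0 < t0 ->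
  (forall t, 0 < t <= t0 -> chr2 t <= 1 - kappa * t ^+ 2) ->
  forall h, 0 < h -> t0^-1 <= h -> kappa <= h ^+ 2 ->
  forall n, psurv n h <= 2 * expR (- (kappa * n%:R / (36 * h ^+ 2))).
Proof.
move=> k0 t00 hk h h0 th kh n.
have h20 : 0 < h ^+ 2 by rewrite exprn_gt0.
pose m := (Num.truncn (5 * h ^+ 2 / kappa)).+1.
have x0 : 0 <= 5 * h ^+ 2 / kappa by rewrite divr_ge0 ?mulr_ge0 ?ltW.
have /andP[m1 m2] := truncn_itv x0.
have m0 : 0 < m%:R :> R by rewrite ltr0n.
have m6 : m%:R <= 6 * h ^+ 2 / kappa.
  rewrite /m -natr1; apply: (@le_trans _ _ (5 * h ^+ 2 / kappa + h ^+ 2 / kappa)).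
    by rewrite lerD// ler_pdivlMr ?mul1r.
  by rewrite -mulrDl (_ : 5 * h ^+ 2 + h ^+ 2 = 6 * h ^+ 2)//; ring.
have hm : chr2 h^-1 ^+ m <= 32^-1.
  have c0 : 0 <= chr2 h^-1 by rewrite addr_ge0 ?sqr_ge0.
  have c1 : chr2 h^-1 <= expR (- (kappa * h^-1 ^+ 2)).
    apply: (@le_trans _ _ (1 - kappa * h^-1 ^+ 2)).
      by apply: hk; rewrite invr_gt0 h0/= invf_ple.
    exact: expR_ge1Dx.
  apply: (@le_trans _ _ (expR (- (kappa * h^-1 ^+ 2)) ^+ m)).
    by rewrite lerXn2r// nnegrE expR_ge0.
  rewrite -expRM_natl mulrN expRN lef_pV2 ?posrE ?expR_gt0//.
  apply: (@le_trans _ _ (expR 5)).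
    have e2 : 2 <= expR 1 :> R by have := expR_ge1Dx (1 : R); lra.
    have -> : expR 5 = expR 1 ^+ 5 :> R by rewrite -expRM_natl mulr1.
    apply: (@le_trans _ _ (2 ^+ 5)); first by rewrite -natrX ler_nat.
    by rewrite lerXn2r ?nnegrE ?expR_ge0.
  rewrite ler_expR; move: m2; rewrite -/m ltr_pdivrMr// => m2.
  by rewrite exprVn mulrA ler_pdivlMr// ltW.
have q q' : psurv (q' * m)%N h <= (5 / 6) ^+ q'.
  elim: q' => [|k IH]; first by rewrite mul0n expr0 psurv_le1.
  rewrite mulSn addnC; apply: le_trans (psurv_block _ h0 hm) _.
  by rewrite exprS ler_wpM2l// divr_ge0.
apply: le_trans (psurv_anti _ _ (leq_trunc_div n m)) _.
apply: le_trans (q _) _.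
have e56 : 5 / 6 <= expR (- (1 / 6)) :> R by have := expR_ge1Dx (- (1 / 6) : R); lra.
apply: (@le_trans _ _ (expR (- (1 / 6)) ^+ (n %/ m))).
  by rewrite lerXn2r ?nnegrE ?divr_ge0 ?expR_ge0.
have e65 : expR (1 / 6) <= 2 :> R.
  rewrite -[X in expR X]opprK expRN invf_ple ?posrE ?expR_gt0//.
  by apply: le_trans e56; lra.
rewrite -expRM_natl.
apply: (@le_trans _ _ (expR (1 / 6) * expR (- (kappa * n%:R / (36 * h ^+ 2))))); last first.
  by rewrite ler_wpM2r ?expR_ge0.
rewrite -expRD ler_expR.
have nm : n%:R <= ((n %/ m)%:R + 1) * m%:R :> R.
  by rewrite natr1 -natrM ler_nat ltnW// ltn_ceil.
have nq : n%:R * (kappa / (6 * h ^+ 2)) <= (n %/ m)%:R + 1.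
  have k6 : m%:R * (kappa / (6 * h ^+ 2)) <= 1.
    by rewrite mulrA ler_pdivrMr ?mulr_gt0// mul1r -ler_pdivlMr.
  apply: le_trans (_ : ((n %/ m)%:R + 1) * m%:R * (kappa / (6 * h ^+ 2)) <= _).
    by rewrite ler_wpM2r// divr_ge0 ?mulr_ge0// ltW.
  by rewrite -mulrA ler_piMr// addr_ge0.
have -> : kappa * n%:R / (36 * h ^+ 2) = n%:R * (kappa / (6 * h ^+ 2)) / 6.
  by field; rewrite gt_eqF.
by move: nq; set A := n%:R * _; lra.
Qed.

Hypothesis X2int : P.-integrable setT (EFin \o (fun w => X0 w ^+ 2)).

Definition killed_cos t n h : R := E (fun w => \1_(surv n h) w * cos (t * S n w)).

(* At the exit time the cosine is close to its zero [t h], the overshoot being at most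
   one step of the walk. *)
Lemma killed_cos_step t h eta n : 0 < t -> 0 <= h -> cos (t * h) = 0 -> 0 < eta <= 1 ->
  `|killed_cos t n.+1 h - killed_cos t n h * chr_cos X t| <=
    `|chr_sin X t| + t ^+ 2 * tail2 X t / eta ^+ 3 + eta * (psurv n h - psurv n.+1 h).
Proof.
move=> t0 h0 th eta01.
have /andP[eta0 _] := eta01.
pose Y : T -> R := \1_(surv n h).
have aY : adapted X n Y by exact: adapted_survive.
have bY : bddmeas Y := bddmeas_survive n h.
have [hc _] := chr_step iidX t aY bY.
(* Indicator of the exit at step [n.+1]; its mean is the drop of the survival probability. *)
pose Z : T -> R := \1_(surv n h `\` surv n.+1 h).
have bZ : bddmeas Z.
  by apply/bddmeas_indic/measurableD; exact: measurable_survive.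
have YZ w : Y w = \1_(surv n.+1 h) w + Z w.
  rewrite /Y /Z !indicE in_setD.
  have sub : w \in surv n.+1 h -> w \in surv n h.
    by rewrite !inE /survive/=; apply: le_trans; exact: max_partial_sum_homo.
  case: (boolP (w \in surv n.+1 h)) => [ws|ws]; first by rewrite (sub ws) addr0.
  by case: (w \in surv n h); rewrite add0r.
have pE : psurv n h - psurv n.+1 h = E Z.
  rewrite !psurvE -ExB; [|exact: bddmeas_survive..].
  by apply: eq_Ex => w; rewrite -/(Y w) YZ [X in X - _]addrC addrK.
have bc := bddmeas_cosS X t n.+1.
have e1 : E (fun w => Y w * cos (t * S n.+1 w)) =
    killed_cos t n.+1 h + E (fun w => Z w * cos (t * S n.+1 w)).
  rewrite -ExD; [|by apply: bddmeasM => //; exact: bddmeas_survive|exact: bddmeasM].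
  by apply: eq_Ex => w; rewrite YZ mulrDl.
have D1 : `|E (fun w => Y w * sin (t * S n w))| <= 1.
  rewrite -[leRHS](Ex_cst P 1); apply: normr_Ex.
  - by apply: bddmeasM => //; exact: bddmeas_sinS.
  - exact: bddmeas_cst.
  - move=> w; rewrite normrM mulr_ile1// ?sin_max//.
    by rewrite /Y indicE; case: (w \in _); rewrite ?normr1 ?normr0.
have D2 : `|E (fun w => Z w * cos (t * S n.+1 w))| <=
    eta * E Z + t ^+ 2 * tail2 X t / eta ^+ 3.
  pose g (x : R) := (t * x) ^+ 2 * Num.min 1 `|t * x|.
  have mg : measurable_fun setT g.
    rewrite (_ : g = fun x => t ^+ 2 * (x ^+ 2 * Num.min 1 `|t * x|)).
      by apply: measurable_funM => //; exact: measurable_sqr_min.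
    by apply/funext => x; rewrite /g exprMn -mulrA.
  have ig : P.-integrable setT (EFin \o (g \o X n.+1)).
    exact: (integrable_X iidX _ mg (tail2Z_integrable X2int t)).
  rewrite (tail2Z X2int (ltW t0)).
  have <- : E (g \o X n.+1) = E (fun w => (t * X0 w) ^+ 2 * Num.min 1 `|t * X0 w|).
    exact: (Ex_X iidX _ mg (tail2Z_integrable X2int t)).
  have i1 : P.-integrable setT (EFin \o (fun w => Z w * cos (t * S n.+1 w))).
    by apply: bddmeas_integrable; exact: bddmeasM.
  have i2 : P.-integrable setT (EFin \o (fun w => eta * Z w)).
    by apply: bddmeas_integrable; exact: bddmeasZ.
  have i3 : P.-integrable setT (EFin \o (fun w => (eta ^+ 3)^-1 * (g \o X n.+1) w)).
    exact: integrable_Zl.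
  rewrite -ExZ// [X in _ + X]mulrC /Ex -RintegralZl//  -RintegralD//.
  apply: le_trans (le_normr_Rintegral _ _) _ => //.
  apply: le_Rintegral => //; first exact: (integrable_norm i1).
    exact: integrable_add.
  move=> w _; rewrite /Z indicE.
  have g0 : 0 <= (eta ^+ 3)^-1 * g (X n.+1 w).
    apply: mulr_ge0; first by rewrite invr_ge0 exprn_ge0// ltW.
    by apply: mulr_ge0; rewrite ?sqr_ge0// le_min ler01 normr_ge0.
  case: (boolP (w \in _)) => /= [|_]; last by rewrite mul0r normr0 mulr0 add0r.
  rewrite inE => -[]; rewrite /survive/= max_partial_sumS => Mh /negP.
  rewrite -ltNge lt_max ltNge Mh/= => hS.
  have Sh := le_trans (le_max_partial_sum X n w) Mh.
  rewrite mul1r mulr1 [X in _ <= _ + X]mulrC.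
  apply: (@le_trans _ _ (Num.min 1 `|t * X n.+1 w|));
    last by rewrite /g/= -(real_normK (num_real (t * _))); exact: min1_le.
  rewrite le_min cos_max/=.
  have -> : cos (t * S n.+1 w) = cos (t * `|S n.+1 w|) - cos (t * h).
    by rewrite th subr0 -[in RHS](gtr0_norm t0) -normrM cos_norm.
  apply: le_trans (cos_lipschitz _ _) _.
  rewrite -mulrBr !normrM ler_wpM2l// ger0_norm ?subr_ge0 ?(ltW hS)//.
  rewrite lerBlDr partial_sumS; apply: le_trans (ler_normD _ _) _.
  by rewrite addrC lerD2l.
have -> : killed_cos t n.+1 h - killed_cos t n h * chr_cos X t =
   - (E (fun w => Y w * sin (t * S n w)) * chr_sin X t) - E (fun w => Z w * cos (t * S n.+1 w)).
  by move: e1; rewrite hc -/(killed_cos t n h); move=> e1; lra.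
apply: le_trans (ler_normB _ _) _; rewrite normrN pE -addrA lerD//.
  by rewrite normrM ler_piMl.
by rewrite addrC.
Qed.

(** The drops [psurv n h - psurv n.+1 h] telescope, so the overshoots within [eta] cost [eta] once
    in all instead of [n * eta]; only the other two errors accumulate. *)
Lemma killed_cos_pow t h eta n : 0 < t -> 0 <= h -> cos (t * h) = 0 -> 0 < eta <= 1 ->
  `|killed_cos t n h - chr_cos X t ^+ n| <=
    n%:R * (`|chr_sin X t| + t ^+ 2 * tail2 X t / eta ^+ 3) + eta.
Proof.
move=> t0 h0 th eta01; have /andP[eta0 _] := eta01.
set err := `|chr_sin X t| + _.
suff H : `|killed_cos t n h - chr_cos X t ^+ n| <= n%:R * err + eta * (1 - psurv n h).
  apply: le_trans H _; rewrite lerD2l ler_piMr ?(ltW eta0)//.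
  by rewrite gerBl psurv_ge0.
elim: n => [|n IH].
  have s0 : surv 0 h = setT.
    by rewrite predeqE => w; split => // _; rewrite /survive/= max_partial_sum0.
  have -> : killed_cos t 0 h = 1.
    rewrite /killed_cos -[RHS](Ex_cst P 1); apply: eq_Ex => w.
    by rewrite s0 indicE in_setT partial_sum0 mulr0 cos0 mul1r.
  by rewrite expr0 subrr normr0 mul0r add0r mulr_ge0 ?(ltW eta0)// subr_ge0 psurv_le1.
have st := killed_cos_step n t0 h0 th eta01.
have -> : killed_cos t n.+1 h - chr_cos X t ^+ n.+1 =
  (killed_cos t n.+1 h - killed_cos t n h * chr_cos X t) +
  (killed_cos t n h - chr_cos X t ^+ n) * chr_cos X t by rewrite exprS; ring.
apply: le_trans (ler_normD _ _) _.
have h2 : `|(killed_cos t n h - chr_cos X t ^+ n) * chr_cos X t| <= n%:R * err + eta * (1 - psurv n h).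
  by apply: le_trans IH; rewrite normrM ler_piMr// norm_chr_cos.
apply: le_trans (lerD st h2) _.
rewrite -natr1 -/err mulrDl mul1r.
by move: (psurv n h) (psurv n.+1 h) => p q; lra.
Qed.

(** At [t = a / h] the product [n t^2] is at most [a^2 K], so the accumulated error is a constant
    times [tail2 t], with [t] small because [n] is large. The threshold on [n] is uniform in [h]. *)
Lemma killed_cos_limit (a K eta : R) : E X0 = 0 -> 0 < a -> cos a = 0 -> 0 < eta ->
  exists n0 : nat, forall n h, (n0 <= n)%N -> 0 < h -> n%:R <= K * h ^+ 2 ->
    `|killed_cos (a / h) n h - expR (- (a ^+ 2 * var0 X / 2 * (n%:R / h ^+ 2)))| <= eta.
Proof.
move=> EX0 a0 ca eta0.
wlog K0 : K / 0 < K.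
  move=> H; have [n0 hn0] := H (`|K| + 1) (ltr_wpDl (normr_ge0 _) ltr01).
  exists n0 => n h n0n h0 nK; apply: hn0 => //; apply: le_trans nK _.
  by rewrite ler_wpM2r ?sqr_ge0// ler_wpDr// ler_norm.
set v := var0 X.
have v0 : 0 <= v by apply: Ex_ge0 => w; exact: sqr_ge0.
pose eta1 := Num.min 1 (eta / 4).
have eta10 : 0 < eta1 by rewrite lt_min ltr01 divr_gt0.
have eta11 : 0 < eta1 <= 1 by rewrite eta10 ge_min lexx.
have eta14 : eta1 <= eta / 4 by rewrite ge_min lexx orbT.
pose L := a ^+ 2 * K.
have L0 : 0 < L by rewrite mulr_gt0 ?exprn_gt0.
(* The [3] is [2] from the sine and [1] from the cosine; the inverse cube comes from the
   overshoot. *)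
pose c := 3 + (eta1 ^+ 3)^-1.
have c0 : 0 < c by rewrite addr_gt0 ?invr_gt0 ?exprn_gt0.
have [t0 t00 ht0] := tail2_cvg0 X2int (divr_gt0 (divr_gt0 eta0 (ltr0n R 2)) (mulr_gt0 L0 c0)).
(* The first bound forces [t <= t0]; the second makes the [n] replacements of [1 - x] by
   [expR (- x)] cost at most [eta / 4]. *)
pose B := Num.max (L / t0 ^+ 2) (L * (L * v ^+ 2 / eta)).
exists (Num.truncn B).+1 => n h nB h0 nK.
have nB' : B <= n%:R.
  by apply/ltW; apply: lt_le_trans (truncnS_gt _) _; rewrite ler_nat.
have n0 : 0 < n%:R :> R by rewrite ltr0n; case: n nB {nK nB'}.
set t := a / h.
have t_gt0 : 0 < t by rewrite divr_gt0.
have h20 : 0 < h ^+ 2 by rewrite exprn_gt0.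
have nt2 : n%:R * t ^+ 2 <= L.
  rewrite /t expr_div_n mulrCA /L ler_wpM2l ?sqr_ge0//.
  by rewrite ler_pdivrMr.
have t2n : t ^+ 2 <= L / n%:R by rewrite ler_pdivlMr// mulrC.
have tt0 : t <= t0.
  have : t ^+ 2 <= t0 ^+ 2; last by rewrite ler_pXn2r// nnegrE ltW.
  apply: (le_trans t2n).
  rewrite ler_pdivrMr// mulrC -ler_pdivrMr ?exprn_gt0//.
  by apply: le_trans nB'; rewrite le_max lexx.
have Lam := ht0 t; rewrite (ltW t_gt0) tt0 in Lam; have {}Lam := Lam isT.
have th : cos (t * h) = 0 by rewrite /t mulfVK ?gt_eqF.
have k1 := killed_cos_pow n t_gt0 (ltW h0) th eta11.
have k2 := chr_sin_approx X2int (ltW t_gt0) EX0.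
have k3 := chr_cos_approx X2int (ltW t_gt0).
rewrite -/v in k3.
pose x := t ^+ 2 * v / 2.
have x0 : 0 <= x by apply: divr_ge0 => //; apply: mulr_ge0 => //; exact: sqr_ge0.
have k4 := expRN_approx x0.
have k5 : `|chr_cos X t ^+ n - expR (- x) ^+ n| <= n%:R * (t ^+ 2 * tail2 X t + x ^+ 2).
  apply: le_trans (norm_subXX_le _ _ _) _.
  - exact: norm_chr_cos.
  - by rewrite ger0_norm ?expR_ge0// -expR0 ler_expR oppr_le0.
  - rewrite ler_wpM2l// (_ : chr_cos X t - expR (- x) =
      (chr_cos X t - 1 + x) - (expR (- x) - 1 + x)); last by ring.
    by apply: le_trans (ler_normB _ _) _; rewrite lerD.
have -> : expR (- (a ^+ 2 * v / 2 * (n%:R / h ^+ 2))) = expR (- x) ^+ n.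
  rewrite -expRM_natl; congr expR; rewrite /x /t expr_div_n.
  by field; rewrite gt_eqF.
have -> : killed_cos t n h - expR (- x) ^+ n =
  (killed_cos t n h - chr_cos X t ^+ n) + (chr_cos X t ^+ n - expR (- x) ^+ n) by ring.
apply: le_trans (ler_normD _ _) _.
apply: le_trans (lerD k1 k5) _.
have T0 := tail2_ge0 X t.
set Lm := tail2 X t in Lam T0 k2 *.
have b1 : n%:R * (`|chr_sin X t| + t ^+ 2 * Lm / eta1 ^+ 3) + n%:R * (t ^+ 2 * Lm)
    <= (n%:R * t ^+ 2) * c * Lm.
  have -> : n%:R * t ^+ 2 * c * Lm = n%:R * (2 * (t ^+ 2 * Lm) + t ^+ 2 * Lm / eta1 ^+ 3)
     + n%:R * (t ^+ 2 * Lm) by rewrite /c; ring.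
  by rewrite lerD2r ler_wpM2l// lerD2r.
have b2 : (n%:R * t ^+ 2) * c * Lm <= eta / 2.
  apply: (@le_trans _ _ (L * c * (eta / 2 / (L * c)))).
    apply: ler_pM => //; last by rewrite ler_wpM2r// ltW.
    by apply: mulr_ge0; [apply: mulr_ge0 => //; exact: sqr_ge0 | exact: ltW].
  by rewrite mulrC divfK// gt_eqF// mulr_gt0.
have b3 : n%:R * x ^+ 2 <= eta / 4.
  have -> : n%:R * x ^+ 2 = (n%:R * t ^+ 2) * t ^+ 2 * v ^+ 2 / 4 by rewrite /x; field.
  rewrite ler_pM2r//.
  apply: (@le_trans _ _ (L * (L / n%:R) * v ^+ 2)).
    rewrite ler_wpM2r ?sqr_ge0//; apply: ler_pM => //; last exact: sqr_ge0.
    by apply: mulr_ge0 => //; exact: sqr_ge0.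
  rewrite mulrA mulrAC ler_pdivrMr//.
  have : L * (L * v ^+ 2 / eta) <= n%:R by apply: le_trans nB'; rewrite le_max lexx orbT.
  by rewrite mulrA ler_pdivrMr// mulrA [n%:R * _]mulrC.
by rewrite mulrDr; lra.
Qed.

End KilledWalk.

(** * Abel means of the square wave *)

Section SquareWave.
Context {R : realType}.
Implicit Types (r y q : R).

(* Abel means of the Fourier series of the square wave. *)
Definition sqwave r (N : nat) y : R :=
  4 / pi * \sum_(k < N) (-1) ^+ k * r ^+ (2 * k + 1) / (2 * k + 1)%:R * cos ((2 * k + 1)%:R * y).

(** Real part of a geometric sum with ratio [q e^(2iy)], multiplied by [|1 - q e^(2iy)|^2]. The
    index [2 N - 1] is a real subtraction, so that [N = 0] gives [- y]. *)
Lemma geometric_cos_sum q y N :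
  (\sum_(k < N) q ^+ k * cos ((2 * k + 1)%:R * y)) * (1 - 2 * q * cos (2 * y) + q ^+ 2) =
  (1 - q) * cos y - q ^+ N * (cos ((2 * N + 1)%:R * y) - q * cos ((2 * N%:R - 1) * y)).
Proof.
elim: N => [|N IH].
  have -> : (2 * 0%:R - 1) * y = - y by rewrite mulr0 sub0r mulN1r.
  rewrite cosN big_ord0 mul1r muln0 add0n mul1r; ring.
rewrite big_ord_recr/= mulrDl IH.
have e1 : (2 * N.+1 + 1)%:R * y = (2 * N + 1)%:R * y + 2 * y :> R.
  by rewrite !natrD !natrM -(@natr1 _ N); ring.
have e2 : (2 * N.+1%:R - 1) * y = (2 * N + 1)%:R * y :> R.
  by rewrite -(@natr1 _ N) natrD natrM; ring.
have e3 : (2 * N%:R - 1) * y = (2 * N + 1)%:R * y - 2 * y :> R.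
  by rewrite natrD natrM; ring.
rewrite e1 e2 e3 !cosD cosN sinN (exprS q N); ring.
Qed.

(** For [c = cos y] the denominator is [|1 + r^2 e^(2iy)|^2], the one of the geometric sum at
    [q = - r^2]; this is why the Abel means integrate to an arctangent. *)
Lemma is_derive_atan_poisson c r : r ^+ 2 != 1 ->
  is_derive r 1 (fun x => atan (2 * c * x / (1 - x ^+ 2)))
    (2 * c * (1 + r ^+ 2) / ((1 - r ^+ 2) ^+ 2 + 4 * r ^+ 2 * c ^+ 2)).
Proof.
move=> r1.
have nz : 1 - r ^+ 2 != 0 by rewrite subr_eq0 eq_sym.
have d1 : is_derive r 1 (fun x : R => 1 - x ^+ 2) (- (2 * r)).
  by apply: is_derive_eq; rewrite /GRing.scale/= !mulr1; ring.
have d2 : is_derive r 1 (fun x : R => (1 - x ^+ 2)^-1) (- (1 - r ^+ 2) ^- 2 *: (- (2 * r))).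
  exact: is_deriveV.
have d3 : is_derive r 1 (fun x : R => 2 * c * x) (2 * c).
  by apply: is_derive_eq; rewrite /GRing.scale/= mulr1.
have d4 := is_deriveM d3 d2.
have d5 := @is_derive1_comp R atan (fun x : R => 2 * c * x / (1 - x ^+ 2)) r _ _ (is_derive1_atan _) d4.
apply: (is_derive_eq d5); rewrite /GRing.scale/=.
have n1 : (1 - r ^+ 2) ^+ 2 + 4 * r ^+ 2 * c ^+ 2 != 0.
  rewrite gt_eqF// ltr_wpDr ?exprn_even_gt0//.
  by apply: mulr_ge0; [apply: mulr_ge0 => //|]; exact: sqr_ge0.
by field; rewrite n1 nz.
Qed.

Lemma is_derive_sqwave_sum y N r :
  is_derive r 1 (fun x : R => \sum_(k < N) (-1) ^+ k * x ^+ (2 * k + 1) / (2 * k + 1)%:R *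
                   cos ((2 * k + 1)%:R * y))
    (\sum_(k < N) (- r ^+ 2) ^+ k * cos ((2 * k + 1)%:R * y)).
Proof.
elim: N => [|N IH].
  under eq_fun do rewrite big_ord0.
  by rewrite big_ord0; exact: is_derive_cst.
under eq_fun do rewrite big_ord_recr/=.
rewrite big_ord_recr/=; apply: is_deriveD.
set c := cos _.
have nz : (2 * N + 1)%:R != 0 :> R by rewrite pnatr_eq0 addn1.
rewrite (_ : (fun x => _) = (fun x => ((-1) ^+ N / (2 * N + 1)%:R * c) * x ^+ (2 * N + 1))); last first.
  by apply/funext => x; ring.
have d1 : is_derive r 1 (fun x : R => x ^+ (2 * N + 1)) ((2 * N + 1)%:R * r ^+ (2 * N)).
  have := is_deriveX (2 * N + 1) (is_derive_id r (1 : R)).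
  by rewrite (_ : (2 * N + 1).-1 = (2 * N)%N) ?fctE /GRing.scale/= ?mulr1 ?addn1.
apply: (is_derive_eq (is_deriveZ _ d1)); rewrite /GRing.scale/=.
have -> : (- r ^+ 2) ^+ N = (-1) ^+ N * r ^+ (2 * N).
  by rewrite -[- r ^+ 2]mulN1r exprMn -exprM.
by field.
Qed.

(* Both sides vanish at [r = 0] and their [r]-derivatives differ by the geometric remainder. *)
Lemma sqwave_approx r eta : 0 <= r < 1 -> 0 < eta ->
  exists N0 : nat, forall N y, (N0 <= N)%N ->
    `|sqwave r N y - 2 / pi * atan (2 * cos y * r / (1 - r ^+ 2))| <= eta.
Proof.
move=> /andP[r0 r1] eta0.
have r21 : r ^+ 2 < 1 by rewrite expr_lt1.
(* The derivatives differ by a quotient with numerator at most [2 * (r^2)^N * 2] and denominator at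
   least [(1 - r^2)^2], uniformly in [y]. *)
pose K := 4 / (1 - r ^+ 2) ^+ 2.
have K0 : 0 < K by rewrite divr_gt0// exprn_gt0// subr_gt0.
have : (r ^+ 2) ^+ N @[N --> \oo] --> (0 : R).
  by apply: cvg_expr; rewrite ger0_norm ?sqr_ge0.
move/cvgrPdist_le => /(_ _ (divr_gt0 eta0 K0)) [N0 _ hN0].
exists N0 => N y N0N.
have {}hN0 := hN0 N N0N; rewrite /= sub0r normrN ger0_norm ?exprn_ge0 ?sqr_ge0// in hN0.
pose f x := 2 * (\sum_(k < N) (-1) ^+ k * x ^+ (2 * k + 1) / (2 * k + 1)%:R *
                   cos ((2 * k + 1)%:R * y)) - atan (2 * cos y * x / (1 - x ^+ 2)).
have f0 : f 0 = 0.
  rewrite /f big1; last by move=> k _; rewrite addn1 exprS mul0r mulr0 !mul0r.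
  by rewrite mulr0 sub0r mulr0 mul0r atan0 oppr0.
have pi0 := pi_gt0 R.
have -> : sqwave r N y - 2 / pi * atan (2 * cos y * r / (1 - r ^+ 2)) = 2 / pi * (f r - f 0).
  by rewrite f0 subr0 /f /sqwave; move: pi0; generalize (@pi R) => p p0; field; rewrite gt_eqF.
have bd x : 0 <= x <= r -> 0 < 1 - x ^+ 2 /\ 1 - r ^+ 2 <= 1 - x ^+ 2.
  move=> /andP[x0 xr]; have : x ^+ 2 <= r ^+ 2 by rewrite lerXn2r ?nnegrE.
  by lra.
have := @le_norm_MVT R f (fun x => 2 * (\sum_(k < N) (- x ^+ 2) ^+ k * cos ((2 * k + 1)%:R * y)) -
   (2 * cos y * (1 + x ^+ 2) / ((1 - x ^+ 2) ^+ 2 + 4 * x ^+ 2 * cos y ^+ 2))) 0 r eta r0.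
rewrite subr0 => main.
have {}main : `|f r - f 0| <= eta * r.
  apply: main => x xr; have [b1 b2] := bd x xr.
    apply: is_deriveB.
      have d := is_derive_sqwave_sum y N x.
      by apply: (is_derive_eq (is_deriveZ 2 d)); rewrite /GRing.scale/=.
    by apply: is_derive_atan_poisson; rewrite lt_eqF// -subr_gt0.
  set D := _ + _ * _ ^+ 2.
  have D0 : (1 - r ^+ 2) ^+ 2 <= D.
    rewrite /D -[leLHS]addr0 lerD//.
      by rewrite lerXn2r ?nnegrE//; lra.
    by apply: mulr_ge0; [apply: mulr_ge0 => //|]; exact: sqr_ge0.
  have Dp : 0 < D by apply: lt_le_trans D0; rewrite exprn_gt0 ?subr_gt0.
  have DE : D = 1 - 2 * (- x ^+ 2) * cos (2 * y) + (- x ^+ 2) ^+ 2.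
    rewrite /D (_ : cos (2 * y) = 2 * cos y ^+ 2 - 1); last first.
      by rewrite mulr_natl cos_mulr2n mulr_natl.
    by ring.
  have /(congr1 (fun z => z / D)) := geometric_cos_sum (- x ^+ 2) y N.
  rewrite -DE mulfK ?gt_eqF// => ->.
  rewrite (_ : _ - _ = - (2 * (- x ^+ 2) ^+ N * (cos ((2 * N + 1)%:R * y) -
     (- x ^+ 2) * cos ((2 * N%:R - 1) * y)) / D)); last by field; rewrite gt_eqF.
  rewrite normrN normrM normfV (gtr0_norm Dp) ler_pdivrMr//.
  apply: (@le_trans _ _ (2 * (r ^+ 2) ^+ N * 2)).
    rewrite !normrM (ger0_norm (ler0n _ 2)) -!mulrA ler_pM2l//.
    have /andP[x0 xr'] := xr.
    have x2r : x ^+ 2 <= r ^+ 2 by rewrite lerXn2r ?nnegrE.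
    apply: ler_pM => //.
      by rewrite normrX normrN ger0_norm ?sqr_ge0// lerXn2r ?nnegrE ?sqr_ge0.
    apply: le_trans (ler_normB _ _) _.
    have c1 := cos_max ((2 * N + 1)%:R * y); have c2 := cos_max ((2 * N%:R - 1) * y).
    have c3 : `|- x ^+ 2 * cos ((2 * N%:R - 1) * y)| <= 1.
      rewrite normrM mulr_ile1// normrN ger0_norm ?sqr_ge0//.
      by apply: le_trans x2r _; exact: ltW.
    by lra.
  apply: (@le_trans _ _ (eta * (1 - r ^+ 2) ^+ 2)); last by rewrite ler_pM2l.
  move: hN0; rewrite /K invf_div mulrA ler_pdivlMr//.
  by set a := _ ^+ N; lra.
rewrite normrM ger0_norm; last by rewrite divr_ge0// ltW.
apply: (@le_trans _ _ (1 * `|f r - f 0|)).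
  by rewrite ler_wpM2r// ler_pdivrMr// mul1r pi_ge2.
by rewrite mul1r; apply: le_trans main _; rewrite ler_piMr ?(ltW r1)// ltW.
Qed.

Lemma poisson_atan_bounds c r : 0 <= c -> 0 <= r < 1 ->
  0 <= 2 / pi * atan (2 * c * r / (1 - r ^+ 2)) <= 1.
Proof.
move=> c0 /andP[r0 r1]; have pi0 := pi_gt0 R.
have r21 : r ^+ 2 < 1 by rewrite expr_lt1.
have x0 : 0 <= 2 * c * r / (1 - r ^+ 2).
  by rewrite divr_ge0 ?mulr_ge0// subr_ge0 ltW.
apply/andP; split.
  apply: mulr_ge0; first by rewrite divr_ge0// ltW.
  by rewrite -(atan0 R); exact: le_atan.
have /ltW := atan_ltpi2 (2 * c * r / (1 - r ^+ 2)).
set a := atan _ => ha.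
by rewrite mulrAC ler_pdivrMr// mul1r; lra.
Qed.

(** The argument of the arctangent tends to infinity as [r] tends to [1], uniformly over
    [c >= c0]. *)
Lemma poisson_atan_cvg c0 eta : 0 < c0 -> 0 < eta ->
  exists2 r0, 0 <= r0 < 1 & forall r c, r0 <= r < 1 -> c0 <= c ->
    1 - eta <= 2 / pi * atan (2 * c * r / (1 - r ^+ 2)).
Proof.
move=> c00 eta0; have pi0 := pi_gt0 R.
have pi2 : 0 < eta * (pi / 2) by rewrite mulr_gt0// divr_gt0.
have := @cvgy_atan R => /cvgrPdist_le /(_ _ pi2) [A [_ hA]].
pose B := `|A| + 1.
have B0 : 0 < B by rewrite ltr_wpDl.
have AB : A < B by rewrite /B; have := ler_norm A; lra.
(* The bound [1 / 2] gives [2 r >= 1]; the other gives [1 - r^2 <= 2 (1 - r) <= c0 / B], so that the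
   argument is at least [B]. *)
exists (Num.max (1 / 2) (1 - c0 / (2 * B))).
  rewrite le_max divr_ge0//= gt_max; apply/andP; split; first by lra.
  by rewrite gtrBl divr_gt0// mulr_gt0.
move=> r c /andP[]; rewrite ge_max => /andP[r12 rB] r1 c0c.
have r0 : 0 <= r by lra.
have r21 : r ^+ 2 < 1 by rewrite expr_lt1.
have Bx : B <= 2 * c * r / (1 - r ^+ 2).
  rewrite ler_pdivlMr ?subr_gt0//.
  have h1 : B * (1 - r) <= c0 / 2.
    have : 1 - r <= c0 / (2 * B) by lra.
    by rewrite ler_pdivlMr ?mulr_gt0// => h; lra.
  have h2 : B * (1 - r ^+ 2) <= c0.
    have -> : B * (1 - r ^+ 2) = B * (1 - r) * (1 + r) by ring.
    apply: (@le_trans _ _ (c0 / 2 * 2)); last by lra.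
    by apply: ler_pM => //; rewrite ?mulr_ge0// ?(ltW B0)//; lra.
  apply: (le_trans h2); apply: (le_trans c0c).
  have -> : 2 * c * r = c * (2 * r) by ring.
  by rewrite ler_peMr//; lra.
have := hA _ (lt_le_trans AB Bx).
rewrite ler_norml => /andP[_].
set a := atan _ => ha.
rewrite mulrAC ler_pdivlMr//; lra.
Qed.

End SquareWave.

Lemma expR_lipschitz (R : realType) (x y : R) : 0 <= x -> 0 <= y ->
  `|expR (- x) - expR (- y)| <= `|x - y|.
Proof.
wlog xy : x y / y <= x.
  move=> H x0 y0; have [/H|/ltW yx] := leP y x; first exact.
  by rewrite distrC [leRHS]distrC; exact: H.
move=> x0 y0; rewrite distrC ger0_norm; last by rewrite subr_ge0 ler_expR lerN2.
rewrite ger0_norm ?subr_ge0//.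
have -> : expR (- x) = expR (- y) * expR (- (x - y)) by rewrite -expRD; congr expR; ring.
have e1 : expR (- y) <= 1 by rewrite -expR0 ler_expR oppr_le0.
have e0 := expR_ge0 (- y).
have h := expR_ge1Dx (- (x - y)).
have e2 : expR (- (x - y)) <= 1 by rewrite -expR0 ler_expR oppr_le0 subr_ge0.
rewrite -[X in X - _]mulr1 -mulrBr.
apply: (@le_trans _ _ (1 * (1 - expR (- (x - y))))); last by lra.
by rewrite ler_wpM2r// subr_ge0.
Qed.

(** * The theta series: damping, truncation and bounds *)

Section ThetaSum.
Context {R : realType}.
Implicit Types (r u eta : R).

(** The image of [sqwave r M] when each [cos ((2k+1) y)] is replaced by its limiting expectation;
    [r = 1] is the target. *)
Definition theta_sum r (M : nat) u : R :=
  4 / pi * \sum_(k < M) (-1) ^+ k * r ^+ (2 * k + 1) / (2 * k + 1)%:R * expR (- ((2 * k + 1)%:R ^+ 2 * u)).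

Lemma pi4_le2 : 0 <= 4 / (pi : R) <= 2.
Proof.
have pi0 := pi_gt0 R; have := pi_ge2 R; move: pi0; generalize (@pi R) => p p0 p2.
by rewrite divr_ge0 ?(ltW p0)//= ler_pdivrMr//; lra.
Qed.

(** Since [1 - r^(2k+1) <= (2k+1) (1 - r)], the factor [2k+1] cancels the denominator. *)
Lemma theta_sum_sub1 r M u : 0 <= r <= 1 -> 0 <= u ->
  `|theta_sum r M u - theta_sum 1 M u| <= 2 * M%:R * (1 - r).
Proof.
move=> /andP[r0 r1] u0; have /andP[p0 p2] := pi4_le2.
rewrite /theta_sum -mulrBr normrM (ger0_norm p0) -mulrA ler_pM//.
rewrite -sumrB; apply: le_trans (ler_norm_sum _ _ _) _.
rewrite -[X in X%:R](card_ord M) -sumr_const mulr_suml; apply: ler_sum => k _.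
rewrite expr1n mul1r mulr1.
rewrite (_ : _ - _ = - ((-1) ^+ k * ((1 - r ^+ (2 * k + 1)) / (2 * k + 1)%:R) * expR (- ((2 * k + 1)%:R ^+ 2 * u)))); last by ring.
have c0 : 0 < (2 * k + 1)%:R :> R by rewrite ltr0n addn1.
have e1 : expR (- ((2 * k + 1)%:R ^+ 2 * u)) <= 1.
  by rewrite -expR0 ler_expR oppr_le0 mulr_ge0// sqr_ge0.
rewrite normrN !normrM normrX normrN1 expr1n mul1r (ger0_norm (expR_ge0 _)).
rewrite normfV (gtr0_norm c0).
have b : `|1 - r ^+ (2 * k + 1)| <= (1 - r) * (2 * k + 1)%:R.
  rewrite mulrC; have := @norm_subXX_le R 1 r (2 * k + 1); rewrite expr1n normr1 lexx.
  by rewrite (ger0_norm r0) r1 => /(_ isT isT); rewrite (@ger0_norm _ (1 - r)) ?subr_ge0.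
rewrite -[leRHS]mulr1; apply: ler_pM => //.
by rewrite ler_pdivrMr.
Qed.

Lemma theta_sum_lipschitz M u u' : 0 <= u -> 0 <= u' ->
  `|theta_sum 1 M u - theta_sum 1 M u'| <= 2 * (M%:R * (2 * M)%:R * `|u - u'|).
Proof.
move=> u0 u'0; have /andP[p0 p2] := pi4_le2.
rewrite /theta_sum -mulrBr normrM (ger0_norm p0) ler_pM//.
rewrite -sumrB; apply: le_trans (ler_norm_sum _ _ _) _.
rewrite -[X in X%:R * _ * _](card_ord M) -sumr_const !mulr_suml; apply: ler_sum => k _.
have c0 : 0 < (2 * k + 1)%:R :> R by rewrite ltr0n addn1.
rewrite expr1n -mulrBr normrM mulr1 normrM normrX normrN1 expr1n !mul1r normfV (gtr0_norm c0).
rewrite mulrC ler_pdivrMr//.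
apply: le_trans (expR_lipschitz _ _) _; [by rewrite mulr_ge0// sqr_ge0..|].
rewrite -mulrBr normrM (ger0_norm (sqr_ge0 _)) expr2 -mulrA mulrC ler_pM2r//.
rewrite ler_wpM2r// ler_nat.
have := ltn_ord k; rewrite -(leq_pmul2l (isT : 0 < 2)%N); apply: leq_trans.
by rewrite mulnS addnC leq_add2r.
Qed.

(** A crude geometric bound from [k <= (2k+1)^2]. It is uniform in [r], [N] and [u >= d], which lets
    [M] be fixed before [r] and [N]. *)
Lemma theta_sum_tail r M N d u : 0 <= r <= 1 -> 0 < d -> d <= u -> (M <= N)%N ->
  `|theta_sum r N u - theta_sum r M u| <= 2 * (expR (- d) ^+ M / (1 - expR (- d))).
Proof.
move=> /andP[r0 r1] d0 du; have /andP[p0 p2] := pi4_le2.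
have q0 := expR_gt0 (- d); have q1 : expR (- d) < 1 by rewrite -expR0 ltr_expR oppr_lt0.
set q := expR (- d) in q0 q1 *.
move=> /subnKC <-; set m := (N - M)%N.
rewrite /theta_sum -mulrBr normrM (ger0_norm p0) ler_pM//.
have key k : `|(-1) ^+ k * r ^+ (2 * k + 1) / (2 * k + 1)%:R * expR (- ((2 * k + 1)%:R ^+ 2 * u))| <= q ^+ k.
  have c1 : 1 <= (2 * k + 1)%:R :> R by rewrite ler1n addn1.
  have c0 : 0 < (2 * k + 1)%:R :> R by apply: lt_le_trans c1.
  rewrite !normrM normrX normrN1 expr1n mul1r normfV (gtr0_norm c0) (ger0_norm (expR_ge0 _)).
  rewrite normrX (ger0_norm r0).
  rewrite -[leRHS]mul1r; apply: ler_pM => //.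
  - by rewrite divr_ge0 ?exprn_ge0// ltW.
  - by rewrite ler_pdivrMr// mul1r; apply: le_trans c1; rewrite exprn_ile1.
  - rewrite /q -expRM_natl ler_expR mulrN lerN2.
    apply: ler_pM => //; first exact: ltW.
    apply: (@le_trans _ _ ((2 * k + 1)%:R)); first by rewrite ler_nat mul2n -addnn -addnA leq_addr.
    by rewrite expr2 ler_peMr// ltW.
have : `|\sum_(k < M + m) (-1) ^+ k * r ^+ (2 * k + 1) / (2 * k + 1)%:R * expR (- ((2 * k + 1)%:R ^+ 2 * u)) -
   \sum_(k < M) (-1) ^+ k * r ^+ (2 * k + 1) / (2 * k + 1)%:R * expR (- ((2 * k + 1)%:R ^+ 2 * u))| <=
   q ^+ M * ((1 - q ^+ m) / (1 - q)).
  elim: m => [|m IH]; first by rewrite addn0 subrr normr0 expr0 subrr mul0r mulr0.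
  rewrite addnS big_ord_recr/= addrAC; apply: le_trans (ler_normD _ _) _.
  apply: le_trans (lerD IH (key _)) _.
  rewrite exprD -mulrDr le_eqVlt; apply/orP; left; apply/eqP; congr (_ * _).
  by rewrite exprS; field; rewrite subr_eq0 gt_eqF.
move/le_trans; apply; rewrite ler_wpM2l ?exprn_ge0 ?(ltW q0)//.
rewrite ler_pdivrMr ?subr_gt0// mulVf ?subr_eq0 ?gt_eqF// gerBl.
by rewrite exprn_ge0// ltW.
Qed.

(** Leibniz: after the first term, the sum is minus an alternating sum of the same kind, which lies
    between [0] and [a 1]. *)
Lemma alternating_sum_bounds (a : nat -> R) M :
  (forall k, 0 <= a k) -> (forall k, a k.+1 <= a k) ->
  0 <= \sum_(k < M) (-1) ^+ k * a k <= a 0%N.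
Proof.
move=> a0 aS; elim: M a a0 aS => [|M IH] a a0 aS; first by rewrite big_ord0 lexx a0.
rewrite big_ord_recl/= expr0 mul1r.
have -> : \sum_(i < M) (-1) ^+ bump 0 i * a (bump 0 i) = - \sum_(i < M) (-1) ^+ i * a i.+1.
  by rewrite -sumrN; apply: eq_bigr => i _; rewrite /bump leq0n add1n exprS mulN1r mulNr.
have := IH (fun k => a k.+1) (fun k => a0 _) (fun k => aS _).
by move=> /andP[h1 h2]; rewrite subr_ge0 (le_trans h2)//= gerBl.
Qed.

(** The terms alternate and decrease in [k], so the first one bounds the sum whatever [M]. This
    controls the theta sum for small and large [u], where the limit theorem says nothing. *)
Lemma theta_sum_bounds M u : 0 <= u -> 0 <= theta_sum 1 M u <= 2 * expR (- u).
Proof.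
move=> u0; have /andP[p0 p2] := pi4_le2.
pose a k : R := (2 * k + 1)%:R^-1 * expR (- ((2 * k + 1)%:R ^+ 2 * u)).
have := @alternating_sum_bounds a M.
have -> : \sum_(k < M) (-1) ^+ k * a k = \sum_(k < M) (-1) ^+ k * 1 ^+ (2 * k + 1) / (2 * k + 1)%:R * expR (- ((2 * k + 1)%:R ^+ 2 * u)).
  by apply: eq_bigr => k _; rewrite expr1n mulr1 mulrA.
have -> : a 0%N = expR (- u) by rewrite /a muln0 add0n expr1n invr1 !mul1r.
have a_ge0 k : 0 <= a k by rewrite mulr_ge0 ?expR_ge0 ?invr_ge0.
have a_decr k : a k.+1 <= a k.
  have lek : (2 * k + 1)%:R <= (2 * k.+1 + 1)%:R :> R by rewrite ler_nat leq_add2r leq_mul2l leqnSn.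
  have c0 : 0 < (2 * k + 1)%:R :> R by rewrite ltr0n addn1.
  apply: ler_pM; rewrite ?expR_ge0 ?invr_ge0//.
    by rewrite lef_pV2 ?posrE// (lt_le_trans c0).
  by rewrite ler_expR lerN2 ler_wpM2r// lerXn2r// nnegrE.
move=> /(_ a_ge0 a_decr) /andP[h1 h2].
rewrite /theta_sum; apply/andP; split; first by rewrite mulr_ge0.
by apply: ler_pM.
Qed.

End ThetaSum.

(** * Limit law of the survival probability *)

Section ErdosKac.
Context {d : measure_display} {T : measurableType d} {R : realType}.
Variables (P : probability T R) (X : nat -> {RV P >-> R}).
Hypothesis iidX : iid X.
Hypothesis X2int : P.-integrable setT (EFin \o (fun w => X 0%N w ^+ 2)).

Local Notation S := (partial_sum X).
Local Notation E := (Ex P).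
Local Notation X0 := (X 0%N).
Local Notation surv := (survive X).
Local Notation psurv := (psurv X).
Local Notation v := (var0 X).

Lemma cos_odd_pihalf k : cos ((2 * k + 1)%:R * (pi / 2)) = 0 :> R.
Proof.
elim: k => [|k IH]; first by rewrite muln0 add0n mul1r cos_pihalf.
rewrite (_ : (2 * k.+1 + 1)%:R * (pi / 2) = (2 * k + 1)%:R * (pi / 2) + pi); last first.
  by rewrite !natrD !natrM -(@natr1 _ k); move: (@pi R) => p; field.
by rewrite cosDpi IH oppr0.
Qed.

(* For [h = sigma phi(n) eps] and variance [sigma^2] this is [loglog n / eps^2]. *)
Definition ratio n h : R := pi ^+ 2 * v * n%:R / (8 * h ^+ 2).

Lemma killed_cos_sum_limit (c : nat -> R) N (K eta : R) : E X0 = 0 -> 0 < eta ->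
  exists n0 : nat, forall n h, (n0 <= n)%N -> 0 < h -> n%:R <= K * h ^+ 2 ->
    `|\sum_(k < N) c k * killed_cos X ((2 * k + 1)%:R * (pi / 2) / h) n h
      - \sum_(k < N) c k * expR (- ((2 * k + 1)%:R ^+ 2 * ratio n h))| <= eta.
Proof.
move=> EX0; elim: N eta => [|N IH] eta eta0.
  by exists 0%N => n h _ _ _; rewrite !big_ord0 subrr normr0 ltW.
have pi0 := pi_gt0 R.
have [n1 h1] := IH (eta / 2) (divr_gt0 eta0 (ltr0n _ 2)).
have c1 : 0 < `|c N| + 1 by rewrite ltr_wpDl.
have a0 : 0 < (2 * N + 1)%:R * (pi / 2) :> R.
  by rewrite mulr_gt0 ?ltr0n ?addn1// divr_gt0.
have [n2 h2] := killed_cos_limit iidX X2int K EX0 a0 (cos_odd_pihalf N)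
  (divr_gt0 (divr_gt0 eta0 (ltr0n _ 2)) c1).
exists (maxn n1 n2) => n h; rewrite geq_max => /andP[n1n n2n] h0 nK.
rewrite !big_ord_recr/=.
have {h1}b1 := h1 n h n1n h0 nK; have {h2}b2 := h2 n h n2n h0 nK.
have e : ((2 * N + 1)%:R * (pi / 2)) ^+ 2 * v / 2 * (n%:R / h ^+ 2) = (2 * N + 1)%:R ^+ 2 * ratio n h.
  by rewrite /ratio; move: (@pi R) => p; field; rewrite gt_eqF.
rewrite e in b2.
rewrite opprD addrACA; apply: le_trans (ler_normD _ _) _.
rewrite (splitr eta) lerD// -mulrBr normrM.
apply: (@le_trans _ _ ((`|c N| + 1) * (eta / 2 / (`|c N| + 1)))).
  by apply: ler_pM => //; rewrite lerDl.
by rewrite mulrC divfK// gt_eqF.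
Qed.

Lemma killed_sqwave_limit r N (K eta : R) : E X0 = 0 -> 0 < v -> 0 < eta ->
  exists n0 : nat, forall n h, (n0 <= n)%N -> 0 < h -> ratio n h <= K ->
    `|E (fun w => \1_(surv n h) w * sqwave r N (pi / 2 / h * S n w)) - theta_sum r N (ratio n h)| <= eta.
Proof.
move=> EX0 v0 eta0; have pi0 := pi_gt0 R.
pose c (k : nat) : R := 4 / pi * ((-1) ^+ k * r ^+ (2 * k + 1) / (2 * k + 1)%:R).
have [n0 hn0] := @killed_cos_sum_limit c N (8 * K / (pi ^+ 2 * v)) eta EX0 eta0.
exists n0 => n h n0n h0 uK.
have nK : n%:R <= 8 * K / (pi ^+ 2 * v) * h ^+ 2.
  move: uK; rewrite /ratio ler_pdivrMr ?mulr_gt0 ?exprn_gt0// => uK.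
  rewrite mulrAC ler_pdivlMr ?mulr_gt0 ?exprn_gt0//.
  by move: uK; set p2 := pi ^+ 2; set h2 := h ^+ 2; lra.
have := hn0 n h n0n h0 nK.
have -> : E (fun w => \1_(surv n h) w * sqwave r N (pi / 2 / h * S n w)) =
   \sum_(k < N) c k * killed_cos X ((2 * k + 1)%:R * (pi / 2) / h) n h.
  transitivity (E (fun w => \sum_(k < N) c k * (\1_(surv n h) w * cos ((2 * k + 1)%:R * (pi / 2) / h * S n w)))).
    apply: eq_Ex => w; rewrite /sqwave mulrCA mulr_sumr mulr_sumr; apply: eq_bigr => k _.
    rewrite (_ : (2 * k + 1)%:R * (pi / 2 / h * S n w) = (2 * k + 1)%:R * (pi / 2) / h * S n w).
      by rewrite /c; ring.
    by rewrite !mulrA.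
  have b k : bddmeas (fun w => \1_(surv n h) w * cos ((2 * k + 1)%:R * (pi / 2) / h * S n w)).
    by apply: bddmeasM; [exact: bddmeas_survive|exact: bddmeas_cosS].
  rewrite Ex_sum; last by move=> k; exact: bddmeasZ.
  by apply: eq_bigr => k _; rewrite ExZ.
have -> : theta_sum r N (ratio n h) = \sum_(k < N) c k * expR (- ((2 * k + 1)%:R ^+ 2 * ratio n h)).
  by rewrite /theta_sum mulr_sumr; apply: eq_bigr => k _; rewrite /c !mulrA.
by [].
Qed.

Lemma bddmeas_sqwave r N b n : bddmeas (fun w => sqwave r N (b * S n w)).
Proof.
apply: bddmeasZ; apply: bddmeas_sum => k; apply: bddmeasZ.
under eq_fun do rewrite mulrA; exact: bddmeas_cosS.
Qed.

Lemma cos_ge_of_le (b h s : R) : 0 <= b -> b * h <= pi -> `|s| <= h -> cos (b * h) <= cos (b * s).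
Proof.
move=> b0 bh sh.
rewrite -[leRHS]cos_norm normrM (ger0_norm b0).
have bs : b * `|s| <= b * h by rewrite ler_wpM2l.
have bs0 : 0 <= b * `|s| by rewrite mulr_ge0.
rewrite leNgt ltr_cos ?in_itv/= ?bs0 ?bh ?(le_trans bs0 bs)//= ?(le_trans bs bh)//.
by rewrite -leNgt.
Qed.

(** On survival [|S n| <= h], so the cosine is nonnegative and the Abel mean is at most [1]. *)
Lemma psurv_lower r N (eta h : R) n : 0 <= r < 1 -> 0 < h -> 0 <= eta ->
  (forall y, `|sqwave r N y - 2 / pi * atan (2 * cos y * r / (1 - r ^+ 2))| <= eta) ->
  E (fun w => \1_(surv n h) w * sqwave r N (pi / 2 / h * S n w)) - eta <= psurv n h.
Proof.
move=> r01 h0 eta0 hy; have pi0 := pi_gt0 R.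
have b0 : 0 <= pi / 2 / h by rewrite !divr_ge0// ltW.
have bh : pi / 2 / h * h = pi / 2 by rewrite divfK// gt_eqF.
have bs := bddmeas_survive X n h.
rewrite lerBlDr.
apply: (@le_trans _ _ (E (fun w => \1_(surv n h) w * (1 + eta)))).
  apply: le_Ex.
  - by apply: bddmeasM => //; exact: bddmeas_sqwave.
  - by apply: bddmeasM => //; exact: bddmeas_cst.
  - move=> w; rewrite indicE; case: (boolP (w \in _)) => /= [|_]; last by rewrite !mul0r.
    rewrite inE /survive/= => Mh; rewrite !mul1r.
    have Sh := le_trans (le_max_partial_sum X n w) Mh.
    have := cos_ge_of_le b0 _ Sh; rewrite bh cos_pihalf => cy.
    have {}cy := cy (ler_piMr (ltW pi0) (ltac:(lra) : 2^-1 <= 1 :> R)).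
    have /andP[_ p1] := poisson_atan_bounds cy r01.
    have := hy (pi / 2 / h * S n w); rewrite ler_norml => /andP[_ hu].
    by rewrite lerBlDl in hu; apply: le_trans hu _; rewrite lerD2r.
rewrite (_ : (fun w => _) = (fun w => (1 + eta) * \1_(surv n h) w)); last by apply/funext => w; rewrite mulrC.
by rewrite ExZ// -psurvE mulrDl mul1r lerD2l ler_piMr// psurv_le1.
Qed.

(* Killing at the larger level [h'] keeps the walk away from the points where the Abel means of
   the square wave are not close to [1]. *)
Lemma psurv_upper r N (eta h h' c0 : R) n : 0 <= r < 1 -> 0 < h -> h <= h' -> 0 <= eta -> 0 <= c0 ->
  c0 <= cos (pi / 2 / h' * h) ->
  (forall c, c0 <= c -> 1 - eta <= 2 / pi * atan (2 * c * r / (1 - r ^+ 2))) ->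
  (forall y, `|sqwave r N y - 2 / pi * atan (2 * cos y * r / (1 - r ^+ 2))| <= eta) ->
  psurv n h <= E (fun w => \1_(surv n h') w * sqwave r N (pi / 2 / h' * S n w)) + 2 * eta.
Proof.
move=> r01 h0 hh' eta0 c00 cc0 hc hy; have pi0 := pi_gt0 R.
have h'0 : 0 < h' by apply: lt_le_trans hh'.
have b0 : 0 <= pi / 2 / h' by rewrite !divr_ge0// ltW.
have bh : pi / 2 / h' * h' = pi / 2 by rewrite divfK// gt_eqF.
have pi2 : pi / 2 <= pi :> R := ler_piMr (ltW pi0) (ltac:(lra) : 2^-1 <= 1 :> R).
have bs := bddmeas_survive X n h'.
have b1 : bddmeas (fun w => \1_(surv n h') w * sqwave r N (pi / 2 / h' * S n w)).
  by apply: bddmeasM => //; exact: bddmeas_sqwave.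
rewrite -[X in _ + X](Ex_cst P) -ExD//; last exact: bddmeas_cst.
rewrite psurvE; apply: le_Ex.
- exact: bddmeas_survive.
- by apply: bddmeasD => //; exact: bddmeas_cst.
move=> w.
have := hy (pi / 2 / h' * S n w); rewrite ler_norml => /andP[hl _].
have sub : w \in surv n h -> w \in surv n h'.
  by rewrite !inE /survive/= => /le_trans; apply.
rewrite !indicE; case: (boolP (w \in surv n h)) => [ws|_] /=.
  rewrite (sub ws) mul1r.
  have Sh : `|S n w| <= h.
    by move: ws; rewrite inE /survive/=; apply: le_trans; exact: le_max_partial_sum.
  have bh2 : pi / 2 / h' * h <= pi.
    by apply: le_trans pi2; rewrite -[leRHS]bh ler_wpM2l.
  have := hc _ (le_trans cc0 (cos_ge_of_le b0 bh2 Sh)).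
  by lra.
case: (boolP (w \in surv n h')) => [|_] /=; last by rewrite mul0r add0r mulr_ge0.
rewrite inE /survive/= => Mh; rewrite mul1r.
have Sh := le_trans (le_max_partial_sum X n w) Mh.
have := cos_ge_of_le b0 _ Sh; rewrite bh cos_pihalf => /(_ pi2) cy.
have /andP[p1 _] := poisson_atan_bounds cy r01.
by lra.
Qed.

(** [M] is only bounded below, so that it can later be enlarged to sum the series of the constant as
    well. The choices are nested: [M] from the tail of the series, the enlargement [d1] of the
    level, [r] close to [1], then [N], and the threshold on [n] last. *)
Theorem erdos_kac (dl K eta : R) : E X0 = 0 -> 0 < v -> 0 < dl -> 0 < eta ->
  exists M0 : nat, forall M, (M0 <= M)%N -> exists n0 : nat, forall n h,
    (n0 <= n)%N -> 0 < h -> dl <= ratio n h <= K -> `|psurv n h - theta_sum 1 M (ratio n h)| <= eta.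
Proof.
move=> EX0 v0 dl0 eta60; have pi0 := pi_gt0 R.
(* The upper bound spends [2 e] on the square wave, [e] on the limit in [n], [2 e] on truncation and
   damping, and [e] on the change of level. *)
pose e := eta / 6.
have e0 : 0 < e by rewrite divr_gt0.
wlog K0 : K / 0 < K.
  move=> H; have [M0 hM0] := H (`|K| + 1) (ltr_wpDl (normr_ge0 _) ltr01).
  exists M0 => M M0M; have [n0 hn0] := hM0 M M0M; exists n0 => n h n0n h0 /andP[u1 u2].
  by apply: hn0 => //; rewrite u1/= (le_trans u2)// ler_wpDr// ler_norm.
(* As [d1 <= 1], the enlarged level has ratio [u / (1 + d1)^2 >= u / 4]. *)
pose dd := dl / 4.
have dd0 : 0 < dd by rewrite divr_gt0.
pose q := expR (- dd).
have q0 : 0 < q := expR_gt0 _.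
have q1 : q < 1 by rewrite -expR0 ltr_expR oppr_lt0.
have [M0 hM0] : exists M0 : nat, forall M, (M0 <= M)%N -> 2 * (q ^+ M / (1 - q)) <= e.
  have : q ^+ M @[M --> \oo] --> (0 : R) by apply: cvg_expr; rewrite ger0_norm ?ltW.
  have ep : 0 < e * (1 - q) / 2 by rewrite divr_gt0// mulr_gt0// subr_gt0.
  move=> /cvgrPdist_le /(_ _ ep) [M0 _ hM0]; exists M0 => M M0M.
  have := hM0 M M0M; rewrite /= sub0r normrN ger0_norm ?exprn_ge0 ?(ltW q0)// => h.
  by rewrite mulrA ler_pdivrMr ?subr_gt0//; lra.
exists M0 => M M0M.
(* Lipschitz constant of the theta sum times [2 K], since the change of level moves [u] by at most
   [2 K d1]; the final [1] keeps [D] positive. *)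
pose D := 2 * (M%:R * (2 * M)%:R * (2 * K)) + 1 : R.
have D1 : 1 <= D by rewrite /D lerDr// !mulr_ge0// ltW.
have D0 : 0 < D by apply: lt_le_trans D1.
pose d1 := Num.min 1 (e / D).
have d10 : 0 < d1 by rewrite lt_min ltr01 divr_gt0.
have d11 : d1 <= 1 by rewrite ge_min lexx.
have d1D : d1 * D <= e by rewrite -ler_pdivlMr// ge_min lexx orbT.
have s0 : 0 < 1 + d1 by rewrite addr_gt0.
pose c0 : R := cos (pi / 2 / (1 + d1)).
have c00 : 0 < c0.
  apply: cos_gt0_pihalf; apply/andP; split.
    by apply: (@lt_le_trans _ _ 0); [rewrite oppr_lt0 divr_gt0|rewrite !divr_ge0// ltW].
  by rewrite ltr_pdivrMr// ltr_pMr ?divr_gt0// ltrDl.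
have [r0 /andP[r00 r01] hr0] := poisson_atan_cvg c00 e0.
pose r := Num.max r0 (1 - e / (2 * M.+1%:R)).
have M20 : 0 < 2 * M.+1%:R :> R by rewrite mulr_gt0.
have r0r : r0 <= r by rewrite le_max lexx.
have r_1 : r < 1 by rewrite gt_max r01/= gtrBl divr_gt0.
have r_0 : 0 <= r by apply: le_trans r0r.
have rM : 2 * M%:R * (1 - r) <= e.
  apply: (@le_trans _ _ (2 * M.+1%:R * (1 - r))).
    by rewrite ler_wpM2r ?subr_ge0 ?(ltW r_1)// ler_wpM2l// ler_nat.
  by rewrite mulrC -ler_pdivlMr// lerBlDl -lerBlDr le_max lexx orbT.
have rr : 0 <= r < 1 by rewrite r_0.
have rr' : 0 <= r <= 1 by rewrite r_0 ltW.
have [N0 hN0] := sqwave_approx rr e0.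
pose N := maxn M N0.
have MN : (M <= N)%N := leq_maxl _ _.
have hy y := hN0 N y (leq_maxr _ _).
have [n1 hn1] := @killed_sqwave_limit r N K e EX0 v0 e0.
exists n1 => n h n1n h0 /andP[udl uK].
pose h' := (1 + d1) * h.
have h'0 : 0 < h' by rewrite mulr_gt0.
have hh' : h <= h' by rewrite /h' ler_peMl ?(ltW h0)// lerDl ltW.
set u := ratio n h in udl uK *.
have u0 : 0 < u by apply: lt_le_trans udl.
pose u' := ratio n h'.
have u'E : u' = u / (1 + d1) ^+ 2.
  rewrite /u' /u /ratio /h'; move: (@pi R) => p; field.
  by rewrite !gt_eqF.
have s2 : 0 < (1 + d1) ^+ 2 by rewrite exprn_gt0.
have s21 : 1 <= (1 + d1) ^+ 2 by rewrite exprn_ege1// lerDl ltW.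
have s24 : (1 + d1) ^+ 2 <= 4.
  rewrite (_ : 4 = 2 ^+ 2 :> R); last by ring.
  by rewrite lerXn2r ?nnegrE//; lra.
have u'u : u' <= u by rewrite u'E ler_pdivrMr// ler_peMr// ltW.
have u'd : dd <= u'.
  rewrite u'E /dd; apply: (@le_trans _ _ (u / 4)); first by rewrite ler_pM2r.
  by rewrite ler_pM2l// lef_pV2 ?posrE.
have u'0 : 0 < u' by apply: lt_le_trans u'd.
have ud : dd <= u by apply: le_trans u'd u'u.
have uu' : `|u' - u| <= 2 * K * d1.
  rewrite distrC ger0_norm ?subr_ge0// u'E.
  have -> : u - u / (1 + d1) ^+ 2 = u * ((2 * d1 + d1 ^+ 2) / (1 + d1) ^+ 2).
    by field; rewrite gt_eqF.
  rewrite (_ : 2 * K * d1 = K * (2 * d1)); last by ring.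
  apply: ler_pM => //.
  - exact: ltW.
  - by rewrite divr_ge0 ?(ltW s2)// addr_ge0 ?sqr_ge0// mulr_ge0// ltW.
  - rewrite ler_pdivrMr//.
    have : d1 * 1 <= d1 * (1 + d1) ^+ 2 by rewrite ler_pM2l.
    have : d1 ^+ 2 <= d1 * (1 + d1) ^+ 2.
      rewrite expr2 ler_pM2l//; apply: le_trans d11 s21.
    have -> : 2 * d1 * (1 + d1) ^+ 2 = 2 * (d1 + 2 * d1 ^+ 2 + d1 ^+ 3) by ring.
    have : 0 <= d1 ^+ 3 by rewrite exprn_ge0// ltW.
    have : 0 <= d1 ^+ 2 by exact: sqr_ge0.
    by move=> a1 a2; lra.
have lip : `|theta_sum 1 M u' - theta_sum 1 M u| <= e.
  apply: le_trans (theta_sum_lipschitz _ (ltW u'0) (ltW u0)) _.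
  apply: (@le_trans _ _ (d1 * (2 * (M%:R * (2 * M)%:R * (2 * K))))).
    have MM : 0 <= M%:R * (2 * M)%:R :> R by rewrite mulr_ge0.
    have : M%:R * (2 * M)%:R * `|u' - u| <= M%:R * (2 * M)%:R * (2 * K * d1) by rewrite ler_wpM2l.
    by set A := M%:R * _; lra.
  by apply: le_trans d1D; rewrite ler_pM2l// /D lerDl.
have cmp x : dd <= x -> `|theta_sum r N x - theta_sum 1 M x| <= 2 * e.
  move=> ddx; have x0 : 0 <= x by apply: le_trans ddx; exact: ltW.
  have t1 := theta_sum_tail rr' dd0 ddx MN.
  have t2 := theta_sum_sub1 M rr' x0.
  have -> : theta_sum r N x - theta_sum 1 M x = (theta_sum r N x - theta_sum r M x) + (theta_sum r M x - theta_sum 1 M x) by ring.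
  apply: le_trans (ler_normD _ _) _.
  rewrite mulr2n mulrDl mul1r; apply: lerD; last exact: le_trans rM.
  exact: le_trans t1 (hM0 M M0M).
have L := psurv_lower n rr h0 (ltW e0) hy.
have cc : c0 <= cos (pi / 2 / h' * h).
  rewrite /c0 /h' (_ : pi / 2 / ((1 + d1) * h) * h = pi / 2 / (1 + d1))//.
  by move: (@pi R) => p; field; rewrite !gt_eqF.
have U := psurv_upper n rr h0 hh' (ltW e0) (ltW c00) cc (fun c cc => hr0 r c (introT andP (conj r0r r_1)) cc) hy.
have l1 := hn1 n h n1n h0 uK.
have l2 := hn1 n h' n1n h'0 (le_trans u'u uK).
rewrite -/u in l1; rewrite -/u' in l2.
have c1 := cmp u ud; have c2 := cmp u' u'd.
have eE : eta = 6 * e by rewrite /e; field.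
move: l1 l2 c1 c2 lip L U; rewrite !ler_norml.
move=> /andP[? ?] /andP[? ?] /andP[? ?] /andP[? ?] /andP[? ?] ? ?.
by apply/andP; split; lra.
Qed.

End ErdosKac.

(** * The Gamma integral *)

Section GammaTail.
Context {R : realType}.
Variable b : R.
Hypothesis b1 : -1 < b.
Local Notation mu := (@lebesgue_measure R).

Definition gammaf (t : R) : R := t `^ b * expR (- t).
Local Notation g := gammaf.

Lemma gammaf_ge0 t : 0 <= g t.
Proof. by rewrite /gammaf mulr_ge0 ?powR_ge0 ?expR_ge0. Qed.

Lemma measurable_gammaf : measurable_fun setT g.
Proof.
apply: measurable_funM; first exact: measurable_powR.
by apply: measurableT_comp => //; exact: measurable_funN.
Qed.

Lemma measurable_Egammaf D : measurable D -> measurable_fun D (EFin \o g).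
Proof. by move=> mD; apply: measurableT_comp => //; apply: measurable_funTS; exact: measurable_gammaf. Qed.

(** From [t <= 2 N e^(t / (2 N))], raised to the power [N >= b]. *)
Lemma powR_le_expR : exists C, forall t, 1 <= t -> t `^ b <= C * expR (t / 2).
Proof.
pose N := (Num.truncn `|b|).+1.
have bN : b <= N%:R.
  by apply: le_trans (ler_norm b) _; apply/ltW; apply: lt_le_trans (truncnS_gt _) _.
exists ((2 * N%:R) ^+ N) => t t1.
have t0 : 0 < t by apply: lt_le_trans t1.
apply: (@le_trans _ _ (t `^ N%:R)); first exact: ler_powR.
rewrite powR_mulrn ?(ltW t0)//.
have N0 : 0 < N%:R :> R by rewrite ltr0n.
have -> : expR (t / 2) = expR (t / (2 * N%:R)) ^+ N.
  by rewrite -expRM_natl; congr expR; field; rewrite gt_eqF.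
have e0 : 0 <= 2 * N%:R * expR (t / (2 * N%:R)).
  by apply: mulr_ge0; [apply: mulr_ge0 | exact: expR_ge0].
rewrite -exprMn lerXn2r ?nnegrE ?(ltW t0)//.
have := expR_ge1Dx (t / (2 * N%:R)) => h.
apply: (@le_trans _ _ (2 * N%:R * (t / (2 * N%:R)))).
  by rewrite mulrC divfK// gt_eqF// mulr_gt0.
by rewrite ler_wpM2l ?mulr_ge0// ?(ltW N0)//; lra.
Qed.

Lemma integral_gammaf_infty : (\int[mu]_(t in `[1%R, +oo[) (g t)%:E < +oo)%E.
Proof.
have [C hC] := powR_le_expR.
have h2 : 0 < 1 / 2 :> R by rewrite divr_gt0.
have C0 : 0 <= C.
  have := hC 1 (lexx _); rewrite powR1 => /(le_trans ler01).
  by rewrite pmulr_lge0// expR_gt0.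
have mE : measurable_fun setT (fun t : R => (expR (- (1 / 2) * t))%:E).
  by apply: measurableT_comp => //; apply: measurableT_comp => //; exact: measurable_funM.
apply: (@le_lt_trans _ _ (\int[mu]_(t in `[1%R, +oo[) (C%:E * (expR (- (1 / 2) * t))%:E))%E).
  apply: ge0_le_integral => //.
  - by move=> t _; rewrite /= lee_fin gammaf_ge0.
  - exact: measurable_Egammaf.
  - by apply: measurable_funeM; exact: measurable_funTS.
  - move=> t; rewrite /= in_itv/= andbT => t1; rewrite -EFinM lee_fin /gammaf.
    rewrite (_ : expR (- (1 / 2) * t) = expR (t / 2) * expR (- t)); last first.
      by rewrite -expRD; congr expR; field.
    by rewrite mulrA ler_wpM2r ?expR_ge0// hC.
rewrite ge0_integralZl//; last exact: measurable_funTS.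
rewrite lte_mul_pinfty// ?lee_fin//.
(* On the half-line [e^(-t/2)] is twice the exponential density of rate [1 / 2], whose total mass is
   one. *)
apply: (@le_lt_trans _ _ (\int[mu]_(t in setT) (2%:E * (exponential_pdf (1 / 2) t)%:E))%E); last first.
  rewrite ge0_integralZl//.
  - by rewrite integral_exponential_pdf// mule1 ltry.
  - by apply: measurableT_comp => //; exact: measurable_exponential_pdf.
  - by move=> t _; rewrite lee_fin exponential_pdf_ge0// ltW.
rewrite integral_mkcond; apply: ge0_le_integral => //.
- by move=> t _; rewrite patchE; case: ifP => // _; rewrite lee_fin expR_ge0.
- by apply/measurable_restrict => //; exact: measurable_funTS.
- apply: measurable_funeM; apply: measurableT_comp => //; exact: measurable_exponential_pdf.
- move=> t _; rewrite patchE; case: ifPn => [|_]; last first.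
    by rewrite -EFinM lee_fin mulr_ge0 ?exponential_pdf_ge0 ?ltW.
  rewrite inE/= in_itv/= andbT => t1.
  rewrite -EFinM lee_fin exponential_pdfE ?(le_trans ler01)//.
  by rewrite mulrA (_ : 2 * (1 / 2) = 1) ?mul1r//; field.
Qed.

(** The primitive is [t^(b+1) / (b+1)]; as [-1 < b], its value at [a] is nonnegative, so the bound
    does not depend on [a]. *)
Lemma integral_powR_le (a : R) : 0 < a <= 1 ->
  (\int[mu]_(t in `[a, 1%R]) (t `^ b)%:E <= (1 / (b + 1))%:E)%E.
Proof.
have bp : 0 < b + 1 by rewrite -ltrBlDr sub0r.
move=> /andP[a0]; rewrite le_eqVlt => /predU1P[->|a1].
  by rewrite set_itv1 integral_set1 lee_fin divr_ge0// ltW.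
pose F (t : R) := (b + 1)^-1 * t `^ (b + 1).
have dF (t : R) : 0 < t -> is_derive t 1 F (t `^ b).
  move=> t0; have := is_deriveZ (b + 1)^-1 (is_derive1_powR (b + 1) t0).
  by move/is_derive_eq; apply; rewrite /GRing.scale/= mulrA mulVf ?gt_eqF// mul1r addrK.
have cont (f : R -> R) (df t : R) : is_derive t 1 f df -> f x @[x --> t] --> f t.
  by move=> h; apply: differentiable_continuous; apply/derivable1_diffP.
have cF (t : R) : 0 < t -> F x @[x --> t] --> F t.
  by move=> t0; exact: cont (dF t t0).
rewrite (@continuous_FTC2 _ _ F)//.
- rewrite -EFinD lee_fin /F powR1 mulr1 div1r gerBl mulr_ge0 ?powR_ge0// invr_ge0 ltW//.
- apply: derivable_within_continuous => t; rewrite in_itv/= => /andP[at_ _].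
  by have h := is_derive1_powR b (lt_le_trans a0 at_).
- split.
  + move=> t; rewrite in_itv/= => /andP[at_ _].
    by have h := dF t (lt_trans a0 at_).
  + by apply: cvg_at_right_filter; exact: cF.
  + by apply: cvg_at_left_filter; exact: cF.
- move=> t; rewrite in_itv/= => /andP[at_ _].
  by have h := dF t (lt_trans a0 at_); rewrite derive1E derive_val.
Qed.

Lemma integral_gammaf_01 : (\int[mu]_(t in `]0%R, 1%R]) (g t)%:E < +oo)%E.
Proof.
pose F (n : nat) : set R := `[n.+1%:R^-1, 1]%classic.
have FE : \bigcup_n F n = `]0, 1]%classic.
  rewrite predeqE => t; split.
    move=> [n _]; rewrite /F/= !in_itv/= => /andP[nt ->]; rewrite andbT.
    by apply: lt_le_trans nt; rewrite invr_gt0.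
  rewrite /= in_itv/= => /andP[t0 t1].
  exists (Num.truncn t^-1) => //; rewrite /F/= in_itv/= t1 andbT.
  by rewrite invf_ple ?posrE// ltW// truncnS_gt.
apply: (@le_lt_trans _ _ ((1 / (b + 1))%:E)); last by rewrite ltry.
have hlim : ((fun n => \int[mu]_(x in F n) (EFin \o g) x) @ \oo --> \int[mu]_(t in `]0%R, 1%R]) (EFin \o g) t)%E.
  rewrite -FE; apply: ge0_nondecreasing_set_cvg_integral.
  - move=> n m nm; rewrite subsetEset => t; rewrite /F/= !in_itv/= => /andP[h ->]; rewrite andbT.
    by apply: le_trans h; rewrite lef_pV2 ?posrE// ler_nat.
  - by move=> n; exact: measurable_itv.
  - by move=> n; apply: measurable_Egammaf; exact: measurable_itv.
  - by move=> n t _; rewrite /= lee_fin gammaf_ge0.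
rewrite -(cvg_lim _ hlim)//; apply: lime_le; first by apply/cvg_ex; eexists; exact: hlim.
near=> n.
have n01 : 0 < (n.+1%:R^-1 : R) <= 1 by rewrite invr_gt0 ltr0n/= invf_le1// ler1n.
apply: le_trans (integral_powR_le n01).
apply: ge0_le_integral => //.
- exact: measurable_itv.
- by move=> t _; rewrite /= lee_fin gammaf_ge0.
- by apply: measurable_Egammaf; exact: measurable_itv.
- by apply: measurableT_comp => //; apply: measurable_funTS; exact: measurable_powR.
- move=> t; rewrite /F/= in_itv/= => /andP[nt _]; rewrite lee_fin /gammaf ler_piMr ?powR_ge0//.
  rewrite -expR0 ler_expR oppr_le0; apply: le_trans nt; rewrite invr_ge0//.
Unshelve. all: by end_near. Qed.

Lemma integrable_gammaf : mu.-integrable `]0, +oo[ (EFin \o g).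
Proof.
apply/integrableP; split; first by apply: measurable_Egammaf; exact: measurable_itv.
under eq_integral do rewrite /= ger0_norm ?gammaf_ge0//.
rewrite (_ : [set` `]0, +oo[] = `]0, 1]%classic `|` `]1, +oo[%classic); last first.
  by rewrite -itv_bndbnd_setU// bnd_simp.
rewrite ge0_integral_setU//.
- apply: lte_add_pinfty; first exact: integral_gammaf_01.
  apply: le_lt_trans integral_gammaf_infty.
  apply: ge0_subset_integral => //.
  + exact: measurable_Egammaf.
  + by move=> t _; rewrite /= lee_fin gammaf_ge0.
  + by move=> t; rewrite /= !in_itv/= !andbT => /ltW.
- by apply: measurable_Egammaf; apply: measurableU.
- by move=> t _; rewrite /= lee_fin gammaf_ge0.
- apply/disj_setPS => t [/=]; rewrite !in_itv/= andbT => /andP[_ t1] /(le_lt_trans t1).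
  by rewrite ltxx.
Qed.

Definition Gm (D : set R) : R := \int[mu]_(t in D) g t.

Lemma integrable_gammaf_sub (D : set R) : measurable D -> D `<=` `]0, +oo[%classic ->
  mu.-integrable D (EFin \o g).
Proof. by move=> mD sD; apply: integrableS integrable_gammaf. Qed.

Lemma sub_Gm (A B : set R) : measurable A -> measurable B -> A `<=` B -> B `<=` `]0, +oo[%classic -> Gm A <= Gm B.
Proof.
move=> mA mB AB B0.
have iB := integrable_gammaf_sub mB B0.
have iA := integrable_gammaf_sub mA (subset_trans AB B0).
apply: fine_le; [exact: integrable_fin_num..|].
apply: ge0_subset_integral => //; first exact: measurable_Egammaf.
by move=> t _; rewrite /= lee_fin gammaf_ge0.
Qed.

Lemma Gm_ge0 D : 0 <= Gm D.
Proof. by apply: Rintegral_ge0 => t _; exact: gammaf_ge0. Qed.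

Lemma GammaE : Gamma (b + 1) = Gm `]0, +oo[.
Proof. by rewrite /Gamma addrK. Qed.

Lemma Gm_split (x y : R) : 0 < x -> x <= y -> Gm `[x, +oo[ = Gm `[x, y[ + Gm `[y, +oo[.
Proof.
move=> x0 xy; rewrite /Gm.
rewrite (_ : [set` `[x, +oo[] = `[x, y[%classic `|` `[y, +oo[%classic); last first.
  by rewrite -itv_bndbnd_setU// bnd_simp.
rewrite Rintegral_setU//.
- apply: integrable_gammaf_sub; first exact: measurableU.
  move=> t [|] /=; rewrite !in_itv/= !andbT.
    by move=> /andP[/(lt_le_trans x0)].
  by apply: lt_le_trans; exact: lt_le_trans xy.
- apply/disj_setPS => t [/=]; rewrite !in_itv/= andbT => /andP[_ t1] /(lt_le_trans t1).
  by rewrite ltxx.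
Qed.

Lemma Gm_bounds (x y lo hi : R) : 0 < x -> x <= y ->
  (forall t, x <= t <= y -> lo <= g t <= hi) ->
  lo * (y - x) <= Gm `[x, y[ <= hi * (y - x).
Proof.
move=> x0 xy h.
have sub : `[x, y[%classic `<=` `]0, +oo[%classic.
  by move=> t; rewrite /= !in_itv/= andbT => /andP[/(lt_le_trans x0)].
have ig := integrable_gammaf_sub (measurable_itv _) sub.
have muE : mu `[x, y[%classic = (y - x)%:E.
  rewrite lebesgue_measure_itv/= lte_fin; move: xy; rewrite le_eqVlt => /predU1P[->|->].
    by rewrite ltxx subrr.
  by rewrite EFinB.
have cE (c : R) : c * (y - x) = \int[mu]_(t in `[x, y[) c.
  by rewrite Rintegral_cst// [X in fine X]muE.
have ic (c : R) : mu.-integrable `[x, y[ (EFin \o (fun=> c)).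
  apply: measurable_bounded_integrable => //.
    by rewrite [X in (X < _)%E]muE ltry.
  by exists `|c|; split; rewrite ?num_real// => z cz t _; exact: ltW.
apply/andP; split; rewrite cE; apply: le_Rintegral => // t; rewrite /= in_itv/= => /andP[xt ty].
  by have /andP[] := h t (introT andP (conj xt (ltW ty))).
by have /andP[] := h t (introT andP (conj xt (ltW ty))).
Qed.

(** The intervals [[1 / (n + 1), n + 1[] exhaust the half-line. One that captures all but [eta] of
    the mass settles both ends, so a single [A] serves. *)
Lemma Gm_limits (eta : R) : 0 < eta -> exists2 A, 0 < A &
  (forall a, 0 < a <= A -> Gamma (b + 1) - eta <= Gm `[a, +oo[ <= Gamma (b + 1)) /\
  (forall a, A^-1 <= a -> Gm `[a, +oo[ <= eta).
Proof.
move=> eta0.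
pose F (n : nat) : set R := `[n.+1%:R^-1, n.+1%:R[%classic.
have sF n : F n `<=` `]0, +oo[%classic.
  move=> t; rewrite /F/= !in_itv/= andbT => /andP[nt _].
  by apply: lt_le_trans nt; rewrite invr_gt0.
have FE : \bigcup_n F n = `]0, +oo[%classic.
  rewrite predeqE => t; split; first by move=> [n _ /sF].
  rewrite /= in_itv/= andbT => t0.
  exists (maxn (Num.truncn t^-1) (Num.truncn t)) => //; rewrite /F/= in_itv/=; apply/andP; split.
    rewrite invf_ple ?posrE//; apply/ltW; apply: lt_le_trans (truncnS_gt _) _.
    by rewrite ler_nat ltnS leq_maxl.
  by apply: lt_le_trans (truncnS_gt _) _; rewrite ler_nat ltnS leq_maxr.
have hlim : ((fun n => \int[mu]_(x in F n) (EFin \o g) x) @ \oo --> \int[mu]_(t in `]0%R, +oo[) (EFin \o g) t)%E.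
  rewrite -FE; apply: ge0_nondecreasing_set_cvg_integral.
  - move=> n m nm; rewrite subsetEset => t; rewrite /F/= !in_itv/= => /andP[h1 h2]; apply/andP; split.
      by apply: le_trans h1; rewrite lef_pV2 ?posrE// ler_nat.
    by apply: lt_le_trans h2 _; rewrite ler_nat.
  - by move=> n; exact: measurable_itv.
  - by move=> n; apply: measurable_Egammaf; exact: measurable_itv.
  - by move=> n t _; rewrite /= lee_fin gammaf_ge0.
have {}hlim : Gm (F n) @[n --> \oo] --> Gamma (b + 1).
  rewrite GammaE; apply: fine_cvg; rewrite fineK//; exact: integrable_fin_num integrable_gammaf.
have [N hN] : exists N, Gamma (b + 1) - eta <= Gm (F N).
  move/cvgrPdist_le : hlim => /(_ _ eta0) [N _ /(_ N (leqnn N))] /=.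
  by rewrite ler_norml => /andP[_ h]; exists N; lra.
have mI (a : R) : measurable `[a, +oo[%classic by exact: measurable_itv.
exists N.+1%:R^-1; first by rewrite invr_gt0.
split => a; first (move=> /andP[a0 aN]; apply/andP; split).
- apply: le_trans hN _; apply: sub_Gm => //.
  + exact: measurable_itv.
  + move=> t; rewrite /F/= !in_itv/= andbT => /andP[h _]; exact: le_trans h.
  + by move=> t; rewrite /= !in_itv/= !andbT; exact: lt_le_trans.
- by rewrite GammaE; apply: sub_Gm => // t; rewrite /= !in_itv/= !andbT; exact: lt_le_trans.
- rewrite invrK => Na.
  have N1 : N.+1%:R^-1 <= N.+1%:R :> R.
    by apply: (@le_trans _ _ 1); rewrite ?invf_le1 ?ler1n.
  have Np : 0 < N.+1%:R^-1 :> R by rewrite invr_gt0.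
  have : Gm `[N.+1%:R^-1, +oo[ <= Gamma (b + 1).
    by rewrite GammaE; apply: sub_Gm => // t; rewrite /= !in_itv/= !andbT; exact: lt_le_trans.
  rewrite (Gm_split Np N1) -/(F N) => h.
  apply: (@le_trans _ _ (Gm `[N.+1%:R, +oo[)); last by lra.
  apply: sub_Gm => // t; rewrite /= !in_itv/= !andbT; first exact: le_trans.
  by apply: lt_le_trans.
Qed.

Lemma Gamma_gt0 : 0 < Gamma (b + 1).
Proof.
(* The minimum and the maximum cover both signs of [b]. *)
have h : forall t : R, 1 <= t <= 2 -> Num.min 1 (2 `^ b) * expR (- 2) <= g t <= Num.max 1 (2 `^ b).
  move=> t /andP[t1 t2]; have t0 : 0 < t by lra.
  have e1 : expR (- 2) <= expR (- t) by rewrite ler_expR lerN2.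
  have e2 : expR (- t) <= 1 by rewrite -expR0 ler_expR oppr_le0 ltW.
  have tb : Num.min 1 (2 `^ b) <= t `^ b <= Num.max 1 (2 `^ b).
    have [b0|b0] := leP 0 b.
      have h1 : 1 <= t `^ b by rewrite -[leLHS](powRr0 t) ler_powR.
      have h2 : t `^ b <= 2 `^ b by rewrite ge0_ler_powR ?nnegrE// ltW.
      by rewrite ge_min h1/= le_max h2 orbT.
    have h1 : t `^ b <= 1 by rewrite -[leRHS](powRr0 t) ler_powR// ltW.
    have h2 : 2 `^ b <= t `^ b.
      rewrite -(opprK b) !(powRN _ (- b)) lef_pV2 ?posrE ?powR_gt0//.
      by rewrite ge0_ler_powR ?nnegrE ?oppr_ge0 ?(ltW b0)// ltW.
    by rewrite ge_min h2 orbT/= le_max h1.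
  move: tb => /andP[m1 m2]; rewrite /gammaf; apply/andP; split.
    by apply: ler_pM => //; rewrite ?expR_ge0// le_min ler01 powR_ge0.
  by apply: le_trans m2; rewrite ler_piMr ?powR_ge0.
have /andP[lo _] := Gm_bounds ltr01 (ltac:(lra) : 1 <= 2 :> R) h.
apply: (@lt_le_trans _ _ (Gm `[1, 2[)); last first.
  rewrite GammaE; apply: sub_Gm => //; try exact: measurable_itv.
  by move=> t; rewrite /= !in_itv/= andbT => /andP[/(lt_le_trans ltr01)].
by apply: lt_le_trans lo; rewrite mulr_gt0// subr_gt0 ltr1n.
Qed.

End GammaTail.

(** * Iterated logarithms as the mesh of a Riemann sum *)

Section IteratedLogarithm.
Context {R : realType}.
Implicit Types x T : R.

Lemma logt_ge1 x : 1 <= logt x.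
Proof.
rewrite /logt -{1}(expRK (1 : R)) ler_ln ?posrE ?expR_gt0//; first by rewrite le_max lexx orbT.
by rewrite lt_max expR_gt0 orbT.
Qed.

Lemma loglog_ge1 x : 1 <= loglog x.
Proof. exact: logt_ge1. Qed.

Lemma logtE x : expR 1 <= x -> logt x = ln x.
Proof. by move=> h; rewrite /logt max_l. Qed.

Lemma ln_diff_bounds (s t : R) : 0 < s -> s <= t -> (t - s) / t <= ln t - ln s <= (t - s) / s.
Proof.
move=> s0 st; have t0 : 0 < t by apply: lt_le_trans st.
have h (u : R) : 0 < u -> ln u <= u - 1.
  move=> u0; have := expR_ge1Dx (ln u); rewrite lnK ?posrE//; lra.
have tsE : ln t - ln s = ln (t / s) by rewrite ln_div ?posrE.
have stE : ln t - ln s = - ln (s / t) by rewrite ln_div ?posrE// opprB.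
apply/andP; split.
  rewrite stE lerNr; apply: le_trans (h _ _) _; first by rewrite divr_gt0.
  by rewrite le_eqVlt; apply/orP; left; apply/eqP; field; rewrite gt_eqF.
rewrite tsE; apply: le_trans (h _ _) _; first by rewrite divr_gt0.
by rewrite le_eqVlt; apply/orP; left; apply/eqP; field; rewrite gt_eqF.
Qed.

Definition llog (n : nat) : R := loglog n%:R.
Definition weight (b : R) (n : nat) : R := llog n `^ b / (n%:R * logt n%:R).

Lemma llog_ge1 n : 1 <= llog n. Proof. exact: loglog_ge1. Qed.
Lemma llog_gt0 n : 0 < llog n. Proof. exact: lt_le_trans ltr01 (llog_ge1 n). Qed.

Lemma weight_ge0 b n : 0 <= weight b n.
Proof.
by rewrite /weight divr_ge0 ?powR_ge0// mulr_ge0// (le_trans ler01)// logt_ge1.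
Qed.

(** Division by zero yields zero, so series may start at index [0] although the theorem starts at
    [1]. *)
Lemma weight0 b : weight b 0 = 0.
Proof. by rewrite /weight mul0r invr0 mulr0. Qed.

(** Beyond [e^e] neither truncation in [loglog] is active. *)
Definition large_index : nat := (Num.truncn (expR (expR 1 : R))).+1.

Lemma large_indexP n : (large_index <= n)%N ->
  [/\ 0 < n%:R :> R, 1 < ln (n%:R : R), logt (n%:R : R) = ln n%:R & llog n = ln (ln n%:R)].
Proof.
move=> hn.
have ee : expR (expR 1) <= n%:R :> R.
  by apply/ltW; apply: lt_le_trans (truncnS_gt _) _; rewrite ler_nat.
have e1 : 1 < expR 1 :> R by rewrite expR_gt1.
have n0 : 0 < n%:R :> R by apply: lt_le_trans ee; exact: expR_gt0.
have ln1 : expR 1 <= ln n%:R :> R by rewrite -[leLHS]expRK ler_ln ?posrE ?expR_gt0.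
have lE : logt (n%:R : R) = ln n%:R.
  by apply: logtE; apply: le_trans ee; rewrite ler_expR ltW.
split => //; first exact: lt_le_trans ln1.
by rewrite /llog /loglog lE logtE.
Qed.

Lemma llog_unbounded x : exists N : nat, forall n, (N <= n)%N -> x <= llog n.
Proof.
exists (maxn large_index (Num.truncn (expR (expR x : R))).+1) => n.
rewrite geq_max => /andP[/large_indexP[n0 l1 _ ->] hn].
have ee : expR (expR x) <= n%:R :> R.
  by apply/ltW; apply: lt_le_trans (truncnS_gt _) _; rewrite ler_nat.
rewrite -(expRK x) ler_ln ?posrE ?expR_gt0//; last by apply: lt_trans l1.
by rewrite -[leLHS]expRK ler_ln ?posrE ?expR_gt0.
Qed.

(** Two uses of the bounds on [ln t - ln s]. For the last inequality, passing from [n] to [n.+1]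
    multiplies [n] and [ln n] each by at most [1 + 1 / n <= e^(1/n)]. *)
Lemma llog_step n : (large_index <= n)%N ->
  [/\ llog n <= llog n.+1,
      llog n.+1 - llog n <= n%:R^-1,
      llog n.+1 - llog n <= (n%:R * logt n%:R)^-1 &
      (n%:R * logt n%:R)^-1 * expR (- (2 / n%:R)) <= llog n.+1 - llog n].
Proof.
move=> hn.
have [n0 l1 lE yE] := large_indexP hn.
have [n0' l1' lE' yE'] := large_indexP (leqW hn).
have nn' : n%:R <= n.+1%:R :> R by rewrite ler_nat.
have d1 : n.+1%:R - n%:R = 1 :> R by rewrite -natrB// subSnn.
have /andP[a1 a2] := ln_diff_bounds n0 nn'.
rewrite d1 !div1r in a1 a2.
have lpos : 0 < ln (n%:R : R) by apply: lt_trans l1.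
have lpos' : 0 < ln (n.+1%:R : R) by apply: lt_trans l1'.
have ll : ln (n%:R : R) <= ln n.+1%:R by rewrite ler_ln ?posrE.
have /andP[b1 b2] := ln_diff_bounds lpos ll.
rewrite yE yE' lE.
have inv0 : 0 < (n%:R : R)^-1 by rewrite invr_gt0.
have up : ln (ln n.+1%:R) - ln (ln (n%:R : R)) <= (n%:R * ln n%:R)^-1.
  apply: le_trans b2 _; rewrite invfM ler_pM2r ?invr_gt0//.
split => //.
- by rewrite ler_ln ?posrE.
- apply: le_trans up _; rewrite invfM ler_piMr ?ltW// invf_lt1//.
- apply: le_trans b1.
  apply: (@le_trans _ _ (n.+1%:R * ln n.+1%:R)^-1); last first.
    by rewrite invfM ler_pM2r ?invr_gt0.
  rewrite expRN -invfM lef_pV2 ?posrE ?mulr_gt0 ?expR_gt0//.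
  have e1 := expR_ge1Dx (n%:R^-1 : R).
  have -> : expR (2 / n%:R) = expR n%:R^-1 * expR n%:R^-1 :> R.
    by rewrite -expRD; congr expR; rewrite mulr_natl mulr2n.
  have -> : n%:R * ln n%:R * (expR n%:R^-1 * expR n%:R^-1) = (n%:R * expR n%:R^-1) * (ln n%:R * expR n%:R^-1) :> R.
    by ring.
  apply: ler_pM => //; first exact: ltW.
  + apply: (@le_trans _ _ (n%:R * (1 + n%:R^-1))); last by rewrite ler_pM2l.
    by rewrite mulrDr mulr1 mulfV ?gt_eqF// natr1.
  + apply: (@le_trans _ _ (ln n%:R * (1 + n%:R^-1))); last by rewrite ler_pM2l.
    rewrite mulrDr mulr1.
    have : n%:R^-1 <= ln n%:R * n%:R^-1 :> R by rewrite ler_peMl ?ltW.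
    by lra.
Qed.

Section WeightedSeries.
Variable b : R.
Hypothesis b1 : -1 < b.

(** The relative error on a cell is [e^(c / n)]: [|b| + 1] from the variation of the integrand, [2]
    from the length of the cell. *)
Let c : R := `|b| + 3.

Let bp : 0 < b + 1. Proof. by rewrite -ltrBlDr sub0r. Qed.

Definition expterm T n : R := weight b n * expR (- (llog n / T)).

Lemma expterm_ge0 T n : 0 <= expterm T n.
Proof. by rewrite /expterm mulr_ge0 ?weight_ge0 ?expR_ge0. Qed.

(* [llog n.+1 - llog n] is close to [1 / (n ln n)], so that the scaled terms are those of a Riemann
   sum of [t^b exp (- t)] at the points [llog n / T]. *)
Lemma scaled_expterm_bounds T n : 1 <= T -> (large_index <= n)%N ->
  let I := Gm b `[llog n / T, llog n.+1 / T[%classic in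
  expR (- (c / n%:R)) * I <= T `^ (- (b + 1)) * expterm T n <= expR (c / n%:R) * I.
Proof.
move=> T1 hn /=.
have T0 : 0 < T by apply: lt_le_trans T1.
have [n0 l1 _ _] := large_indexP hn.
have [y1 y2 y3 y4] := llog_step hn.
have yn1 := llog_ge1 n; have yn0 := llog_gt0 n.
set x := llog n / T; set x' := llog n.+1 / T.
have x0 : 0 < x by rewrite divr_gt0.
have xx' : x <= x' by rewrite ler_pM2r ?invr_gt0.
have nl0 : 0 < n%:R * logt n%:R :> R by rewrite mulr_gt0// (lt_le_trans ltr01)// logt_ge1.
set i := n%:R^-1 in y2 *.
have i0 : 0 < i by rewrite invr_gt0.
set B := x `^ b * expR (- x).
have B0 : 0 < B by rewrite mulr_gt0 ?powR_gt0 ?expR_gt0.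
have aE : T `^ (- (b + 1)) * expterm T n = B * (T * (n%:R * logt n%:R))^-1.
  rewrite /expterm /weight /B /x powRM ?invr_ge0 ?ltW//.
  have -> : T^-1 `^ b = T `^ (- b) by rewrite -powR_inv1 ?ltW// -powRrM mulN1r.
  rewrite opprD powRD; last by apply/implyP => _; rewrite gt_eqF.
  by rewrite powR_inv1 ?ltW// [in RHS]invfM; ring.
have h : forall t, x <= t <= x' -> B * expR (- ((`|b| + 1) * i)) <= gammaf b t <= B * expR (`|b| * i).
  move=> t /andP[xt tx']; have t0 : 0 < t by apply: lt_le_trans xt.
  have tx : t - x <= i.
    apply: (@le_trans _ _ (x' - x)); first by rewrite lerD2r.
    rewrite /x /x' -mulrBl ler_pdivrMr//; apply: le_trans y2 _.
    by rewrite ler_peMr// ltW.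
  (* Because [llog n >= 1], the ratio satisfies [t / x <= 1 + 1 / n]; hence [ln s <= 1 / n], and
     [s^b] is within a factor [e^(|b| / n)] of one. *)
  pose s := t / x.
  have s1 : 1 <= s by rewrite ler_pdivlMr// mul1r.
  have sp : 0 < s by apply: lt_le_trans s1.
  have tE : t = x * s by rewrite /s mulrC divfK// gt_eqF.
  have ls0 : 0 <= ln s by rewrite ln_ge0.
  have lsi : ln s <= i.
    rewrite -ler_expR lnK ?posrE//; apply: le_trans (expR_ge1Dx i).
    rewrite /s ler_pdivrMr//; apply: (le_trans tx').
    rewrite /x' /x mulrA ler_pM2r ?invr_gt0// mulrDl mul1r.
    have : i <= i * llog n by rewrite ler_peMr// ltW.
    by lra.
  have sbE : s `^ b = expR (b * ln s) by rewrite /powR gt_eqF.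
  have bls : `|b * ln s| <= `|b| * i by rewrite normrM (ger0_norm ls0) ler_wpM2l.
  move: bls; rewrite ler_norml => /andP[bl1 bl2].
  have gE : gammaf b t = B * (expR (b * ln s) * expR (- (t - x))).
    rewrite /gammaf /B {1}tE powRM ?ltW// sbE.
    have -> : expR (- t) = expR (- x) * expR (- (t - x)) by rewrite -expRD; congr expR; ring.
    by ring.
  rewrite gE -expRD; apply/andP; split; rewrite ler_pM2l// ler_expR.
    by rewrite mulrDl mul1r opprD; lra.
  by lra.
have /andP[lo hi] := Gm_bounds b1 x0 xx' h.
have len1 : x' - x <= (T * (n%:R * logt n%:R))^-1.
  by rewrite /x /x' -mulrBl ler_pdivrMr// invfM mulrC mulrA mulfV ?gt_eqF// mul1r.
have len2 : (T * (n%:R * logt n%:R))^-1 * expR (- (2 * i)) <= x' - x.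
  rewrite /x /x' -mulrBl ler_pdivlMr// invfM.
  have -> : T^-1 * (n%:R * logt n%:R)^-1 * expR (- (2 * i)) * T = (n%:R * logt n%:R)^-1 * expR (- (2 * i)) * (T^-1 * T).
    by ring.
  by rewrite mulVf ?gt_eqF// mulr1.
rewrite aE; set q := (T * _)^-1 in len1 len2 *.
have q0 : 0 < q by rewrite invr_gt0 mulr_gt0.
set I := Gm b _ in lo hi *.
have up : I <= expR (`|b| * i) * (B * q).
  apply: (le_trans hi); rewrite [B * _]mulrC -mulrA ler_pM2l ?expR_gt0//.
  by rewrite ler_pM2l.
have low : expR (- (c * i)) * (B * q) <= I.
  apply: le_trans lo.
  apply: (@le_trans _ _ (B * expR (- ((`|b| + 1) * i)) * (q * expR (- (2 * i))))).
    have -> : expR (- (c * i)) = expR (- ((`|b| + 1) * i)) * expR (- (2 * i)).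
      by rewrite -expRD; congr expR; rewrite /c; ring.
    by rewrite le_eqVlt; apply/orP; left; apply/eqP; ring.
  by rewrite ler_pM2l// mulr_gt0// expR_gt0.
have Bq0 : 0 < B * q by exact: mulr_gt0.
apply/andP; split.
  rewrite expRN ler_pdivrMl ?expR_gt0//; apply: (le_trans up).
  rewrite ler_pM2r// ler_expR ler_pM2r//.
  by rewrite /c; lra.
by rewrite -ler_pdivrMl ?expR_gt0// -expRN.
Qed.

Lemma Gm_telescope T m N : 1 <= T -> (large_index <= m)%N -> (m <= N)%N ->
  \sum_(m <= n < N) Gm b `[llog n / T, llog n.+1 / T[ =
  Gm b `[llog m / T, +oo[ - Gm b `[llog N / T, +oo[.
Proof.
move=> T1 hm mN; have T0 : 0 < T by apply: lt_le_trans T1.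
elim: N mN => [|N IH]; first by rewrite leqn0 => /eqP ->; rewrite big_geq// subrr.
rewrite leq_eqVlt => /predU1P[->|]; first by rewrite big_geq// subrr.
rewrite ltnS => mN; rewrite big_nat_recr//= IH//.
have [y1 _ _ _] := llog_step (leq_trans hm mN).
rewrite (@Gm_split _ _ b1 (llog N / T) (llog N.+1 / T)).
- by ring.
- by rewrite divr_gt0// llog_gt0.
- by rewrite ler_pM2r ?invr_gt0.
Qed.

(** The cells tile [[llog m / T, llog N / T[], and the error factor [e^(c / n)] is worst at
    [n = m]. *)
Lemma expterm_sum_bounds T m N : 1 <= T -> (large_index <= m)%N -> (m <= N)%N ->
  let D := Gm b `[llog m / T, +oo[ - Gm b `[llog N / T, +oo[ in
  expR (- (c / m%:R)) * D <= \sum_(m <= n < N) T `^ (- (b + 1)) * expterm T n <= expR (c / m%:R) * D.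
Proof.
move=> T1 hm mN /=; rewrite -(Gm_telescope T1 hm mN) !mulr_sumr.
have c0 : 0 <= c by rewrite addr_ge0.
have [m0 _ _ _] := large_indexP hm.
have cmp n : (m <= n)%N -> c / n%:R <= c / m%:R.
  by move=> mn; rewrite ler_wpM2l// lef_pV2 ?posrE ?ler_nat// (lt_le_trans m0)// ler_nat.
apply/andP; split; apply: ler_sum_nat => n /andP[mn _];
    have /andP[h1 h2] := scaled_expterm_bounds T1 (leq_trans hm mn).
  apply: le_trans h1; rewrite ler_wpM2r ?Gm_ge0// ler_expR lerN2; exact: cmp.
apply: le_trans h2 _; rewrite ler_wpM2r ?Gm_ge0// ler_expR; exact: cmp.
Qed.

(** The first [m] terms do not resemble a Riemann sum; they are bounded by a constant that the
    normalization sends to [0]. Uniformity in [N] also gives summability. *)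
Lemma expterm_partial T m N : 1 <= T -> (large_index <= m)%N ->
  T `^ (- (b + 1)) * series (expterm T) N <=
    T `^ (- (b + 1)) * (\sum_(0 <= n < m) weight b n) + expR (c / m%:R) * Gamma (b + 1).
Proof.
move=> T1 hm; have T0 : 0 < T by apply: lt_le_trans T1.
apply: (@le_trans _ _ (T `^ (- (b + 1)) * series (expterm T) (maxn m N))).
  rewrite ler_wpM2l ?powR_ge0// /series/= [leRHS](big_cat_nat (n := N)) ?leq_maxr//=.
  by rewrite lerDl sumr_ge0// => n _; exact: expterm_ge0.
rewrite /series/= (big_cat_nat (n := m)) ?leq_maxl//= mulrDr; apply: lerD.
  rewrite ler_wpM2l ?powR_ge0//; apply: ler_sum => n _.
  rewrite /expterm ler_piMr ?weight_ge0// -expR0 ler_expR oppr_le0.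
  by rewrite divr_ge0 ?ltW// llog_gt0.
rewrite mulr_sumr.
have /andP[_ h] := expterm_sum_bounds T1 hm (leq_maxl m N).
apply: (le_trans h); rewrite ler_wpM2l ?expR_ge0// GammaE//.
apply: (@le_trans _ _ (Gm b `[llog m / T, +oo[)); first by rewrite gerBl Gm_ge0.
apply: sub_Gm => //; try exact: measurable_itv.
move=> t; rewrite /= !in_itv/= !andbT; apply: lt_le_trans.
by rewrite divr_gt0// llog_gt0.
Qed.

Lemma expterm_cvg T : 1 <= T -> cvgn (series (expterm T)).
Proof.
move=> T1; have T0 : 0 < T by apply: lt_le_trans T1.
apply: nondecreasing_is_cvgn.
  by apply: nondecreasing_series => n _ _; exact: expterm_ge0.
have p0 : 0 < T `^ (- (b + 1)) by rewrite powR_gt0.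
eexists => _ [N _ <-].
have := expterm_partial N T1 (leqnn large_index).
rewrite -ler_pdivlMl//; exact.
Qed.

Definition expsum T : R := limn (series (expterm T)).

Lemma series_le_expsum T N : 1 <= T -> series (expterm T) N <= expsum T.
Proof.
move=> T1; apply: nondecreasing_cvgn_le; last exact: expterm_cvg.
by apply: nondecreasing_series => n _ _; exact: expterm_ge0.
Qed.

Lemma powR_small (eta K : R) : 0 < eta -> exists2 T0, 1 <= T0 & forall T, T0 <= T -> T `^ (- (b + 1)) * K <= eta.
Proof.
move=> eta0; pose Z := (`|K| + 1) / eta.
have Z0 : 0 < Z by rewrite divr_gt0// ltr_wpDl.
exists (Num.max 1 (Z `^ (b + 1)^-1)); first by rewrite le_max lexx.
move=> T; rewrite ge_max => /andP[T1 ZT].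
have T0 : 0 < T by apply: lt_le_trans T1.
have h : Z <= T `^ (b + 1).
  have zE : Z = (Z `^ (b + 1)^-1) `^ (b + 1).
    by rewrite -powRrM mulVf ?lt0r_neq0// powRr1// ltW.
  rewrite [leLHS]zE.
  by rewrite ge0_ler_powR ?nnegrE ?powR_ge0// ltW.
rewrite powRN mulrC ler_pdivrMr ?powR_gt0//.
apply: (@le_trans _ _ (eta * Z)); last by rewrite ler_pM2l.
by rewrite /Z mulrC divfK ?gt_eqF//; have := ler_norm K; lra.
Qed.

Theorem expsum_limit (eta : R) : 0 < eta -> exists2 T0, 1 <= T0 & forall T, T0 <= T ->
  `|T `^ (- (b + 1)) * expsum T - Gamma (b + 1)| <= eta.
Proof.
move=> eta0; have G0 := Gamma_gt0 b1; set G := Gamma (b + 1) in G0 *.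
(* A relative error [dl] then costs at most a quarter of [eta]. *)
pose dl := eta / (4 * (G + 1)).
have G1 : 0 < 4 * (G + 1) by lra.
have dl0 : 0 < dl by rewrite divr_gt0.
have dlG : dl * (G + 1) = eta / 4 by rewrite /dl; field; rewrite gt_eqF//; lra.
have l0 : 0 < ln (1 + dl) by rewrite ln_gt0// ltrDl.
have c0 : 0 <= c by rewrite addr_ge0.
pose m := maxn large_index (Num.truncn (c / ln (1 + dl))).+1.
have hm : (large_index <= m)%N := leq_maxl _ _.
have [m0 _ _ _] := large_indexP hm.
have d10 : 0 < 1 + dl by lra.
have ecm : expR (c / m%:R) <= 1 + dl.
  rewrite -[leRHS]lnK ?posrE// ler_expR ler_pdivrMr// mulrC -ler_pdivrMr//.
  by apply/ltW; apply: lt_le_trans (truncnS_gt _) _; rewrite ler_nat leq_maxr.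
have ecm' : 1 - dl <= expR (- (c / m%:R)).
  rewrite expRN; apply: (@le_trans _ _ (1 + dl)^-1); last first.
    by rewrite lef_pV2 ?posrE ?expR_gt0.
  rewrite -[leRHS]div1r ler_pdivlMr//.
  by have : 0 <= dl ^+ 2 by [exact: sqr_ge0]; rewrite expr2; lra.
have [A A0 [hA1 hA2]] := Gm_limits b1 (divr_gt0 eta0 (ltr0n R 4)).
have [T1 T11 hT1] := @powR_small (eta / 4) (\sum_(0 <= n < m) weight b n) (divr_gt0 eta0 (ltr0n R 4)).
exists (Num.max T1 (llog m / A)); first by rewrite le_max T11.
move=> T; rewrite ge_max => /andP[T1T AT].
have T_1 : 1 <= T by apply: le_trans T1T.
have T0 : 0 < T by apply: lt_le_trans T_1.
have p0 : 0 < T `^ (- (b + 1)) by rewrite powR_gt0.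
rewrite ler_norml; apply/andP; split.
  (* For [G > eta] the quantity [G - eta / 2] is nonnegative, as its multiplication by [1 - dl]
     requires; otherwise the lower bound is trivial. *)
  have [Ge|Ge] := leP G eta.
    have : 0 <= T `^ (- (b + 1)) * expsum T.
      rewrite mulr_ge0 ?powR_ge0//; apply: le_trans (series_le_expsum 0 T_1).
      by rewrite /series/= big_geq.
    by lra.
  have [N hN] := llog_unbounded (A^-1 * T).
  have mN : (m <= maxn m N)%N := leq_maxl _ _.
  have /andP[h _] := expterm_sum_bounds T_1 hm mN.
  have xm : 0 < llog m / T <= A.
    rewrite divr_gt0 ?llog_gt0//= ler_pdivrMr// mulrC -ler_pdivrMr//.
  have /andP[g1 _] := hA1 _ xm.
  have g2 : Gm b `[llog (maxn m N) / T, +oo[ <= eta / 4.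
    by apply: hA2; rewrite ler_pdivlMr// hN// leq_maxr.
  have key : T `^ (- (b + 1)) * expsum T >= (1 - dl) * (G - eta / 4 - eta / 4).
    have D1 : G - eta / 4 - eta / 4 <= Gm b `[llog m / T, +oo[ - Gm b `[llog (maxn m N) / T, +oo[.
      by rewrite -/G in g1; lra.
    have D0 : 0 <= Gm b `[llog m / T, +oo[ - Gm b `[llog (maxn m N) / T, +oo[.
      by rewrite -(Gm_telescope T_1 hm mN) sumr_ge0// => n _; exact: Gm_ge0.
    apply: (@le_trans _ _ (\sum_(m <= n < maxn m N) T `^ (- (b + 1)) * expterm T n)); last first.
      rewrite -mulr_sumr ler_pM2l//; apply: le_trans (series_le_expsum (maxn m N) T_1).
      rewrite /series/= [leRHS](big_cat_nat (n := m))//= lerDr sumr_ge0// => n _; exact: expterm_ge0.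
    apply: le_trans h.
    apply: (@le_trans _ _ (expR (- (c / m%:R)) * (G - eta / 4 - eta / 4))); last first.
      by rewrite ler_pM2l ?expR_gt0.
    by rewrite ler_wpM2r//; lra.
  have : dl * G <= eta / 4 by rewrite -dlG ler_pM2l// lerDl.
  have : 0 <= dl * eta by rewrite mulr_ge0// ltW.
  by lra.
have : T `^ (- (b + 1)) * expsum T <= eta / 4 + (1 + dl) * G.
  rewrite -ler_pdivlMl//; apply: limr_le; first exact: expterm_cvg.
  near=> N; rewrite ler_pdivlMl//.
  apply: le_trans (expterm_partial N T_1 hm) _; apply: lerD; first exact: hT1.
  by rewrite ler_pM2r.
have : dl * G <= eta / 4 by rewrite -dlG ler_pM2l// lerDl.
by lra.
Unshelve. all: by end_near. Qed.

End WeightedSeries.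
End IteratedLogarithm.

(** * Normalized series of exponentials and the constant *)

Section ExponentialCombinations.
Context {R : realType}.
Variable b : R.
Hypothesis b1 : -1 < b.
Local Notation G := (Gamma (b + 1)).
Local Notation w := (weight b).

(* The normalized series of the theorem, with the probabilities replaced by [f]. *)
Definition nsum (eps : R) (f : nat -> R) : R :=
  (eps ^+ 2) `^ (- (b + 1)) * limn (series (fun n => w n * f n)).

Definition summable_w (f : nat -> R) := cvgn (series (fun n => w n * f n)).

Lemma summable_wD f g : summable_w f -> summable_w g -> summable_w (fun n => f n + g n).
Proof.
move=> sf sg; have := is_cvg_seriesD sf sg.
by congr (cvgn (series _)); apply/funext => n; rewrite mulrDr.
Qed.

Lemma summable_wZ (c : R) f : summable_w f -> summable_w (fun n => c * f n).
Proof.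
move=> sf; have := is_cvg_seriesZ (k := c) sf.
by congr (cvgn (series _)); apply/funext => n; rewrite mulrCA.
Qed.

Lemma nsumD eps f g : summable_w f -> summable_w g ->
  nsum eps (fun n => f n + g n) = nsum eps f + nsum eps g.
Proof.
move=> sf sg; have h := lim_seriesD sf sg.
rewrite /nsum -mulrDr; congr (_ * _); rewrite -[RHS]h; congr (limn (series _)).
by apply/funext => n; rewrite mulrDr.
Qed.

Lemma nsumZ eps (c : R) f : summable_w f -> nsum eps (fun n => c * f n) = c * nsum eps f.
Proof.
move=> sf; have h := lim_seriesZ c sf.
rewrite /nsum mulrCA; congr (_ * _); rewrite -[RHS]h; congr (limn (series _)).
by apply/funext => n; rewrite mulrCA.
Qed.

Lemma summable_w_le (f g : nat -> R) : (forall n, (0 < n)%N -> 0 <= f n <= g n) ->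
  summable_w g -> summable_w f.
Proof.
move=> fg; apply: series_le_cvg.
- move=> [|n]; first by rewrite weight0 mul0r.
  by have /andP[f0 _] := fg n.+1 isT; rewrite mulr_ge0// weight_ge0.
- move=> [|n]; first by rewrite weight0 mul0r.
  by have /andP[f0 /(le_trans f0) g0] := fg n.+1 isT; rewrite mulr_ge0// weight_ge0.
- move=> [|n]; first by rewrite weight0 !mul0r.
  by have /andP[_ h] := fg n.+1 isT; rewrite ler_wpM2l// weight_ge0.
Qed.

Lemma nsum_le eps (f g : nat -> R) : summable_w f -> summable_w g ->
  (forall n, (0 < n)%N -> f n <= g n) -> nsum eps f <= nsum eps g.
Proof.
move=> sf sg fg; rewrite /nsum ler_wpM2l ?powR_ge0//; apply: lim_series_le => //.
by move=> [|n]; [rewrite weight0 !mul0r|rewrite ler_wpM2l ?weight_ge0// fg].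
Qed.

Lemma nsum_dist eps (f g r : nat -> R) : summable_w f -> summable_w g -> summable_w r ->
  (forall n, (0 < n)%N -> `|f n - g n| <= r n) -> `|nsum eps f - nsum eps g| <= nsum eps r.
Proof.
move=> sf sg sr fgr.
have h1 : nsum eps f <= nsum eps g + nsum eps r.
  rewrite -nsumD//; apply: nsum_le => //; first exact: summable_wD.
  by move=> n n0; have := fgr n n0; rewrite ler_norml => /andP[_]; rewrite lerBlDl.
have h2 : nsum eps g <= nsum eps f + nsum eps r.
  rewrite -nsumD//; apply: nsum_le => //; first exact: summable_wD.
  by move=> n n0; have := fgr n n0; rewrite distrC ler_norml => /andP[_]; rewrite lerBlDl.
by rewrite ler_norml; apply/andP; split; lra.
Qed.

Lemma sqr_unbounded (A : R) : exists2 E0 : R, 0 < E0 & forall eps, E0 <= eps -> A <= eps ^+ 2.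
Proof.
exists (`|A| + 1); first by rewrite ltr_wpDl.
move=> eps h; apply: (le_trans (ler_norm A)).
have e1 : 1 <= eps by apply: le_trans h; rewrite lerDr.
apply: (@le_trans _ _ eps); first by apply: le_trans h; rewrite lerDl.
by rewrite expr2 ler_peMr// (le_trans ler01).
Qed.

(** The rate is absorbed in [T = eps^2 / lam], which leaves the factor [lam^(-(b+1))] in the
    normalization. *)
Lemma nsum_exp_limit (lam eta : R) : 0 < lam -> 0 < eta -> exists2 E0, 0 < E0 & forall eps, E0 <= eps ->
  summable_w (fun n => expR (- (lam * (llog n / eps ^+ 2)))) /\
  `|nsum eps (fun n => expR (- (lam * (llog n / eps ^+ 2)))) - lam `^ (- (b + 1)) * G| <= eta.
Proof.
move=> lam0 eta0.
have lp : 0 < lam `^ (- (b + 1)) by rewrite powR_gt0.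
have [T0 T01 hT] := expsum_limit b1 (divr_gt0 eta0 lp).
have [E0 E00 hE] := sqr_unbounded (lam * T0).
exists E0 => // eps /hE heps.
have T0p : 0 < T0 by apply: lt_le_trans T01.
have eps20 : 0 < eps ^+ 2 by apply: lt_le_trans heps; rewrite mulr_gt0.
pose TT := eps ^+ 2 / lam.
have TT0 : T0 <= TT by rewrite ler_pdivlMr// mulrC.
have TT1 : 1 <= TT by apply: le_trans TT0.
have eE : (fun n => w n * expR (- (lam * (llog n / eps ^+ 2)))) = expterm b TT.
  apply/funext => n; rewrite /expterm; congr (_ * expR (- _)).
  by rewrite /TT invf_div mulrCA.
split; first by rewrite /summable_w eE; exact: expterm_cvg.
have := hT _ TT0; rewrite /nsum eE -/(expsum b TT) => h.
have -> : (eps ^+ 2) `^ (- (b + 1)) = lam `^ (- (b + 1)) * TT `^ (- (b + 1)).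
  by rewrite -powRM ?ltW// /TT ?divr_gt0//; congr (_ `^ _); field; rewrite gt_eqF.
rewrite -mulrA -mulrBr normrM (ger0_norm (ltW lp)).
by rewrite mulrC -ler_pdivlMr.
Qed.

Lemma nsum_expcomb_limit (c lam : nat -> R) m (eta : R) : (forall k, 0 < lam k) -> 0 < eta ->
  exists2 E0, 0 < E0 & forall eps, E0 <= eps ->
  summable_w (fun n => \sum_(k < m) c k * expR (- (lam k * (llog n / eps ^+ 2)))) /\
  `|nsum eps (fun n => \sum_(k < m) c k * expR (- (lam k * (llog n / eps ^+ 2))))
    - G * \sum_(k < m) c k * lam k `^ (- (b + 1))| <= eta.
Proof.
move=> lam0; elim: m eta => [|m IH] eta eta0.
  have [E0 E00 hE] := nsum_exp_limit (lam0 0%N) ltr01.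
  exists E0 => // eps /hE [s _].
  have e : (fun n => \sum_(k < 0) c k * expR (- (lam k * (llog n / eps ^+ 2)))) =
     (fun n => 0 * expR (- (lam 0%N * (llog n / eps ^+ 2)))).
    by apply/funext => n; rewrite big_ord0 mul0r.
  rewrite e; split; first exact: summable_wZ.
  by rewrite nsumZ// mul0r big_ord0 mulr0 subrr normr0 ltW.
have c1 : 0 < `|c m| + 1 by rewrite ltr_wpDl.
have [E1 E10 hE1] := IH _ (divr_gt0 eta0 (ltr0n R 2)).
have [E2 E20 hE2] := nsum_exp_limit (lam0 m) (divr_gt0 (divr_gt0 eta0 (ltr0n R 2)) c1).
exists (Num.max E1 E2); first by rewrite lt_max E10.
move=> eps; rewrite ge_max => /andP[/hE1 [s1 h1] /hE2 [s2 h2]].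
under eq_fun do rewrite big_ord_recr/=.
split; first by apply: summable_wD => //; exact: summable_wZ.
rewrite nsumD//; last exact: summable_wZ.
rewrite nsumZ// big_ord_recr/= mulrDr opprD addrACA; apply: le_trans (ler_normD _ _) _.
rewrite [leRHS](splitr eta); apply: lerD => //.
move: h2; set A := nsum _ _; set B := _ `^ _; move=> h2.
rewrite (_ : c m * A - G * (c m * B) = c m * (A - B * G)); last by ring.
rewrite normrM; apply: (@le_trans _ _ ((`|c m| + 1) * (eta / 2 / (`|c m| + 1)))).
  by apply: ler_pM => //; rewrite lerDl.
by rewrite mulrC divfK// gt_eqF.
Qed.

(* The partial sums of the alternating series in [chung_constant], in the shape produced by
   [nsum_expcomb_limit]. *)
Definition chung_partial M : R :=
  \sum_(k < M) (4 / pi * ((-1) ^+ k * 1 ^+ (2 * k + 1) / (2 * k + 1)%:R)) * ((2 * k + 1)%:R ^+ 2) `^ (- (b + 1)).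

Let a (k : nat) : R := ((2 * k + 1)%:R `^ (2 * b + 3))^-1.

Let a_gt0 k : 0 < a k.
Proof. by rewrite invr_gt0 powR_gt0// ltr0n addn1. Qed.

Let s_gt1 : 1 < 2 * b + 3. Proof. by move: b1 => b_gt; lra. Qed.

Let a_decr k : a k.+1 <= a k.
Proof.
rewrite lef_pV2 ?posrE ?powR_gt0 ?ltr0n ?addn1//.
rewrite ge0_ler_powR ?nnegrE//; first by rewrite ltW// (lt_trans ltr01).
by rewrite ler_nat ltnS leq_mul2l leqnSn.
Qed.

Let a_cvg0 (eta : R) : 0 < eta -> exists N : nat, forall n, (N <= n)%N -> a n <= eta.
Proof.
move=> eta0; exists (Num.truncn eta^-1).+1 => n hn.
have n0 : 0 < (2 * n + 1)%:R :> R by rewrite ltr0n addn1.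
rewrite /a invf_ple ?posrE ?powR_gt0//.
apply: (@le_trans _ _ (2 * n + 1)%:R).
  apply/ltW; apply: lt_le_trans (truncnS_gt _) _; rewrite ler_nat (leq_trans hn)//.
  by rewrite mul2n -addnn -addnA leq_addr.
by rewrite -[leLHS](powRr1 (ltW n0)) ler_powR ?ler1n ?addn1// ltW.
Qed.

(** The exponents add up: [1 / (2k+1)] from the Fourier coefficient and [(2k+1)^(-2(b+1))] from the
    rate make [2 b + 3]. *)
Lemma chung_partialE M : chung_partial M = 4 / pi * \sum_(k < M) (-1) ^+ k * a k.
Proof.
rewrite /chung_partial mulr_sumr; apply: eq_bigr => k _; rewrite -mulrA expr1n mulr1; congr (_ * _).
rewrite -!mulrA; congr (_ * _); rewrite /a.
have c0 : 0 < (2 * k + 1)%:R :> R by rewrite ltr0n addn1.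
rewrite -powR_mulrn ?ltW// -powRrM -[X in X * _](powR_inv1 (ltW c0)) -powRD; last first.
  by apply/implyP => _; rewrite gt_eqF.
by rewrite -powRN; congr (_ `^ _); ring.
Qed.

(** Leibniz: from [M] on, the partial sums differ from [S M] by at most [a M], so from the first on
    they are at least [a 0 - a 1 > 0]. Positivity lets the converse exclude a zero limit and cancel
    the constant. *)
Lemma chung_partial_cvg : G * chung_partial M @[M --> \oo] --> chung_constant b /\ 0 < chung_constant b.
Proof.
pose S M := \sum_(k < M) (-1) ^+ k * a k.
have dist M N : (M <= N)%N -> `|S N - S M| <= a M.
  move=> /subnKC <-; rewrite /S big_split_ord/= addrAC subrr add0r.
  have -> : \sum_(i < N - M) (-1) ^+ (M + i) * a (M + i)%N = (-1) ^+ M * \sum_(i < N - M) (-1) ^+ i * a (M + i)%N.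
    by rewrite mulr_sumr; apply: eq_bigr => i _; rewrite exprD mulrA.
  rewrite normrM normrX normrN1 expr1n mul1r.
  have /andP[h1 h2] := alternating_sum_bounds (N - M) (fun i => ltW (a_gt0 (M + i))) (fun i => eq_ind_r (fun z => a z <= a (M + i)%N) (a_decr (M + i)) (addnS M i)).
  by rewrite ger0_norm// addn0 in h2 *.
have cS : cvgn S.
  apply: cauchy_cvg; apply: cauchy_exP => eta eta0.
  have [N hN] := a_cvg0 (divr_gt0 eta0 (ltr0n R 2)).
  exists (S N), N => // m /= Nm.
  rewrite /ball/= distrC; apply: le_lt_trans (dist _ _ Nm) _.
  by apply: le_lt_trans (hN _ (leqnn N)) _; lra.
have SE : S = series (fun k => (-1) ^+ k / (2 * k + 1)%:R `^ (2 * b + 3)).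
  by apply/funext => M; rewrite /series/= /S big_mkord.
have limS : chung_constant b = 4 / pi * G * limn S by rewrite /chung_constant SE.
split.
  under eq_fun do rewrite chung_partialE mulrA [G * _]mulrC.
  by rewrite limS; apply: cvgMr; exact: cS.
have G0 := Gamma_gt0 b1.
rewrite limS mulr_gt0//; first by rewrite mulr_gt0// divr_gt0// pi_gt0.
have a1 : a 1%N < a 0%N.
  rewrite /a ltf_pV2 ?posrE ?powR_gt0 ?ltr0n// muln0 add0n muln1 powR1.
  rewrite -[ltLHS](powRr0 3%:R).
  by rewrite /powR gt_eqF// ltr_expR ltr_pM2r ?(lt_trans _ s_gt1)// ln_gt0// ltr1n.
apply: (@lt_le_trans _ _ (a 0%N - a 1%N)); first by rewrite subr_gt0.
apply: limr_ge => //; near=> M.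
have M1 : (1 <= M)%N by near: M; exists 1%N.
have := dist _ _ M1; rewrite ler_norml => /andP[h _].
have -> : a 0%N = S 1%N by rewrite /S big_ord1 expr0 mul1r.
by lra.
Unshelve. all: by end_near. Qed.

End ExponentialCombinations.

(** * Modulus of the characteristic function; nonzero mean; zero variance *)

Section CharacteristicModulus.
Context {d : measure_display} {T : measurableType d} {R : realType}.
Variables (P : probability T R) (X : nat -> {RV P >-> R}).
Hypothesis iidX : iid X.
Local Notation E := (Ex P).
Local Notation X0 := (X 0%N).
Local Notation S := (partial_sum X).
Local Notation psurv := (psurv X).
Local Notation chr2 t := (chr_cos X t ^+ 2 + chr_sin X t ^+ 2).

(** Near [0] the cosine part lies in [[0, 1]], so its square is at most itself, hence at most
    [1 - t^2 v / 2 + t^2 v / 16], while the squared sine part is at most [t^2 v / 16]. This leaves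
    room for [v / 4]. *)
Lemma chr2_finite_variance : P.-integrable setT (EFin \o (fun w => X0 w ^+ 2)) ->
  E X0 = 0 -> 0 < var0 X ->
  exists2 t0, 0 < t0 & forall t, 0 < t <= t0 -> chr2 t <= 1 - var0 X / 4 * t ^+ 2.
Proof.
move=> X2int EX0; set v := var0 X => v0.
have [t0 t00 ht0] := tail2_cvg0 X2int (divr_gt0 v0 (ltr0n R 16)).
exists (Num.min t0 (Num.min 1 v^-1)); first by rewrite !lt_min t00 ltr01 invr_gt0.
move=> t /andP[tp]; rewrite !le_min => /and3P[tt0 t1 tv].
have Lam := ht0 t; rewrite (ltW tp) tt0 in Lam; have {}Lam := Lam isT.
have L0 := tail2_ge0 X t.
have := chr_cos_approx X2int (ltW tp); rewrite -/v ler_norml => /andP[c1 c2].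
have s1 := chr_sin_approx X2int (ltW tp) EX0.
have c3 := norm_chr_cos X t; move: c3; rewrite ler_norml => /andP[_ c3].
set L := tail2 X t in Lam L0 c1 c2 s1 *.
set t2 := t ^+ 2 in c1 c2 s1 *.
have t20 : 0 < t2 by rewrite exprn_gt0.
have t2t : t2 <= t by rewrite /t2 expr2 ler_piMr// ltW.
have t21 : t2 <= 1 by apply: le_trans t1.
have t2v : t2 * v <= 1 by rewrite -ler_pdivlMr// div1r; apply: le_trans tv.
have t2L : t2 * L <= t2 * v / 16 by rewrite -mulrA ler_pM2l.
have cpos : 0 <= chr_cos X t by lra.
have cc : chr_cos X t ^+ 2 <= chr_cos X t by rewrite expr2 ler_piMr.
have ss : chr_sin X t ^+ 2 <= (2 * (t2 * L)) ^+ 2.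
  by rewrite -[leLHS]real_normK ?num_real// lerXn2r// nnegrE// (le_trans _ s1).
have ss2 : (2 * (t2 * L)) ^+ 2 <= t2 * v / 16.
  have x0 : 0 <= t2 * L by rewrite mulr_ge0// ltW.
  apply: (@le_trans _ _ (4 * (t2 * L) * (t2 * v / 16))).
    rewrite (_ : (2 * (t2 * L)) ^+ 2 = 4 * (t2 * L) * (t2 * L)); last by ring.
    by apply: ler_wpM2l => //; exact: mulr_ge0.
  rewrite ler_piMl//; last by lra.
  by rewrite !mulr_ge0// ltW.
rewrite (_ : v / 4 * t2 = t2 * v / 4); last by ring.
by lra.
Qed.

Lemma Ex_sqr_sub (f : T -> R) (c : R) : bddmeas f -> E (fun w => (f w - c) ^+ 2) = E (fun w => f w ^+ 2) - 2 * c * E f + c ^+ 2.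
Proof.
move=> bf; have bff : bddmeas (fun w => f w ^+ 2) by apply: bddmeasM.
rewrite -[X in _ + X](Ex_cst P) -ExZ// -ExB//; last exact: bddmeasZ.
rewrite -ExD; [|by apply: bddmeasB => //; exact: bddmeasZ|exact: bddmeas_cst].
by apply: eq_Ex => w; ring.
Qed.

Let F (n : nat) : set T := [set w | `|X0 w| <= n%:R].

Let mF n : measurable (F n).
Proof.
have mX : measurable_fun setT (fun w => `|X0 w|) by exact: measurableT_comp.
have := mX measurableT _ (measurable_itv `]-oo, n%:R]); rewrite setTI.
by congr (measurable _); rewrite predeqE => w /=; rewrite in_itv.
Qed.

Let F_nd : nondecreasing_seq F.
Proof.
move=> m n mn; rewrite subsetEset => w; rewrite /F/= => /le_trans; apply.
by rewrite ler_nat.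
Qed.

Let F_cover : \bigcup_n F n = setT.
Proof.
rewrite -subTset => w _; exists (Num.truncn `|X0 w|).+1 => //; rewrite /F/=.
by rewrite ltW// truncnS_gt.
Qed.

(* [1 - chr2 t] is the sum of the variances of [cos (t X)] and [sin (t X)]. If the latter were at most
   [kappa t^2] for arbitrarily small [t], then [sin (t X) / t] would be bounded in mean square around a
   bounded center, and [X] would be square integrable. *)
Lemma chr2_infinite_variance : ~ P.-integrable setT (EFin \o (fun w => X0 w ^+ 2)) ->
  forall kappa, 0 < kappa -> exists2 t0, 0 < t0 & forall t, 0 < t <= t0 -> chr2 t <= 1 - kappa * t ^+ 2.
Proof.
move=> ninf kappa k0; apply: contrapT => neg; apply: ninf.
have far t0 : 0 < t0 -> exists2 t, 0 < t <= t0 & 1 - kappa * t ^+ 2 < chr2 t.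
  move=> t00; apply: contrapT => h; apply: neg; exists t0 => // t ht.
  by rewrite leNgt; apply/negP => hh; apply: h; exists t.
(* A level below which [|X|] lies with probability at least one half; it locates the mean [be] of
   [sin (t X)] on the scale [t]. *)
have [A hA] : exists A : nat, 1 / 2 <= fine (P (F A)).
  have := nondecreasing_cvg_mu mF (bigcup_measurable (fun n _ => mF n)) F_nd (mu := P).
  rewrite F_cover => cv.
  have : fine (P (F n)) @[n --> \oo] --> (1 : R).
    apply: fine_cvg; have -> : (1 : R)%:E = P setT by exact/esym/probability_setT.
    exact: cv.
  move=> /cvgrPdist_le /(_ (1 / 2)) []; first by rewrite divr_gt0.
  move=> N _ /(_ N (leqnn N)); rewrite /= ler_norml => /andP[_ h].
  by exists N; lra.
(* If [|be| > t A], half of the mass of [sin (t X)] is at distance at least [|be| - t A] from [be],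
   so [(|be| - t A)^2 / 2 <= kappa t^2]; hence [|be| <= t B]. *)
pose B := A%:R + Num.sqrt (2 * kappa) : R.
have B0 : 0 <= B by rewrite addr_ge0// sqrtr_ge0.
(* The [4] comes from [|sin x| >= |x| / 2] for [|x| <= 1]; [kappa] bounds the variance and [B^2] the
   squared mean of [sin (t X)], both divided by [t^2]. *)
pose K := 4 * (kappa + B ^+ 2).
have bound n : (\int[P]_(w in F n) (X0 w ^+ 2)%:E <= K%:E)%E.
  pose m := (maxn n A).+1.
  have m0 : 0 < m%:R :> R by rewrite ltr0n.
  have [|t /andP[t0 tm] ht] := far m%:R^-1; first by rewrite invr_gt0.
  have tm1 : t * m%:R <= 1 by rewrite -ler_pdivlMr// div1r.
  pose f w := sin (t * X0 w); pose g w := cos (t * X0 w).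
  have bf : bddmeas f by apply/bddmeas_sin/measurable_X0Z.
  have bg : bddmeas g by apply/bddmeas_cos/measurable_X0Z.
  have bff : bddmeas (fun w => f w ^+ 2) by apply: bddmeasM.
  have bgg : bddmeas (fun w => g w ^+ 2) by apply: bddmeasM.
  set be := chr_sin X t in ht; set rh := chr_cos X t in ht.
  have e1 : E (fun w => f w ^+ 2) + E (fun w => g w ^+ 2) = 1.
    rewrite -ExD// -[RHS](Ex_cst P); apply: eq_Ex => w.
    by rewrite addrC cos2Dsin2.
  have e2 := Ex_sqr_sub be bf; have e3 := Ex_sqr_sub rh bg.
  rewrite -/(chr_sin X t) -/be in e2; rewrite -/(chr_cos X t) -/rh in e3.
  have e30 : 0 <= E (fun w => (g w - rh) ^+ 2) by apply: Ex_ge0 => w; exact: sqr_ge0.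
  have vf : E (fun w => (f w - be) ^+ 2) <= kappa * t ^+ 2.
    by move: ht e2 e3 e30 e1; rewrite !expr2; lra.
  have bfs : bddmeas (fun w => (f w - be) ^+ 2).
    by apply: bddmeasM; apply: bddmeasB => //; exact: bddmeas_cst.
  have beB : `|be| <= t * B.
    have [ba|ab] := leP `|be| (t * A%:R).
      by apply: (le_trans ba); rewrite ler_pM2l// lerDl sqrtr_ge0.
    have h1 : (`|be| - t * A%:R) ^+ 2 * (1 / 2) <= kappa * t ^+ 2.
      apply: le_trans vf.
      apply: (@le_trans _ _ ((`|be| - t * A%:R) ^+ 2 * E \1_(F A))).
        by rewrite ler_wpM2l ?sqr_ge0// Ex_indic.
      rewrite -ExZ; last exact: bddmeas_indic.
      apply: le_Ex => //; first by apply/bddmeasZ/bddmeas_indic.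
      move=> w; rewrite indicE; case: (boolP (w \in F A)) => /= [|_]; last by rewrite mulr0 sqr_ge0.
      rewrite inE /F/= => XA; rewrite mulr1.
      rewrite -[leRHS]real_normK ?num_real// lerXn2r ?nnegrE ?subr_ge0 ?(ltW ab)//.
      have fA : `|f w| <= t * A%:R.
        by apply: le_trans (norm_sin_le _) _; rewrite normrM (gtr0_norm t0) ler_pM2l.
      rewrite distrC; apply: le_trans (lerB_dist _ _).
      by rewrite lerD2l lerN2.
    have h2 : `|be| - t * A%:R <= t * Num.sqrt (2 * kappa).
      rewrite -(@ler_pXn2r _ 2) ?nnegrE ?subr_ge0 ?(ltW ab)//; last by rewrite mulr_ge0 ?sqrtr_ge0// ltW.
      rewrite exprMn sqr_sqrtr; last by rewrite mulr_ge0// ltW.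
      by move: h1; set z := _ ^+ 2; set y := t ^+ 2; lra.
    by rewrite /B mulrDr; lra.
  have be2 : be ^+ 2 <= t ^+ 2 * B ^+ 2.
    by rewrite -exprMn -[leLHS]real_normK ?num_real// lerXn2r// nnegrE mulr_ge0// ltW.
  have Ef2 : E (fun w => f w ^+ 2) <= t ^+ 2 * (kappa + B ^+ 2).
    by move: vf be2; rewrite e2 mulrDr !expr2; lra.
  have t20 : 0 < t ^+ 2 by rewrite exprn_gt0.
  have iff : P.-integrable setT (EFin \o (fun w => 4 / t ^+ 2 * f w ^+ 2)).
    by apply: bddmeas_integrable; exact: bddmeasZ.
  apply: (@le_trans _ _ (\int[P]_w (4 / t ^+ 2 * f w ^+ 2)%:E)%E); last first.
    rewrite -[leLHS]fineK; last exact: integrable_fin_num iff.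
    rewrite lee_fin -/(Rintegral P setT _) -/(Ex P _) ExZ//.
    by rewrite mulrAC ler_pdivrMr// /K; move: Ef2; set z := t ^+ 2; set y := B ^+ 2; lra.
  rewrite integral_mkcond; apply: ge0_le_integral => //.
  - by move=> w _; rewrite patchE; case: ifP => // _; rewrite lee_fin sqr_ge0.
  - apply/measurable_restrict => //; apply: measurable_funTS; apply: measurableT_comp => //.
    exact: measurable_funX.
  - by move/integrableP : iff => [].
  - move=> w _; rewrite patchE; case: ifPn => [|_]; last first.
      by rewrite lee_fin mulr_ge0 ?sqr_ge0// divr_ge0// ltW.
    rewrite inE /F/= => Xn; rewrite lee_fin.
    have tx1 : `|t * X0 w| <= 1.
      rewrite normrM (gtr0_norm t0); apply: le_trans tm1; rewrite ler_pM2l//.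
      by apply: (le_trans Xn); rewrite ler_nat (leq_trans (leq_maxl n A)).
    have h3 := norm_sin_sub_cube (t * X0 w).
    have h4 : `|t * X0 w| / 2 <= `|f w|.
      have a0 := normr_ge0 (t * X0 w).
      have : `|t * X0 w| ^+ 3 <= `|t * X0 w|.
        by rewrite -[leRHS]expr1 ler_wiXn2l.
      have := lerB_dist (t * X0 w) (f w); rewrite distrC -/(f w).
      by move: h3; rewrite -/(f w); lra.
    rewrite mulrAC ler_pdivlMr// -exprMn mulrC.
    have : (`|t * X0 w| / 2) ^+ 2 <= `|f w| ^+ 2 by rewrite lerXn2r// nnegrE divr_ge0.
    rewrite exprMn !real_normK ?num_real// exprVn.
    by rewrite (_ : 2 ^+ 2 = 4 :> R) ?[t * _]mulrC; [lra|ring].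
apply/integrableP; split.
  by apply: measurableT_comp => //; exact: measurable_funX.
rewrite (_ : (\int[P]_x _ = \int[P]_x (X0 x ^+ 2)%:E)%E); last first.
  by apply: eq_integral => w _; rewrite /= ger0_norm ?sqr_ge0.
apply: (@le_lt_trans _ _ K%:E); last by rewrite ltry.
have hlim : ((fun n => \int[P]_(x in F n) (X0 x ^+ 2)%:E) @ \oo --> \int[P]_x (X0 x ^+ 2)%:E)%E.
  rewrite -F_cover; apply: ge0_nondecreasing_set_cvg_integral => //.
  - move=> n; apply: measurable_funTS; apply: measurableT_comp => //.
    exact: measurable_funX.
  - by move=> n w _; rewrite lee_fin sqr_ge0.
rewrite -(cvg_lim _ hlim)//; apply: lime_le; first by apply/cvg_ex; eexists; exact: hlim.
exact: nearW.
Qed.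

Section Chebyshev.
Hypothesis X2int : P.-integrable setT (EFin \o (fun w => X0 w ^+ 2)).
Let mu := E X0.

(** The cross terms vanish because the centered step is independent of the past. *)
Lemma centered_square_Ex n :
  P.-integrable setT (EFin \o (fun w => (S n w - n%:R * mu) ^+ 2)) /\
  E (fun w => (S n w - n%:R * mu) ^+ 2) = n%:R * E (fun w => (X0 w - mu) ^+ 2).
Proof.
pose g (x : R) := x - mu; pose g2 (x : R) := (x - mu) ^+ 2.
have mg : measurable_fun setT g by exact: measurable_funB.
have mg2 : measurable_fun setT g2 by exact: measurable_funX.
have X1int := X0_integrable X2int.
have ig0 : P.-integrable setT (EFin \o (g \o X0)).
  by apply: integrable_sub => //; exact: bddmeas_integrable (bddmeas_cst mu).
have ig20 : P.-integrable setT (EFin \o (g2 \o X0)).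
  have := integrable_add (integrable_sub X2int (integrable_Zl (2 * mu) X1int))
    (bddmeas_integrable P (bddmeas_cst (mu ^+ 2))).
  by congr (_.-integrable _ (EFin \o _)); apply/funext => w; rewrite /g2/=; ring.
have Eg0 : E (g \o X0) = 0.
  rewrite /Ex/= RintegralB//; last exact: bddmeas_integrable (bddmeas_cst mu).
  by rewrite -!/(Ex P _) Ex_cst subrr.
have [ind _] := iidX.
pose V k w := S k w - k%:R * mu.
have VS k : V k.+1 = fun w => V k w + g (X k.+1 w).
  by apply/funext => w; rewrite /V partial_sumS -natr1 /g; ring.
have Vint m : P.-integrable setT (EFin \o V m).
  elim: m => [|m IH].
    rewrite (_ : V 0 = fun=> 0); first exact: bddmeas_integrable (bddmeas_cst 0).
    by apply/funext => w; rewrite /V partial_sum0 mul0r subrr.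
  by rewrite VS; apply: integrable_add => //; exact: (integrable_X iidX _ mg ig0).
suff H m : P.-integrable setT (EFin \o (fun w => V m w ^+ 2)) /\
    E (fun w => V m w ^+ 2) = m%:R * E (fun w => (X0 w - mu) ^+ 2) by exact: H.
elim: m => [|m [IH1 IH2]].
  have -> : (fun w => V 0 w ^+ 2) = fun=> 0.
    by apply/funext => w; rewrite /V partial_sum0 mul0r subrr expr0n.
  by rewrite Ex_cst mul0r; split => //; exact: bddmeas_integrable (bddmeas_cst 0).
have aV : adapted X m (V m).
  by apply: measurable_funB => //; exact: adapted_partial_sum.
have [i1 e1] := adapted_Rintegral ind aV mg (Vint m) (integrable_X iidX m.+1 mg ig0).
have i2 := integrable_X iidX m.+1 mg2 ig20.
have i12 : P.-integrable setT (EFin \o (fun w => 2 * (V m w * g (X m.+1 w)) + g2 (X m.+1 w))).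
  by apply: integrable_add => //; exact: integrable_Zl.
have E2 : (fun w => V m.+1 w ^+ 2) = fun w => V m w ^+ 2 + (2 * (V m w * g (X m.+1 w)) + g2 (X m.+1 w)).
  by apply/funext => w; rewrite VS /g2 /g; ring.
split; first by rewrite E2; apply: integrable_add.
rewrite E2 /Ex RintegralD// -/(Ex P _) IH2 RintegralD//; last exact: integrable_Zl.
rewrite RintegralZl// e1 (_ : \int[P]_w g (X m.+1 w) = 0); last first.
  by rewrite -Eg0; exact: (Ex_X iidX m.+1 mg ig0).
rewrite mulr0 mulr0 add0r (_ : \int[P]_w g2 (X m.+1 w) = E (g2 \o X0)); last first.
  exact: (Ex_X iidX m.+1 mg2 ig20).
by rewrite -natr1 mulrDl mul1r.
Qed.

(** Survival forces [|S n| <= h <= n |mu| / 2], hence a deviation of at least [n |mu| / 2] from the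
    mean, while the variance is linear in [n]. *)
Lemma psurv_chebyshev : mu != 0 -> exists2 C, 0 <= C & forall n h, (0 < n)%N ->
  2 * h <= n%:R * `|mu| -> psurv n h <= C / n%:R.
Proof.
move=> mu0; have m0 : 0 < `|mu| by rewrite normr_gt0.
pose v := E (fun w => (X0 w - mu) ^+ 2).
have v0 : 0 <= v by apply: Ex_ge0 => w; exact: sqr_ge0.
exists (4 * v / mu ^+ 2).
  by apply: divr_ge0; [exact: mulr_ge0|exact: sqr_ge0].
move=> n h n0 hn; have [i e] := centered_square_Ex n.
have np : 0 < n%:R :> R by rewrite ltr0n.
have mu2 : 0 < mu ^+ 2 by rewrite exprn_even_gt0.
pose k := 4 / (n%:R ^+ 2 * mu ^+ 2).
have n2m : 0 < n%:R ^+ 2 * mu ^+ 2 by rewrite mulr_gt0// exprn_gt0.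
have k0 : 0 < k by rewrite divr_gt0.
rewrite psurvE; apply: (@le_trans _ _ (E (fun w => k * (S n w - n%:R * mu) ^+ 2))).
  apply: le_Rintegral => //.
  - by apply: bddmeas_integrable; exact: bddmeas_survive.
  - exact: integrable_Zl.
  - move=> w _; rewrite indicE; case: (boolP (w \in _)) => /= [|_]; last first.
      by rewrite mulr_ge0 ?sqr_ge0// ltW.
    rewrite inE /survive/= => Mh.
    have Sh := le_trans (le_max_partial_sum X n w) Mh.
    have : n%:R * `|mu| / 2 <= `|S n w - n%:R * mu|.
      rewrite distrC; apply: le_trans (lerB_dist _ _).
      by rewrite normrM (ger0_norm (ltW np)); lra.
    have z0 : 0 <= n%:R * `|mu| / 2 by rewrite divr_ge0// mulr_ge0// ltW.
    move=> hh; have : (n%:R * `|mu| / 2) ^+ 2 <= `|S n w - n%:R * mu| ^+ 2 by rewrite lerXn2r// nnegrE.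
    rewrite real_normK ?num_real// !exprMn real_normK ?num_real// => h4.
    rewrite /k mulrAC ler_pdivlMr// mul1r.
    move: h4; rewrite exprVn (_ : 2 ^+ 2 = 4 :> R); last by ring.
    by set z := _ * mu ^+ 2; set y := (S n w - _) ^+ 2; lra.
rewrite /Ex RintegralZl// -/(Ex P _) e -/v le_eqVlt; apply/orP; left; apply/eqP.
by rewrite /k; field; rewrite mu0 gt_eqF.
Qed.

End Chebyshev.

(** [tail2] vanishes together with the second moment, so the characteristic function is [1] at [t]
    and [killed_cos_pow] leaves only an arbitrarily small [eta]. *)
Lemma psurv_degenerate : P.-integrable setT (EFin \o (fun w => X0 w ^+ 2)) ->
  E X0 = 0 -> var0 X = 0 -> forall n h, 0 < h -> psurv n h = 1.
Proof.
move=> X2int EX0 v0 n h h0.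
pose t := pi / 2 / h.
have t0 : 0 < t by rewrite !divr_gt0// pi_gt0.
have T0 : tail2 X t = 0.
  apply/eqP; rewrite eq_le tail2_ge0 andbT -v0.
  apply: le_Rintegral => //; first exact: tail2_integrable.
  by move=> w _; rewrite ler_piMr ?sqr_ge0// ge_min lexx.
have c1 : chr_cos X t = 1.
  have := chr_cos_approx X2int (ltW t0); rewrite v0 T0 !mulr0 mul0r addr0 normr_le0 subr_eq0.
  by move/eqP.
have s0 : chr_sin X t = 0.
  by have := chr_sin_approx X2int (ltW t0) EX0; rewrite T0 !mulr0 normr_le0 => /eqP.
have th : cos (t * h) = 0 by rewrite /t divfK ?cos_pihalf// gt_eqF.
apply/eqP; rewrite eq_le psurv_le1/=.
apply/ler_addgt0Pr => eta eta0.
have m0 : 0 < Num.min 1 eta <= 1 by rewrite lt_min ltr01 eta0 ge_min lexx.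
have := killed_cos_pow iidX X2int n t0 (ltW h0) th m0.
rewrite s0 T0 normr0 mulr0 mul0r addr0 mulr0 add0r c1 expr1n ler_norml => /andP[k1 _].
have k2 : killed_cos X t n h <= psurv n h.
  rewrite psurvE; apply: le_Ex.
  - by apply: bddmeasM; [exact: bddmeas_survive|exact: bddmeas_cosS].
  - exact: bddmeas_survive.
  - by move=> w; rewrite ler_piMr ?cos_le1.
have k3 : Num.min 1 eta <= eta by rewrite ge_min lexx orbT.
by lra.
Qed.

End CharacteristicModulus.

(** * The normalized series for the walk, and both implications *)

Section Assembly.
Context {d : measure_display} {T : measurableType d} {R : realType}.
Variables (P : probability T R) (X : nat -> {RV P >-> R}).
Hypothesis iidX : iid X.
Local Notation E := (Ex P).
Local Notation X0 := (X 0%N).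
Local Notation psurv := (psurv X).
Local Notation chr2 t := (chr_cos X t ^+ 2 + chr_sin X t ^+ 2).

(** Verbatim the function under the limit in [precise_chung_asymptotics], to be folded there. *)
Definition chung_sum (b sigma eps : R) : \bar R :=
  ((eps `^ (- 2 * (b + 1)))%:E *
     \sum_(1 <= n <oo)
       ((loglog n%:R `^ b / (n%:R * logt n%:R))%:E *
        P [set w | (max_partial_sum X n w <= sigma * phi n%:R * eps)%R]))%E.

Definition height (sigma eps : R) (n : nat) : R := sigma * phi n%:R * eps.

Lemma logt_le (x : R) : 1 <= x -> logt x <= x.
Proof.
move=> x1; rewrite /logt; have [ex|xe] := leP x (expR 1).
  by rewrite expRK.
have x0 : 0 < x by apply: lt_le_trans x1.
by have := expR_ge1Dx (ln x); rewrite lnK ?posrE//; lra.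
Qed.

Lemma llog_le n : (0 < n)%N -> llog n <= n%:R :> R.
Proof.
move=> n0; rewrite /llog /loglog; apply: (@le_trans _ _ (logt n%:R)).
  by apply: logt_le; exact: logt_ge1.
by apply: logt_le; rewrite ler1n.
Qed.

Lemma expR_llog_le n : (0 < n)%N -> expR (llog n) <= expR 1 * n%:R :> R.
Proof.
move=> n0; have n1 : 1 <= n%:R :> R by rewrite ler1n.
have e1 : 1 <= expR 1 :> R by rewrite -expR0 ler_expR.
have e0 : 0 < expR 1 :> R := expR_gt0 _.
rewrite /llog /loglog {1}/logt lnK ?posrE; last by rewrite lt_max e0 orbT.
rewrite ge_max; apply/andP; split; last by rewrite ler_peMr// ltW.
by apply: le_trans (logt_le n1) _; rewrite ler_peMl.
Qed.

Lemma height_sqr sigma eps n : height sigma eps n ^+ 2 = sigma ^+ 2 * eps ^+ 2 * (pi ^+ 2 * n%:R / (8 * llog n)).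
Proof.
rewrite /height !exprMn /phi sqr_sqrtr; first by rewrite /llog; ring.
have y0 : 0 < loglog n%:R :> R := llog_gt0 n.
by apply: divr_ge0; apply: mulr_ge0 => //; [exact: sqr_ge0|exact: ltW].
Qed.

Lemma height_gt0 sigma eps n : 0 < sigma -> 0 < eps -> (0 < n)%N -> 0 < height sigma eps n.
Proof.
move=> s0 e0 n0; rewrite /height !mulr_gt0// /phi sqrtr_gt0.
have y0 : 0 < loglog n%:R :> R := llog_gt0 n.
by apply: divr_gt0; apply: mulr_gt0; rewrite ?exprn_gt0 ?pi_gt0 ?ltr0n.
Qed.

(** Uniform over [n >= 1] since [llog n <= n]: a large [eps] makes all levels large at once,
    including those of small [n]. *)
Lemma height_sqr_ge sigma eps n : (0 < n)%N -> sigma ^+ 2 * eps ^+ 2 / 2 <= height sigma eps n ^+ 2.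
Proof.
move=> n0; rewrite height_sqr; apply: ler_wpM2l; first by rewrite mulr_ge0 ?sqr_ge0.
have y0 := @llog_gt0 R n; have yn := llog_le n0.
have p2 : 2 ^+ 2 <= pi ^+ 2 :> R by rewrite lerXn2r ?nnegrE ?pi_ge2 ?pi_ge0.
rewrite ler_pdivlMr ?mulr_gt0//.
apply: (@le_trans _ _ (2 ^+ 2 * n%:R)); last by rewrite ler_wpM2r.
by rewrite (_ : 2 ^+ 2 = 4 :> R); [lra|ring].
Qed.

Lemma nneseries_EFin b (f : nat -> R) : summable_w b f ->
  (\sum_(1 <= n <oo) (weight b n * f n)%:E = (limn (series (fun n => weight b n * f n)))%:E)%E.
Proof.
move=> sf; rewrite -EFin_lim//; congr (limn _); apply/funext => N.
rewrite /series/= -sumEFin; case: N => [|N]; first by rewrite !big_geq.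
by rewrite [RHS]big_ltn// weight0 mul0r add0e.
Qed.

Lemma chung_sumE b sigma eps : chung_sum b sigma eps =
  ((eps `^ (- 2 * (b + 1)))%:E * \sum_(1 <= n <oo) (weight b n * psurv n (height sigma eps n))%:E)%E.
Proof.
rewrite /chung_sum; congr (_ * _)%E; apply: eq_eseriesr => n _.
by rewrite [in RHS]EFinM EFin_psurv.
Qed.

Lemma eps_powE b (eps : R) : 0 < eps -> eps `^ (- 2 * (b + 1)) = (eps ^+ 2) `^ (- (b + 1)).
Proof.
by move=> e0; rewrite -powR_mulrn ?ltW// -powRrM; congr (_ `^ _); ring.
Qed.

Lemma chung_sum_EFin b sigma eps : 0 < eps -> summable_w b (fun n => psurv n (height sigma eps n)) ->
  chung_sum b sigma eps = (nsum b eps (fun n => psurv n (height sigma eps n)))%:E.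
Proof. by move=> e0 s; rewrite chung_sumE nneseries_EFin// -EFinM eps_powE. Qed.

(** The series of probabilities may be infinite here; this is the form needed for a degenerate
    walk. *)
Lemma chung_sum_ge b sigma eps f : 0 < eps -> summable_w b f ->
  (forall n, (0 < n)%N -> 0 <= f n <= psurv n (height sigma eps n)) ->
  ((nsum b eps f)%:E <= chung_sum b sigma eps)%E.
Proof.
move=> e0 sf h; rewrite chung_sumE /nsum EFinM -nneseries_EFin// eps_powE//.
apply: lee_wpmul2l; first by rewrite lee_fin powR_ge0.
apply: lee_nneseries => -[|n] _; rewrite ?weight0 ?mul0r// lee_fin.
- by have /andP[f0 _] := h n.+1 isT; rewrite mulr_ge0// weight_ge0.
- by have /andP[_ fp] := h n.+1 isT; rewrite ler_wpM2l// weight_ge0.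
Qed.

Lemma precise_to_eps b sigma : precise_chung_asymptotics X b sigma ->
  forall eta, 0 < eta -> exists2 E0 : R, 0 < E0 & forall eps, E0 <= eps ->
    exists2 j, chung_sum b sigma eps = j%:E & `|j - chung_constant b| <= eta.
Proof.
move=> /fine_cvgP[[A [_ hA]] /cvgrPdist_le hB] eta eta0.
have [B [_ hB']] := hB _ eta0.
exists (Num.max 1 (Num.max (A + 1) (B + 1))); first by rewrite lt_max ltr01.
move=> eps; rewrite !ge_max => /and3P[_ hAe hBe].
exists (fine (chung_sum b sigma eps)).
  by rewrite fineK//; apply: hA; lra.
by rewrite distrC; apply: hB'; lra.
Qed.

Lemma eps_to_precise b sigma : (forall eta, 0 < eta -> exists2 E0 : R, 0 < E0 & forall eps, E0 <= eps ->
    exists2 j, chung_sum b sigma eps = j%:E & `|j - chung_constant b| <= eta) ->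
  precise_chung_asymptotics X b sigma.
Proof.
move=> h; apply/fine_cvgP; split.
  have [E0 E00 hE] := h _ ltr01; exists E0; split; first exact: num_real.
  by move=> eps /ltW /hE [j jE _]; rewrite -/(chung_sum b sigma eps) jE.
apply/cvgrPdist_le => eta eta0; have [E0 E00 hE] := h _ eta0.
exists E0; split; first exact: num_real.
by move=> eps /ltW /hE [j jE jC]; rewrite /= -/(chung_sum b sigma eps) jE/= distrC.
Qed.

(* The rate [8 / (36 pi^2 sigma^2)] obtained from [psurv_tail] at [h = sigma phi(n) eps]. *)
Definition tail_rate sigma : R := 2 / (9 * pi ^+ 2 * sigma ^+ 2).

Lemma tail_rate_gt0 sigma : 0 < sigma -> 0 < tail_rate sigma.
Proof. by move=> s0; rewrite /tail_rate divr_gt0// !mulr_gt0 ?exprn_gt0 ?pi_gt0. Qed.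

(** Once [eps] is large, the conditions of [psurv_tail] on the level hold for all [n >= 1]
    simultaneously, so no index is exceptional. *)
Lemma psurv_height_tail sigma kappa : 0 < sigma -> 0 < kappa ->
  (exists2 t0, 0 < t0 & forall t, 0 < t <= t0 -> chr2 t <= 1 - kappa * t ^+ 2) ->
  exists2 E0 : R, 0 < E0 & forall eps n, E0 <= eps -> (0 < n)%N ->
    psurv n (height sigma eps n) <= 2 * expR (- (kappa * tail_rate sigma * (llog n / eps ^+ 2))).
Proof.
move=> s0 k0 [t0 t00 ht]; have pi0 := pi_gt0 R.
have [E0 E00 hE] := sqr_unbounded (2 / sigma ^+ 2 * Num.max kappa (t0^-1 ^+ 2)).
exists E0 => // eps n Ee n0; have {}hE := hE _ Ee.
have e0 : 0 < eps by apply: lt_le_trans Ee.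
have h0 := height_gt0 s0 e0 n0; have h2 := height_sqr_ge sigma eps n0.
set h := height sigma eps n in h0 h2 *.
have s2 : 0 < sigma ^+ 2 by rewrite exprn_gt0.
have hm : Num.max kappa (t0^-1 ^+ 2) <= h ^+ 2.
  apply: le_trans h2; rewrite ler_pdivlMr// [sigma ^+ 2 * _]mulrC -ler_pdivrMr//.
  by rewrite [_ * 2]mulrC mulrAC.
move: hm; rewrite ge_max => /andP[kh th].
have th' : t0^-1 <= h.
  by move: th; rewrite ler_pXn2r ?nnegrE ?invr_ge0 ?(ltW t00) ?(ltW h0).
have := psurv_tail iidX k0 t00 ht h0 th' kh n.
rewrite height_sqr (_ : kappa * _ / _ = kappa * tail_rate sigma * (llog n / eps ^+ 2))//.
have y0 := @llog_gt0 R n; have np : 0 < n%:R :> R by rewrite ltr0n.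
rewrite /tail_rate; move: pi0; generalize (@pi R) => p p0; field.
by rewrite !gt_eqF.
Qed.

Lemma exp_small (c A eta : R) : 0 < c -> 0 <= A -> 0 < eta -> exists2 K, 1 <= K & A * expR (- (c * K)) <= eta.
Proof.
move=> c0 A0 eta0; exists (Num.max 1 (A / (eta * c))); first by rewrite le_max lexx.
set K := Num.max _ _.
have K1 : 1 <= K by rewrite le_max lexx.
have KA : A / (eta * c) <= K by rewrite le_max lexx orbT.
rewrite expRN ler_pdivrMr ?expR_gt0//.
apply: (@le_trans _ _ (eta * (c * K))); last by rewrite ler_pM2l//; have := expR_ge1Dx (c * K); lra.
by rewrite mulrA -ler_pdivrMl ?mulr_gt0// mulrC.
Qed.

(** The probabilities are replaced by a finite theta sum at [u = llog n / eps^2], whose normalized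
    series has a known limit; the difference is dominated, for every [n >= 1], by three exponentials
    with small normalized sums. *)
Lemma direct_limit b sigma : -1 < b -> 0 < sigma ->
  P.-integrable setT (EFin \o (fun w => X0 w ^+ 2)) -> E X0 = 0 -> var0 X = sigma ^+ 2 ->
  forall eta, 0 < eta -> exists2 E0 : R, 0 < E0 & forall eps, E0 <= eps ->
    exists2 j, chung_sum b sigma eps = j%:E & `|j - chung_constant b| <= eta.
Proof.
move=> b1 s0 X2int EX0 vE eta eta0; have pi0 := pi_gt0 R.
have s2 : 0 < sigma ^+ 2 by rewrite exprn_gt0.
have v0 : 0 < var0 X by rewrite vE.
have G0 := Gamma_gt0 b1; set G := Gamma (b + 1) in G0.
have k0 : 0 < var0 X / 4 by rewrite divr_gt0.
have [E1 E10 htail] := psurv_height_tail s0 k0 (chr2_finite_variance X2int EX0 v0).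
(* The cap [1] gives [expR (- u) <= expR (- (c * u))], so the bound on the theta sum decays at the
   same rate as the one on the probability. *)
pose c := Num.min 1 (var0 X / 4 * tail_rate sigma).
have c0 : 0 < c by rewrite lt_min ltr01 mulr_gt0// tail_rate_gt0.
have c1 : c <= 1 by rewrite ge_min lexx.
have cc : c <= var0 X / 4 * tail_rate sigma by rewrite ge_min lexx orbT.
have c20 : 0 < c / 2 by rewrite divr_gt0.
(* The comparison costs [4 e], the limit of the theta series [e], and its truncation to [M] terms
   [e]; the rest is slack. *)
pose e := eta / 8; have e0 : 0 < e by rewrite divr_gt0.
(* Half of the rate [c] makes the contribution of [u > K] small, the other half keeps it
   summable. *)
have [K K1 hK] := @exp_small (c / 2) (4 * (c / 2) `^ (- (b + 1)) * G) e c20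
  (mulr_ge0 (mulr_ge0 (ler0n R 4) (powR_ge0 _ _)) (ltW G0)) e0.
have K0 : 0 < K by apply: lt_le_trans K1.
(* For [u < 1 / D] the trivial bound [3] is at most [3 e^(1 - D u)], whose normalized sum is of
   order [D^(-(b+1))]. *)
have [D D1 hD] := powR_small b1 (3 * expR 1 * G) e0.
have D0 : 0 < D by apply: lt_le_trans D1.
have {}hD := hD D (lexx _).
pose A := expR 1 * K^-1 `^ (- (b + 1)) * G.
have A0 : 0 < A by rewrite !mulr_gt0 ?expR_gt0// powR_gt0// invr_gt0.
pose e1 := e / A; have e10 : 0 < e1 by rewrite divr_gt0.
have D'0 : 0 < D^-1 by rewrite invr_gt0.
have [M0 hM0] := erdos_kac iidX X2int K EX0 v0 D'0 e10.
have [M M0M hM] : exists2 M, (M0 <= M)%N & `|G * chung_partial b M - chung_constant b| <= e.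
  have [/cvgrPdist_le /(_ _ e0) [N _ hN] _] := chung_partial_cvg b1.
  exists (maxn M0 N); first exact: leq_maxl.
  by rewrite distrC; apply: hN; exact: leq_maxr.
have [n0 hn0] := hM0 M M0M.
pose cP (k : nat) : R := 4 / pi * ((-1) ^+ k * 1 ^+ (2 * k + 1) / (2 * k + 1)%:R).
pose lP (k : nat) : R := (2 * k + 1)%:R ^+ 2.
have lP0 k : 0 < lP k by rewrite /lP exprn_gt0// ltr0n addn1.
have [E2 E20 hP] := nsum_expcomb_limit b1 cP M lP0 e0.
(* The three terms dominate the error for [D^-1 <= u <= K], [u < D^-1] and [u > K]. *)
pose cR := nth 0 [:: e1 * expR 1; 3 * expR 1; 4 * expR (- (c / 2 * K))].
(* The default [1] keeps the rates positive at all indices. *)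
pose lR := nth 1 [:: K^-1; D; c / 2].
have lR0 k : 0 < lR k.
  by case: k => [|[|[|k]]]; rewrite /lR/= ?invr_gt0// nth_nil.
have [E3 E30 hR] := nsum_expcomb_limit b1 cR 3 lR0 e0.
(* This forces [n >= n0] as soon as [u >= 1 / D], because [llog n <= n]. *)
have [E4 E40 hE4] := @sqr_unbounded R (n0%:R * D + 1).
have [E5 E50 hC] := nsum_exp_limit b1 c0 ltr01.
exists (Num.max E1 (Num.max E2 (Num.max E3 (Num.max E4 E5)))); first by rewrite lt_max E10.
move=> eps; rewrite !ge_max => /and5P[hE1 /hP[sP limP] /hR[sR limR] /hE4 hE4' /hC[sC _]].
have eps0 : 0 < eps by apply: lt_le_trans hE1.
have eps20 : 0 < eps ^+ 2 by rewrite exprn_gt0.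
pose u n := llog n / eps ^+ 2.
have u0 n : 0 < u n by rewrite divr_gt0// llog_gt0.
pose p n := psurv n (height sigma eps n).
have p01 n : 0 <= p n <= 1 by rewrite psurv_ge0 psurv_le1.
have ptail n : (0 < n)%N -> p n <= 2 * expR (- (c * u n)).
  move=> np; apply: le_trans (htail eps n hE1 np) _.
  by rewrite ler_pM2l// ler_expR lerN2 ler_pM2r.
have PE n : \sum_(k < M) cP k * expR (- (lP k * (llog n / eps ^+ 2))) = theta_sum 1 M (u n).
  by rewrite /theta_sum mulr_sumr; apply: eq_bigr => k _; rewrite /cP !mulrA.
have RE n : \sum_(k < 3) cR k * expR (- (lR k * (llog n / eps ^+ 2))) =
    e1 * expR 1 * expR (- (K^-1 * u n)) + 3 * expR 1 * expR (- (D * u n)) + 4 * expR (- (c / 2 * K)) * expR (- (c / 2 * u n)).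
  by rewrite !big_ord_recr/= big_ord0 add0r.
have sp : summable_w b p.
  apply: (@summable_w_le _ _ _ (fun n => 2 * expR (- (c * u n)))); last exact: summable_wZ.
  by move=> n np; have /andP[-> _] := p01 n; exact: ptail.
have ratioE n : (0 < n)%N -> ratio X n (height sigma eps n) = u n.
  move=> np; have y0 := @llog_gt0 R n; have npR : 0 < n%:R :> R by rewrite ltr0n.
  rewrite /ratio height_sqr vE /u; move: pi0; generalize (@pi R) => q q0; field.
  by rewrite !gt_eqF.
have dist n : (0 < n)%N -> `|p n - theta_sum 1 M (u n)| <= \sum_(k < 3) cR k * expR (- (lR k * (llog n / eps ^+ 2))).
  move=> np; rewrite RE.
  have /andP[p0 p1] := p01 n.
  have /andP[th0 th2] := theta_sum_bounds M (ltW (u0 n)).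
  have a0 : 0 <= e1 * expR 1 * expR (- (K^-1 * u n)).
    by apply: mulr_ge0; [apply: mulr_ge0; [exact: ltW|exact: expR_ge0]|exact: expR_ge0].
  have a1 : 0 <= 3 * expR 1 * expR (- (D * u n)) by rewrite !mulr_ge0 ?expR_ge0.
  have a2 : 0 <= 4 * expR (- (c / 2 * K)) * expR (- (c / 2 * u n)) by rewrite !mulr_ge0 ?expR_ge0.
  have e_u : expR (- u n) <= 1 by rewrite -expR0 ler_expR oppr_le0 ltW.
  have exp1 x : x <= 1 -> 1 <= expR 1 * expR (- x) :> R.
    by move=> x1; rewrite -expRD -[leLHS]expR0 ler_expR subr_ge0.
  have [uD|Du] := ltP (u n) D^-1.
    have hDu : D * u n <= 1 by rewrite mulrC -ler_pdivlMr// div1r ltW.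
    have := exp1 _ hDu => h.
    apply: (@le_trans _ _ 3); first by rewrite ler_norml; apply/andP; split; lra.
    by rewrite -(mulrA 3) in a1 *; lra.
  have [uK|Ku] := leP (u n) K.
    have nn0 : (n0 <= n)%N.
      rewrite leqNgt; apply/negP => nn.
      have : u n < D^-1; last by rewrite ltNge Du.
      rewrite /u ltr_pdivrMr// mulrC ltr_pdivlMr//.
      apply: lt_le_trans hE4'; apply: le_lt_trans (_ : n0%:R * D < _); last by rewrite ltrDl.
      by rewrite ler_pM2r//; apply: le_trans (llog_le np) _; rewrite ler_nat ltnW.
    have hn := hn0 n _ nn0 (height_gt0 s0 eps0 np).
    rewrite ratioE// Du uK in hn; have {}hn := hn isT.
    have hKu : K^-1 * u n <= 1 by rewrite mulrC ler_pdivrMr// mul1r.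
    have := exp1 _ hKu => h.
    have : e1 * 1 <= e1 * (expR 1 * expR (- (K^-1 * u n))) by rewrite ler_pM2l.
    by rewrite mulr1 mulrA; move: hn; rewrite -/(p n); lra.
  have h1 : expR (- (c * u n)) <= expR (- (c / 2 * K)) * expR (- (c / 2 * u n)).
    rewrite -expRD ler_expR.
    have : c / 2 * K <= c / 2 * u n by rewrite ler_pM2l// ltW.
    by lra.
  have h2 : expR (- u n) <= expR (- (c * u n)) by rewrite ler_expR lerN2 ler_piMl// ltW.
  have h3 := ptail n np.
  rewrite -(mulrA 4) in a2 *.
  by rewrite ler_norml; apply/andP; split; lra.
have sP' : summable_w b (fun n => theta_sum 1 M (u n)).
  by move: sP; congr (summable_w _ _); apply/funext => n; exact: PE.
exists (nsum b eps p); first exact: chung_sum_EFin.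
have nd := nsum_dist eps sp sP' sR dist.
have limP' : `|nsum b eps (fun n => theta_sum 1 M (u n)) - G * chung_partial b M| <= e.
  move: limP; congr (`|nsum _ _ _ - _| <= _).
  by apply/funext => n; exact: PE.
have limR' : nsum b eps (fun n => \sum_(k < 3) cR k * expR (- (lR k * (llog n / eps ^+ 2)))) <= 4 * e.
  move: limR; rewrite ler_norml => /andP[_].
  have : Gamma (b + 1) * \sum_(k < 3) cR k * lR k `^ (- (b + 1)) <= 3 * e.
    rewrite !big_ord_recr/= big_ord0 add0r -/G.
    have r1 : G * (e1 * expR 1 * K^-1 `^ (- (b + 1))) = e.
      transitivity (e1 * A); first by rewrite /A; ring.
      by rewrite /e1 divfK// lt0r_neq0.
    have r2 : G * (3 * expR 1 * D `^ (- (b + 1))) <= e.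
      by apply: le_trans hD; rewrite le_eqVlt; apply/orP; left; apply/eqP; ring.
    have r3 : G * (4 * expR (- (c / 2 * K)) * (c / 2) `^ (- (b + 1))) <= e.
      by apply: le_trans hK; rewrite le_eqVlt; apply/orP; left; apply/eqP; ring.
    by apply: le_trans (_ : G * (e1 * expR 1 * K^-1 `^ (- (b + 1))) + G * (3 * expR 1 * D `^ (- (b + 1))) + G * (4 * expR (- (c / 2 * K)) * (c / 2) `^ (- (b + 1))) <= _); [rewrite -!mulrDr|lra].
  by lra.
have eE : eta = 8 * e by rewrite /e; field.
move: nd limP' hM limR'; rewrite !ler_norml => /andP[? ?] /andP[? ?] /andP[? ?] ?.
by apply/andP; split; lra.
Qed.

(** Here [llog n >= eps^2 / D] exceeds [2], so the outer truncation of [loglog] is inactive and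
    [n >= e^(llog n) >= (llog n)^2 / 4], which is at least of order [eps^4] and beats [A eps^2]. *)
Lemma large_eps (D A : R) : 0 < D -> exists2 E0 : R, 0 < E0 & forall eps n, E0 <= eps -> (0 < n)%N ->
  1 <= D * (llog n / eps ^+ 2) -> A * eps ^+ 2 <= n%:R.
Proof.
move=> D0.
have [E0 E00 hE] := @sqr_unbounded R (Num.max (2 * D) (D ^+ 2 * 4 * `|A|) + 1).
exists E0 => // eps n Ee n0 h; have {}hE := hE _ Ee.
have e2 : 0 < eps ^+ 2 by rewrite exprn_gt0// (lt_le_trans E00).
have e2D : eps ^+ 2 <= D * llog n by move: h; rewrite mulrA ler_pdivlMr// mul1r.
have m1 : 2 * D < eps ^+ 2.
  by apply: lt_le_trans hE; rewrite ltr_pwDr// le_max lexx.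
have m2 : D ^+ 2 * 4 * `|A| <= eps ^+ 2.
  by apply: le_trans hE; rewrite ler_wpDr// le_max lexx orbT.
have y2 : 2 < llog n :> R by rewrite -(ltr_pM2l D0); lra.
have y0 := @llog_gt0 R n; have yn := llog_le n0.
have n2 : 2 < n%:R :> R by apply: lt_le_trans yn.
have n3 : 3 <= n%:R :> R by rewrite ler_nat; move: n2; rewrite ltr_nat.
have yexp : expR (llog n) <= n%:R :> R.
  have l2 : expR 1 < logt (n%:R : R).
    rewrite ltNge; apply/negP => le1; move: y2.
    by rewrite /llog /loglog {1}/logt max_r// expRK; lra.
  rewrite /llog /loglog logtE ?lnK ?posrE ?(lt_trans _ l2) ?expR_gt0//; last exact: ltW.
  by apply: logt_le; rewrite ler1n.
have yy : llog n ^+ 2 / 4 <= n%:R :> R.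
  apply: le_trans yexp; have -> : expR (llog n) = expR (llog n / 2) ^+ 2 :> R.
    by rewrite -expRM_natl; congr expR; field.
  have := expR_ge1Dx (llog n / 2 : R) => k.
  have : (llog n / 2) ^+ 2 <= expR (llog n / 2) ^+ 2 :> R.
    rewrite lerXn2r ?nnegrE ?expR_ge0 ?divr_ge0 ?(ltW y0)//; lra.
  by rewrite exprMn exprVn (_ : 2 ^+ 2 = 4 :> R)//; ring.
apply: le_trans yy.
have A4 : A * eps ^+ 2 * (D ^+ 2 * 4) <= (D * llog n) ^+ 2.
  apply: (@le_trans _ _ (eps ^+ 2 * eps ^+ 2)).
    rewrite (_ : A * _ * _ = D ^+ 2 * 4 * A * eps ^+ 2); last by ring.
    rewrite ler_pM2r//; apply: le_trans m2.
    by apply: ler_wpM2l; [apply: mulr_ge0 => //; exact: sqr_ge0 | exact: ler_norm].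
  by rewrite expr2; apply: ler_pM => //; exact: ltW.
have D2 : 0 < D ^+ 2 by rewrite exprn_gt0.
rewrite -(ler_pM2l D2); move: A4; rewrite exprMn.
by set x := A * _; set y := llog n ^+ 2; set z := D ^+ 2; lra.
Qed.

Lemma limit_not_small b sigma : -1 < b -> precise_chung_asymptotics X b sigma ->
  ~ (forall eta, 0 < eta -> exists2 E0 : R, 0 < E0 & forall eps, E0 <= eps -> (chung_sum b sigma eps <= eta%:E)%E).
Proof.
move=> b1 /precise_to_eps lim small.
have [_ C0] := chung_partial_cvg b1.
have c4 : 0 < chung_constant b / 4 by rewrite divr_gt0.
have [E1 _ h1] := lim _ c4; have [E2 _ h2] := small _ c4.
have m1 : E1 <= Num.max E1 E2 by rewrite le_max lexx.
have m2 : E2 <= Num.max E1 E2 by rewrite le_max lexx orbT.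
have [j jE] := h1 _ m1; have := h2 _ m2.
rewrite jE lee_fin ler_norml => j4 /andP[? ?]; lra.
Qed.

Lemma limit_not_large b sigma : precise_chung_asymptotics X b sigma ->
  ~ (forall A : R, exists2 E0 : R, 0 < E0 & forall eps, E0 <= eps -> (A%:E <= chung_sum b sigma eps)%E).
Proof.
move=> /precise_to_eps lim large.
have [E1 _ h1] := lim _ ltr01; have [E2 _ h2] := large (chung_constant b + 2).
have m1 : E1 <= Num.max E1 E2 by rewrite le_max lexx.
have m2 : E2 <= Num.max E1 E2 by rewrite le_max lexx orbT.
have [j jE] := h1 _ m1; have := h2 _ m2.
rewrite jE lee_fin ler_norml => j4 /andP[? ?]; lra.
Qed.

Lemma converse_square_integrable b sigma : -1 < b -> 0 < sigma -> precise_chung_asymptotics X b sigma ->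
  P.-integrable setT (EFin \o (fun w => X0 w ^+ 2)).
Proof.
move=> b1 s0 lim; apply: contrapT => ninf; apply: (limit_not_small b1 lim) => eta eta0.
have G0 := Gamma_gt0 b1; have r0 := tail_rate_gt0 s0.
have [D D1 hD] := powR_small b1 (2 * Gamma (b + 1)) (divr_gt0 eta0 (ltr0n R 2)).
have D0 : 0 < D by apply: lt_le_trans D1.
(* The tail bound becomes [2 * expR (- (D * u))] at [u = llog n / eps^2], with [D] as large as
   desired; its normalized limit is [2 D^(-(b+1)) Gamma (b + 1)]. *)
pose kappa := D / tail_rate sigma.
have k0 : 0 < kappa by rewrite divr_gt0.
have [E1 E10 h1] := psurv_height_tail s0 k0 (chr2_infinite_variance ninf k0).
have [E2 E20 h2] := nsum_exp_limit b1 D0 (divr_gt0 eta0 (ltr0n R 4)).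
exists (Num.max E1 E2); first by rewrite lt_max E10.
move=> eps; rewrite ge_max => /andP[e1 /h2 [s lim2]].
have e0 : 0 < eps by apply: lt_le_trans e1.
have pt n : (0 < n)%N -> 0 <= psurv n (height sigma eps n) <= 2 * expR (- (D * (llog n / eps ^+ 2))).
  move=> n0; rewrite psurv_ge0/=; have := h1 eps n e1 n0.
  by rewrite /kappa divfK// gt_eqF.
have sp := summable_w_le pt (summable_wZ (c := 2) s).
rewrite chung_sum_EFin// lee_fin.
apply: (@le_trans _ _ (nsum b eps (fun n => 2 * expR (- (D * (llog n / eps ^+ 2)))))).
  by apply: nsum_le => //; [exact: summable_wZ | move=> n /pt /andP[]].
rewrite nsumZ//; move: lim2; rewrite ler_norml => /andP[_].
by have := hD D (lexx _); lra.
Qed.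

(** Put [u = llog n / eps^2]. If [D u <= 1], the trivial bound [1] is at most [e^(1 - D u)], with
    small normalized sum. Otherwise [n] is so large compared with [eps^2] that the level is at most
    [n |E X| / 2], and Chebyshev's inequality gives [C / n], a majorant independent of [eps] and
    summable against the weights, which the normalization sends to [0]. *)
Lemma converse_centered b sigma : -1 < b -> 0 < sigma -> precise_chung_asymptotics X b sigma ->
  P.-integrable setT (EFin \o (fun w => X0 w ^+ 2)) -> E X0 = 0.
Proof.
move=> b1 s0 lim X2int; apply/eqP; apply/negPn/negP => mu0.
apply: (limit_not_small b1 lim) => eta eta0.
have G0 := Gamma_gt0 b1.
have [C C0 hC] := psurv_chebyshev iidX X2int mu0.
have e40 : 0 < eta / 4 by rewrite divr_gt0.
have [D D1 hD] := powR_small b1 (expR 1 * Gamma (b + 1)) e40.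
have D0 : 0 < D by apply: lt_le_trans D1.
have m2 : 0 < E X0 ^+ 2 by rewrite exprn_even_gt0.
have [E1 E10 h1] := large_eps (4 * sigma ^+ 2 * pi ^+ 2 / E X0 ^+ 2) D0.
have [E2 E20 h2] := nsum_exp_limit b1 D0 (divr_gt0 e40 (expR_gt0 1)).
(* This is [expR (- llog n)], in the shape of [expterm] at [T = 1]; it dominates [1 / n] up to the
   factor [e]. *)
pose f n : R := expR (- (1 * (llog n / 1 ^+ 2))).
have sf : summable_w b f.
  have fE : (fun n => weight b n * f n) = expterm b 1.
    by apply/funext => n; rewrite /expterm /f mul1r expr1n.
  by rewrite /summable_w fE; exact: expterm_cvg.
have [T0 T01 hT] := powR_small b1 (expR 1 * C * limn (series (fun n => weight b n * f n))) e40.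
have [E3 E30 h3] := @sqr_unbounded R T0.
exists (Num.max E1 (Num.max E2 E3)); first by rewrite lt_max E10.
move=> eps; rewrite !ge_max => /and3P[e1 /h2 [s lim2] /h3 h3']; have lim3 := hT _ h3'.
have e0 : 0 < eps by apply: lt_le_trans e1.
pose g n : R := expR 1 * expR (- (D * (llog n / eps ^+ 2))) + expR 1 * C * f n.
have sg : summable_w b g by apply: summable_wD; exact: summable_wZ.
have pt n : (0 < n)%N -> 0 <= psurv n (height sigma eps n) <= g n.
  move=> n0; rewrite psurv_ge0/= /g.
  have f0 : 0 <= expR 1 * C * f n by rewrite !mulr_ge0// expR_ge0.
  have [uD|Du] := leP (D * (llog n / eps ^+ 2)) 1.
    apply: (@le_trans _ _ 1); first exact: psurv_le1.
    rewrite -[leLHS]addr0; apply: lerD => //.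
    by rewrite -expRD -[leLHS]expR0 ler_expR subr_ge0.
  have A := h1 eps n e1 n0 (ltW Du).
  have np : 0 < n%:R :> R by rewrite ltr0n.
  have hh : 2 * height sigma eps n <= n%:R * `|E X0|.
    have hp := height_gt0 s0 e0 n0.
    have : (2 * height sigma eps n) ^+ 2 <= (n%:R * `|E X0|) ^+ 2.
      rewrite exprMn height_sqr [leRHS]exprMn real_normK ?num_real//.
      have A' : 4 * sigma ^+ 2 * pi ^+ 2 * eps ^+ 2 <= n%:R * E X0 ^+ 2.
        by move: A; rewrite mulrAC ler_pdivrMr.
      rewrite (_ : n%:R ^+ 2 * E X0 ^+ 2 = n%:R * (n%:R * E X0 ^+ 2)); last by ring.
      apply: le_trans (ler_wpM2l (ltW np) A').
      pose B := 4 * sigma ^+ 2 * pi ^+ 2 * eps ^+ 2 * n%:R.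
      have B0 : 0 <= B.
        apply: mulr_ge0 => //; apply: mulr_ge0; last exact: sqr_ge0.
        apply: mulr_ge0; last exact: sqr_ge0.
        by apply: mulr_ge0 => //; exact: sqr_ge0.
      have y1 := @llog_ge1 R n; have y0 := @llog_gt0 R n.
      have -> : 2 ^+ 2 * (sigma ^+ 2 * eps ^+ 2 * (pi ^+ 2 * n%:R / (8 * llog n))) = B * (8 * llog n)^-1.
        by rewrite /B; ring.
      rewrite [leRHS](_ : _ = B); last by rewrite /B; ring.
      by rewrite ler_piMr// invf_le1 ?mulr_gt0//; lra.
    have hp2 : 0 <= 2 * height sigma eps n by apply: mulr_ge0 => //; exact: ltW.
    have np2 : 0 <= n%:R * `|E X0| by exact: mulr_ge0.
    by rewrite ler_pXn2r ?nnegrE.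
  apply: le_trans (hC n _ n0 hh) _.
  rewrite -[leLHS]add0r; apply: lerD; first by rewrite mulr_ge0 ?expR_ge0.
  rewrite ler_pdivrMr// [expR 1 * C]mulrC -!mulrA -[leLHS]mulr1 ler_wpM2l//.
  rewrite /f mul1r expr1n divr1 expRN mulrCA ler_pdivlMl ?expR_gt0// mulr1.
  exact: expR_llog_le.
have sp := summable_w_le pt sg.
rewrite chung_sum_EFin// lee_fin.
apply: (@le_trans _ _ (nsum b eps g)).
  by apply: nsum_le => // n /pt /andP[].
rewrite /g nsumD; [|exact: summable_wZ..].
rewrite nsumZ// (nsumZ _ _ sf).
have l3 : expR 1 * C * nsum b eps f <= eta / 4 by apply: le_trans lim3; rewrite /nsum mulrCA.
have l2 : expR 1 * nsum b eps (fun n => expR (- (D * (llog n / eps ^+ 2)))) <= eta / 4 + eta / 4.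
  move: lim2; rewrite ler_norml => /andP[_]; rewrite ler_pdivlMr ?expR_gt0//.
  by have := hD D (lexx _); set N := nsum _ _ _; lra.
by lra.
Qed.

(** A degenerate walk survives with probability [1], which dominates [expR (- (u / D))] at
    [u = llog n / eps^2] for every [D]; the normalized series of the latter tends to
    [D^(b+1) Gamma (b + 1)]. *)
Lemma converse_variance_gt0 b sigma : -1 < b -> 0 < sigma -> precise_chung_asymptotics X b sigma ->
  P.-integrable setT (EFin \o (fun w => X0 w ^+ 2)) -> E X0 = 0 -> 0 < var0 X.
Proof.
move=> b1 s0 lim X2int EX0.
have v0 : 0 <= var0 X by apply: Ex_ge0 => w; exact: sqr_ge0.
rewrite lt_neqAle v0 andbT eq_sym; apply/eqP => vE.
apply: (limit_not_large lim) => A; have G0 := Gamma_gt0 b1.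
have [D D1 hD] := powR_small b1 (`|A| + 1) G0.
have D0 : 0 < D by apply: lt_le_trans D1.
have Di : 0 < D^-1 by rewrite invr_gt0.
have [E1 E10 h1] := nsum_exp_limit b1 Di ltr01.
exists E1 => // eps e1; have [s l] := h1 eps e1.
have e0 : 0 < eps by apply: lt_le_trans e1.
apply: le_trans (chung_sum_ge e0 s _); last first.
  move=> n n0; rewrite expR_ge0/= (psurv_degenerate iidX X2int EX0 vE)//; last exact: height_gt0.
  by rewrite -expR0 ler_expR oppr_le0 mulr_ge0 ?divr_ge0 ?sqr_ge0 ?(ltW Di)// ltW// llog_gt0.
rewrite lee_fin; move: l; rewrite ler_norml => /andP[l _].
have p0 : 0 < D `^ (b + 1) by rewrite powR_gt0.
have key : `|A| + 1 <= D^-1 `^ (- (b + 1)) * Gamma (b + 1).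
  have -> : D^-1 `^ (- (b + 1)) = D `^ (b + 1).
    by rewrite -(powR_inv1 (ltW D0)) -powRrM mulN1r opprK.
  by have := hD D (lexx _); rewrite powRN mulrC ler_pdivrMr// mulrC.
by have := ler_norm A; lra.
Qed.

(** The direct part holds with [tau], the actual standard deviation. Since
    [sigma eps = tau (eps q)], both limits concern the same levels and force [q^(2(b+1)) C = C] with
    [C > 0], so [q = 1]. *)
Lemma converse_variance b sigma : -1 < b -> 0 < sigma -> precise_chung_asymptotics X b sigma ->
  P.-integrable setT (EFin \o (fun w => X0 w ^+ 2)) -> E X0 = 0 -> 0 < var0 X -> var0 X = sigma ^+ 2.
Proof.
move=> b1 s0 /precise_to_eps lim X2int EX0 v0.
pose tau := Num.sqrt (var0 X).
have t0 : 0 < tau by rewrite sqrtr_gt0.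
have tE : var0 X = tau ^+ 2 by rewrite sqr_sqrtr// ltW.
have dir := direct_limit b1 t0 X2int EX0 tE.
have [_ C0] := chung_partial_cvg b1; set C := chung_constant b in C0 lim dir.
pose q := sigma / tau.
have q0 : 0 < q by rewrite divr_gt0.
pose Q := q `^ (2 * (b + 1)).
have Q0 : 0 < Q by rewrite powR_gt0.
have resc eps : 0 < eps -> chung_sum b sigma eps = (Q%:E * chung_sum b tau (eps * q))%E.
  move=> e0; rewrite !chung_sumE muleA -EFinM; congr (_%:E * _)%E.
    rewrite powRM ?ltW// mulrCA /Q -powRD; last by apply/implyP => _; rewrite gt_eqF.
    by rewrite -mulrDl subrr mul0r powRr0 mulr1.
  apply: eq_eseriesr => n _; congr ((_ * psurv _ _)%:E).
  by rewrite /height /q; field; rewrite gt_eqF.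
have QC : Q * C = C.
  apply/eqP; rewrite -subr_eq0 -normr_le0; apply/ler_addgt0Pr => eta eta0.
  rewrite add0r.
  have Q1 : 0 < Q + 1 by rewrite addr_gt0.
  have d0 : 0 < eta / (Q + 1) by rewrite divr_gt0.
  have [E1 E10 h1] := lim _ d0; have [E2 E20 h2] := dir _ d0.
  pose eps := Num.max E1 (E2 / q).
  have e1 : E1 <= eps by rewrite le_max lexx.
  have e2 : E2 <= eps * q by rewrite -ler_pdivrMr// le_max lexx orbT.
  have e0 : 0 < eps by apply: lt_le_trans e1.
  have [j jE jC] := h1 _ e1; have [k kE kC] := h2 _ e2.
  have jk : j = Q * k by apply: EFin_inj; rewrite -jE resc// kE.
  have -> : Q * C - C = Q * (C - k) + (j - C) by rewrite jk; ring.
  apply: le_trans (ler_normD _ _) _; rewrite normrM (gtr0_norm Q0) (distrC C).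
  have : Q * `|k - C| <= Q * (eta / (Q + 1)) by rewrite ler_pM2l.
  have : eta = Q * (eta / (Q + 1)) + eta / (Q + 1) by field; rewrite gt_eqF.
  by lra.
have QE : Q = 1 by apply: (mulIf (lt0r_neq0 C0)); rewrite QC mul1r.
have : q = 1.
  have b2 : 2 * (b + 1) != 0 by rewrite lt0r_neq0// mulr_gt0// -ltrBlDr sub0r.
  move: QE; rewrite /Q => /eqP; rewrite powR_eq1 => /or3P[/eqP//| |/eqP h].
    by rewrite ltNge (ltW q0).
  by rewrite h eqxx in b2.
rewrite tE => /(congr1 (fun z => z * tau)); rewrite /q divfK ?gt_eqF// mul1r => ->.
by [].
Qed.

End Assembly.

Theorem theorem1p2 (R : realType) (d : measure_display) (T : measurableType d)
    (P : probability T R) (X : nat -> {RV P >-> R}) (hX : iid X) :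
  (forall sigma : R, 0 < sigma ->
     ('E_P[X 0%N] = 0)%E ->
     ('E_P[fun w => (X 0%N w ^+ 2)%R] = (sigma ^+ 2)%:E)%E ->
     forall b : R, -1 < b -> precise_chung_asymptotics X b sigma)
  /\
  (forall b sigma : R, -1 < b -> 0 < sigma ->
     precise_chung_asymptotics X b sigma ->
     ('E_P[X 0%N] = 0)%E /\
     ('E_P[fun w => (X 0%N w ^+ 2)%R] = (sigma ^+ 2)%:E)%E).
Proof.
(* A finite second moment in the extended reals gives integrability because the integrand is
   nonnegative. *)
have X2int_of (c : R) : ('E_P[fun w => (X 0%N w ^+ 2)%R] = c%:E)%E ->
    P.-integrable setT (EFin \o (fun w => X 0%N w ^+ 2)).
  rewrite unlock => h; apply/integrableP; split.
    by apply: measurableT_comp => //; exact: measurable_funX.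
  rewrite (_ : (\int[P]_x _ = \int[P]_x (X 0%N x ^+ 2)%:E)%E); first by rewrite h ltry.
  by apply: eq_integral => w _; rewrite /= ger0_norm ?sqr_ge0.
split.
- move=> sigma s0 m0 v0 b b1; have X2int := X2int_of _ v0.
  apply/eps_to_precise/(direct_limit hX b1 s0 X2int).
    by rewrite /Ex /Rintegral; move: m0; rewrite unlock => ->.
  by rewrite /var0 /Ex /Rintegral; move: v0; rewrite unlock => ->.
- move=> b sigma b1 s0 lim.
  have X2int := converse_square_integrable hX b1 s0 lim.
  have m0 := converse_centered hX b1 s0 lim X2int.
  have v0 := converse_variance_gt0 hX b1 s0 lim X2int m0.
  have vE := converse_variance hX b1 s0 lim X2int m0 v0.
  rewrite !unlock; split.
    have iX := X0_integrable X2int.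
    by rewrite -[LHS]fineK ?(integrable_fin_num _ iX)// -/(Rintegral P setT _) -/(Ex P _) m0.
  rewrite -[LHS]fineK ?(integrable_fin_num _ X2int)// -/(Rintegral P setT _) -/(Ex P _).
  by rewrite -/(var0 X) vE.
Qed.
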